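(* Assume ($\nu$0), ($\nu$1) with $\sigma\ne1$, (L1)–(L2), (F2), (H1), (M). Fix $M>0$ and consider parameters $\rho>0$, $h=T/N\in(0,1)$, $r\in(0,1)$, $\epsilon>0$ with $\rho^2/h\le M$ and $h/r^\sigma\le M$ if $\sigma\in(0,1)$, respectively $\rho^2/h\le M$ and $h\,r^{1-2\sigma}\le M$ if $\sigma\in(1,2)$. Then there exists $C_0>0$ such that for all such parameters, all $\mu\in C([0,T],P(\mathbb{R}^d))$ and all $t_1,t_2\in[0,T]$, $d_0\big(m^\epsilon_{\rho,h}[\mu](t_1),m^\epsilon_{\rho,h}[\mu](t_2)\big)\le C_0\sqrt{|t_1-t_2|}$.
   Context: $P(\mathbb{R}^d)$: Borel probability measures with metric $d_0(\mu_1,\mu_2)=\sup\{\int f\,d(\mu_1-\mu_2): f$ Lipschitz, $\|f\|_\infty\le1,\|Df\|_\infty\le1\}$. $\nu$ nonnegative Radon measure on $\mathbb{R}^d\setminus\{0\}$; $L$ Lagrangian, $H(x,p)=\sup_q\{p\cdot q-L(x,q)\}$; $F,G:\mathbb{R}^d\times P(\mathbb{R}^d)\to\mathbb{R}$; $m_0\in P(\mathbb{R}^d)$. ($\nu$0) $\int1\wedge|z|^2\nu(dz)<\infty$. ($\nu$1) $\exists\sigma\in(0,2),C>0$: $0\le\frac{d\nu}{dz}\le C|z|^{-d-\sigma}$ for $|z|<1$. (L1) $L(x,\cdot)$ convex, $L(x,q)/|q|\to\infty$. (L2) $|L(x,q)-L(y,q)|\le L_L|x-y|$. (F2) $|F(x,\mu_1)-F(y,\mu_2)|\le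 L_F(|x-y|+d_0(\mu_1,\mu_2))$, same for $G$. (H1) $D_pH$ continuous, $|D_pH(x,p)|\le C_R$ for $|p|\le R$. (M) $m_0\in P(\mathbb{R}^d)$. Discretization: $t_k=kh$, $x_i=i\rho$, $\beta_i(x)=\prod_l\max\{0,1-|x_l-(x_i)_l|/\rho\}$, $I[v]=\sum_iv_i\beta_i$; $b_r=\int_{r<|z|<1}z\nu(dz)$, $\sigma_r=(\frac12\int_{|z|<r}zz^T\nu(dz))^{1/2}$ with columns $\sigma_r^m$, $\lambda_r=\nu(\{|z|>r\})$, $\bar b(\alpha)=-\alpha-b_r$; $S_{\rho,h,r}[\mu](v,i,k)=\inf_{\alpha}\{hF(x_i,\mu(t_k))+hL(x_i,\alpha)+\frac{e^{-h\lambda_r}}{2d}\sum_{m=1}^d(I[v](x_i+h\bar b(\alpha)+\sqrt{hd}\sigma_r^m)+I[v](x_i+h\bar b(\alpha)-\sqrt{hd}\sigma_r^m))+\frac{1-e^{-h\lambda_r}}{\lambda_r}\int_{|z|\ge r}I[v](x_i+z)\nu(dz)\}$. Discrete HJB: $u_{i,N}=G(x_i,\mu(T))$, $u_{i,k}=S_{\rho,h,r}[\mu](u_{\cdot,k+1},i,k)$; $u_{\rho,h}[\mu](t,x)=\sum_i\beta_i(x)u_{i,[t/h]}$; $u^\epsilon_{\rho,h}[\mu]=u_{\rho,h}[\mu](t,\cdot)*\eta_\epsilon$ (standard mollifier). Discrete FPK: with $w=u^\epsilon_{\rho,h}[\mu]$, $\Phi^{\epsilon,\pm}_{j,k,p}=x_j-h(D_pH(x_j,Dw(t_k,x_j))+b_r)\pm\sqrt{hd}\sigma_r^p$,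 $\mathbf B(i,j,k)=\frac{e^{-h\lambda_r}}{2d}\sum_p(\beta_i(\Phi^{\epsilon,+}_{j,k,p})+\beta_i(\Phi^{\epsilon,-}_{j,k,p}))+\frac{1-e^{-h\lambda_r}}{\lambda_r}\int_{|z|>r}\beta_i(x_j+z)\nu(dz)$, $E_i=x_i+\frac\rho2(-1,1)^d$, $m_{i,0}=m_0(E_i)$, $m_{i,k+1}=\sum_jm_{j,k}\mathbf B(i,j,k)$; $m^\epsilon_{\rho,h}[\mu](t_k,x)=\rho^{-d}\sum_im_{i,k}\mathbb 1_{E_i}(x)$, linear in $t$ on $[t_k,t_{k+1}]$. *)

(* Defs.v *)
From HB Require Import structures.
From mathcomp Require Import all_boot all_order all_algebra.
From mathcomp Require Import all_classical all_reals all_analysis.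
Import Order.TTheory GRing.Theory Num.Theory.
Import numFieldNormedType.Exports.

Set Implicit Arguments.
Unset Strict Implicit.
Unset Printing Implicit Defensive.

Local Open Scope classical_set_scope.
Local Open Scope ring_scope.

Definition Rd (R : realType) (d : nat) := 'rV[R]_d.

Definition Rd_display : measure_display -> measure_display. Proof. exact. Qed.

Section Rd_instances.
Context {R : realType} (d : nat).
HB.instance Definition _ := NormedModule.copy (Rd R d) 'rV[R]_d.
HB.instance Definition _ := isPointed.Build (Rd R d) 0.
Let coor : 'I_d -> Rd R d -> R := fun i x => (x : 'rV[R]_d) ord0 i.
Let s0 : g_sigma_preimage coor set0. Proof. exact: sigma_algebra0. Qed.
Let sC A : g_sigma_preimage coor A -> g_sigma_preimage coor (~` A).
Proof. exact: sigma_algebraC. Qed.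
Let sU (F : (set (Rd R d))^nat) : (forall i, g_sigma_preimage coor (F i)) ->
  g_sigma_preimage coor (\bigcup_i (F i)).
Proof. exact: sigma_algebra_bigcup. Qed.
HB.instance Definition _ := @isMeasurable.Build (Rd_display default_measure_display)
  (Rd R d) (g_sigma_preimage coor) s0 sC sU.
End Rd_instances.

Section Scheme.
Context {R : realType} (d : nat).
Local Notation V := (Rd R d).

Definition coord (x : V) (l : 'I_d) : R := (x : 'rV[R]_d) ord0 l.
Definition dotv (p q : V) : R := \sum_(l < d) coord p l * coord q l.
Definition enorm (z : V) : R := Num.sqrt (dotv z z).
Definition unitv (l : 'I_d) : V := delta_mx ord0 l.

(* test functions: Lipschitz, |f| <= 1 and Lipschitz constant
   (= ||Df||_oo) <= 1 *)
Definition Lip1 (f : V -> R) : Prop :=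
  (forall x, `|f x| <= 1) /\ (forall x y, `|f x - f y| <= enorm (x - y)).

(* d_0 between two (finite) measures, each given through the integration
   functional f |-> \int f dmu *)
Definition d0gen (I1 I2 : (V -> R) -> R) : R :=
  sup [set I1 f - I2 f | f in Lip1].

Definition pint (mu : probability V R) (f : V -> R) : R :=
  fine (\int[mu]_x (f x)%:E)%E.

Definition d0 (mu1 mu2 : probability V R) : R := d0gen (pint mu1) (pint mu2).

Definition is_lebesgue_Rd (lam : {measure set V -> \bar R}) : Prop :=
  forall a b : V,
    lam [set x | forall l, coord a l < coord x l <= coord b l] =
    (\prod_(l < d) Num.max 0 (coord b l - coord a l))%:E.

Definition Ham (L : V -> V -> R) (x p : V) : R :=
  sup [set dotv p q - L x q | q in [set: V]].

Definition xg (rho : R) (i : 'rV[int]_d) : V := rho *: (map_mx intr i : V).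

Definition beta (rho : R) (i : 'rV[int]_d) (x : V) : R :=
  \prod_(l < d) Num.max 0 (1 - `|coord x l - coord (xg rho i) l| / rho).

(* I[v] = sum_i v_i beta_i  (finitely many nonzero terms at each x) *)
Definition interp (rho : R) (v : 'rV[int]_d -> R) (x : V) : R :=
  \sum_(i \in [set: 'rV[int]_d]) v i * beta rho i x.

Definition lam_r (nu : {measure set V -> \bar R}) (r : R) : R :=
  fine (nu [set z | r < enorm z]).

Definition b_r (nu : {measure set V -> \bar R}) (r : R) : V :=
  \row_(l < d) fine (\int[nu]_(z in [set z | (r < enorm z < 1)%R]) (coord z l)%:E)%E.

Definition cov_r (nu : {measure set V -> \bar R}) (r : R) : 'M[R]_d :=
  \matrix_(a < d, b < d)
    (2^-1 * fine (\int[nu]_(z in [set z | (enorm z < r)%R])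
                    (coord z a * coord z b)%:E)%E).

(* the (unique) symmetric positive semidefinite square root *)
Definition psd_sqrt (A : 'M[R]_d) : 'M[R]_d :=
  xget 0 [set S : 'M[R]_d | S^T = S /\
           (forall v : 'rV[R]_d, 0 <= (v *m S *m v^T) ord0 ord0) /\ S *m S = A].

Definition sigma_r (nu : {measure set V -> \bar R}) (r : R) : 'M[R]_d :=
  psd_sqrt (cov_r nu r).

Definition sigcol (nu : {measure set V -> \bar R}) (r : R) (m : 'I_d) : V :=
  ((col m (sigma_r nu r))^T : 'rV[R]_d).

Section HJB.
Variables (nu : {measure set V -> \bar R}) (L : V -> V -> R)
  (F G : V -> probability V R -> R) (T : R) (mu : R -> probability V R)
  (rho h r : R) (N : nat).

Definition bbar (a : V) : V := - a - b_r nu r.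

Definition S_value (v : 'rV[int]_d -> R) (i : 'rV[int]_d) (k : nat) (a : V) : R :=
  let x := xg rho i in
  let lr := lam_r nu r in
  h * F x (mu (k%:R * h)) + h * L x a
  + expR (- (h * lr)) / (2 * d%:R) *
      \sum_(m < d) (interp rho v (x + h *: bbar a + Num.sqrt (h * d%:R) *: sigcol nu r m)
                  + interp rho v (x + h *: bbar a - Num.sqrt (h * d%:R) *: sigcol nu r m))
  + (1 - expR (- (h * lr))) / lr *
      fine (\int[nu]_(z in [set z | (r <= enorm z)%R]) (interp rho v (x + z))%:E)%E.

Definition S_scheme (v : 'rV[int]_d -> R) (i : 'rV[int]_d) (k : nat) : R :=
  inf [set S_value v i k a | a in [set: V]].

(* u_back n = u_{., N - n}: backward recursion from u_{i,N} = G(x_i, mu(T)) *)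
Fixpoint u_back (n : nat) : 'rV[int]_d -> R :=
  match n with
  | 0 => fun i => G (xg rho i) (mu T)
  | n'.+1 => fun i => S_scheme (u_back n') i (N - n'.+1)
  end.

Definition u_grid (k : nat) : 'rV[int]_d -> R := u_back (N - k).

Definition u_rh (t : R) (x : V) : R := interp rho (u_grid (Num.truncn (t / h))) x.
End HJB.

Definition eta0 (x : V) : R :=
  if enorm x < 1 then expR (1 / (enorm x ^+ 2 - 1)) else 0.

Definition eta_eps (lam : {measure set V -> \bar R}) (eps : R) (x : V) : R :=
  (fine (\int[lam]_y (eta0 y)%:E)%E)^-1 * eps ^- d * eta0 (eps^-1 *: x).

Definition mollify (lam : {measure set V -> \bar R}) (eps : R) (w : V -> R) (x : V) : R :=
  fine (\int[lam]_y (w (x - y) * eta_eps lam eps y)%:E)%E.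

Definition grad (w : V -> R) (x : V) : V := \row_(l < d) 'D_(unitv l) w x.

Section FPK.
Variables (lam nu : {measure set V -> \bar R}) (L : V -> V -> R)
  (DpH : V -> V -> V)
  (F G : V -> probability V R -> R) (m0 : probability V R)
  (T : R) (mu : R -> probability V R) (rho h r eps : R) (N : nat).

Definition w_eps (t : R) : V -> R :=
  mollify lam eps (u_rh nu L F G T mu rho h r N t).

Definition Phi (j : 'rV[int]_d) (k : nat) (p : 'I_d) (sgn : bool) : V :=
  let x := xg rho j in
  x - h *: (DpH x (grad (w_eps (k%:R * h)) x) + b_r nu r)
    + (if sgn then 1 else -1) * Num.sqrt (h * d%:R) *: sigcol nu r p.

Definition Bker (i j : 'rV[int]_d) (k : nat) : R :=
  let lr := lam_r nu r in
  expR (- (h * lr)) / (2 * d%:R) *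
    \sum_(p < d) (beta rho i (Phi j k p true) + beta rho i (Phi j k p false))
  + (1 - expR (- (h * lr))) / lr *
    fine (\int[nu]_(z in [set z | (r < enorm z)%R]) (beta rho i (xg rho j + z))%:E)%E.

Definition cell (i : 'rV[int]_d) : set V :=
  [set x | forall l, coord (xg rho i) l - rho / 2 < coord x l < coord (xg rho i) l + rho / 2].

Fixpoint m_grid (k : nat) : 'rV[int]_d -> R :=
  match k with
  | 0 => fun i => fine (m0 (cell i))
  | k'.+1 => fun i => fine (\esum_(j in [set: 'rV[int]_d]) (m_grid k' j * Bker i j k')%:E)%E
  end.

Definition m_dens_k (k : nat) (x : V) : R :=
  rho ^- d * \sum_(i \in [set: 'rV[int]_d]) m_grid k i * \1_(cell i) x.

Definition m_dens (t : R) (x : V) : R :=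
  let k := Num.truncn (t / h) in
  let th := (t - k%:R * h) / h in
  (1 - th) * m_dens_k k x + th * m_dens_k k.+1 x.

Definition m_int (t : R) (f : V -> R) : R :=
  fine (\int[lam]_x (f x * m_dens t x)%:E)%E.
End FPK.

End Scheme.

(* Main.v *)
Require Import Defs.
From HB Require Import structures.
From mathcomp Require Import all_boot all_order all_algebra.
From mathcomp Require Import all_classical all_reals all_analysis.
From mathcomp Require Import measurable_realfun ring lra zify.
Import Order.TTheory GRing.Theory Num.Theory.
Import numFieldNormedType.Exports.
Set Implicit Arguments.
Unset Strict Implicit.
Unset Printing Implicit Defensive.
Local Open Scope classical_set_scope.
Local Open Scope ring_scope.
(* [vector.coord] hides the coordinate function of the scheme *)
Local Notation coord := Defs.coord.

(** Let X_k(g) = sum_i m_{i,k} g_i.  Duality turns the scheme into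
    X_{k+1}(g) = X_k(B g), where (B g)_j = sum_i B(i,j,k) g_i, and the total mass
    is conserved because the tent functions are a partition of unity.

    A test function f enters the integral only through its cell averages f_i,
    which are Lipschitz on the grid.  Replacing them by their infimal convolution
    g_i = min_l (f_l + |x_i - x_l|^2 / (2 delta)) costs O(delta), and at each x_j
    the function g lies below g_j + p.(x_i - x_j) + |x_i - x_j|^2 / (2 delta) with
    p bounded.  This one-sided quadratic bound suffices for
    (B g)_j <= g_j + C h (1 + 1 / delta): the first-order terms of the drift b_r
    and of the compensated small jumps cancel up to O(h (1 - e^(-h lam_r)) |b_r|),
    which nu1 and the step-size conditions bound by O(h); the remaining terms are
    second moments, of order (h + rho^2) / delta, the square of the drift being
    absorbed by the factor e^(-h lam_r).  The gradient D_p H is bounded because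
    the discrete value function is Lipschitz: translations by grid vectors commute
    with interpolation, so Lipschitz constants on the grid only grow by
    h (L_F + L_L) in each step.

    Hence X_t(f) - X_s(f) <= C (1 + 1 / delta) (t - s) + C delta for s <= t.  Take
    delta = sqrt (t - s), and apply this to f and to - f. *)

(** * Norms on R^d and multilinear interpolation *)

(** For a test function that is only Lipschitz, the diffusion increments of length [sqrt (h d)]
    times a column of [sigma_r] give an error of order [sqrt h] in each step, and [1 / h] steps per
    unit of time make this useless. Second moments, like variances, add up linearly in time, so the
    test function has to be regularized before the scheme acts on it. The regularization happens
    once, and its error is paid at an end time and not in every step. All sums over the grid are
    kept nonnegative, so that they may be exchanged freely: [f] is replaced by [f + 1], with values
    in [[0, 2]], and the shift cancels in time differences because the total mass is constant. The
    bound 2 also controls the jumps of length at least one, whose second moment may be infinite.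
    Moments of the jump measure near 0 are geometric sums over dyadic annuli; [sig != 1] keeps a
    logarithm out of the first moment. *)

Section Euclid.
Context {R : realType} (d : nat).
Local Notation V := (Rd R d).
Implicit Types (x y z : V) (l : 'I_d).

Lemma coordD x y l : coord (x + y) l = coord x l + coord y l.
Proof. by rewrite /coord mxE. Qed.

Lemma coordN x l : coord (- x) l = - coord x l.
Proof. by rewrite /coord mxE. Qed.

Lemma coordB x y l : coord (x - y) l = coord x l - coord y l.
Proof. by rewrite coordD coordN. Qed.

Lemma coordZ (a : R) x l : coord (a *: x) l = a * coord x l.
Proof. by rewrite /coord mxE. Qed.

Lemma coord0 l : coord (0 : V) l = 0.
Proof. by rewrite /coord mxE. Qed.

Lemma eq_coord x y : (forall l, coord x l = coord y l) -> x = y.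
Proof. by move=> h; apply/rowP => l; exact: h. Qed.

Lemma coord_xg (rho : R) (i : 'rV[int]_d) l :
  coord (xg rho i) l = rho * (i ord0 l)%:~R.
Proof. by rewrite /xg coordZ /coord mxE. Qed.

Lemma dotvv_ge0 z : 0 <= dotv z z.
Proof. by apply: sumr_ge0 => l _; rewrite -expr2 sqr_ge0. Qed.

Lemma dotvDl x y z : dotv (x + y) z = dotv x z + dotv y z.
Proof. by rewrite /dotv -big_split; apply: eq_bigr => l _; rewrite coordD mulrDl. Qed.

Lemma dotvC x y : dotv x y = dotv y x.
Proof. by apply: eq_bigr => l _; rewrite mulrC. Qed.

Lemma dotvDr x y z : dotv z (x + y) = dotv z x + dotv z y.
Proof. by rewrite dotvC dotvDl !(dotvC z). Qed.

Lemma dotvZl (a : R) x y : dotv (a *: x) y = a * dotv x y.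
Proof. by rewrite /dotv mulr_sumr; apply: eq_bigr => l _; rewrite coordZ mulrA. Qed.

Lemma dotvZr (a : R) x y : dotv x (a *: y) = a * dotv x y.
Proof. by rewrite dotvC dotvZl dotvC. Qed.

Lemma dotvNl x y : dotv (- x) y = - dotv x y.
Proof. by rewrite -scaleN1r dotvZl mulN1r. Qed.

Lemma dotvNr x y : dotv x (- y) = - dotv x y.
Proof. by rewrite dotvC dotvNl dotvC. Qed.

Lemma dotv_sqrD x y :
  dotv (x + y) (x + y) + dotv (x - y) (x - y) = 2 * dotv x x + 2 * dotv y y.
Proof. by rewrite !(dotvDl, dotvDr, dotvNl, dotvNr); ring. Qed.

Lemma dotv_sqrD_le x y :
  dotv (x + y) (x + y) <= 2 * dotv x x + 2 * dotv y y.
Proof. by rewrite -dotv_sqrD lerDl dotvv_ge0. Qed.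

Lemma enorm_ge0 z : 0 <= enorm z.
Proof. exact: sqrtr_ge0. Qed.

Lemma sqr_enorm z : enorm z ^+ 2 = dotv z z.
Proof. by rewrite sqr_sqrtr// dotvv_ge0. Qed.

Lemma enormZ (a : R) z : enorm (a *: z) = `|a| * enorm z.
Proof.
by rewrite /enorm dotvZl dotvZr mulrA -expr2 sqrtrM ?sqr_ge0// sqrtr_sqr.
Qed.

Lemma coord_le_enorm z l : `|coord z l| <= enorm z.
Proof.
rewrite -sqrtr_sqr ler_sqrt ?dotvv_ge0// /dotv (bigD1 l)//= expr2 lerDl.
by apply: sumr_ge0 => k _; rewrite -expr2 sqr_ge0.
Qed.

(** Bounds on tent functions and on partial derivatives are obtained per coordinate and add up in
    this norm. *)
Definition norm1 z : R := \sum_l `|coord z l|.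

Lemma norm1_ge0 z : 0 <= norm1 z.
Proof. by apply: sumr_ge0. Qed.

Lemma ler_norm1D x y : norm1 (x + y) <= norm1 x + norm1 y.
Proof.
by rewrite /norm1 -big_split; apply: ler_sum => l _; rewrite coordD ler_normD.
Qed.

Lemma norm1N x : norm1 (- x) = norm1 x.
Proof. by apply: eq_bigr => l _; rewrite coordN normrN. Qed.

Lemma coord_le_norm1 z l : `|coord z l| <= norm1 z.
Proof. by rewrite /norm1 (bigD1 l)//= lerDl; apply: sumr_ge0. Qed.

Lemma enorm_le_norm1 z : enorm z <= norm1 z.
Proof.
rewrite -[leRHS]ger0_norm ?norm1_ge0// -sqrtr_sqr ler_sqrt ?sqr_ge0//.
rewrite expr2 [in leRHS]/norm1 mulr_suml; apply: ler_sum => l _.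
rewrite -expr2 -real_normK ?num_real// expr2.
by apply: ler_wpM2l => //; exact: coord_le_norm1.
Qed.

Lemma norm1_le_enorm z : norm1 z <= d%:R * enorm z.
Proof.
apply: le_trans (ler_sum _ (fun l _ => coord_le_enorm z l)) _.
by rewrite sumr_const card_ord mulr_natl.
Qed.

Lemma dotv_le_norm1 x y (P : R) : (forall l, `|coord x l| <= P) ->
  `|dotv x y| <= P * norm1 y.
Proof.
move=> h; apply: le_trans (ler_norm_sum _ _ _) _.
rewrite /norm1 mulr_sumr; apply: ler_sum => l _.
by rewrite normrM ler_wpM2r.
Qed.

Lemma dotvv_le x (P : R) : (forall l, `|coord x l| <= P) ->
  dotv x x <= d%:R * P ^+ 2.
Proof.
move=> h.
have -> : d%:R * P ^+ 2 = \sum_(l < d) P ^+ 2 by rewrite sumr_const card_ord mulr_natl.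
apply: ler_sum => l _.
by rewrite -expr2 -real_normK ?num_real// ler_sqr ?nnegrE// (le_trans _ (h l)).
Qed.

End Euclid.

(** * Interpolation as an average over the corners of a cell *)

Section Interp.
Context {R : realType} (d : nat).
Local Notation V := (Rd R d).
Local Notation corner := {ffun 'I_d -> bool}.

Definition cshift (k : 'rV[int]_d) (e : corner) : 'rV[int]_d :=
  k + \row_l (e l : nat)%:Z.

(** The probability of the corner [e] under independent Bernoulli variables with parameters
    [th l]. *)
Definition wgt (th : 'I_d -> R) (e : corner) : R :=
  \prod_l (if e l then th l else 1 - th l).

Lemma cshift_inj k : injective (cshift k).
Proof.
move=> e e' /addrI /rowP h; apply/ffunP => l.
by have := h l; rewrite !mxE; case: (e l); case: (e' l).
Qed.

Lemma wgt_ge0 th e : (forall l, 0 <= th l <= 1) -> 0 <= wgt th e.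
Proof.
move=> h; apply: prodr_ge0 => l _; have /andP[h0 h1] := h l.
by case: ifP => // _; rewrite subr_ge0.
Qed.

Lemma sum_prod_corner (F : 'I_d -> bool -> R) :
  \sum_(e : corner) \prod_l F l (e l) = \prod_l (F l true + F l false).
Proof.
rewrite -(bigA_distr_bigA (fun l b => F l b)); apply: eq_bigr => l _.
by rewrite big_bool.
Qed.

Lemma wgt_sum th : \sum_e wgt th e = 1.
Proof.
rewrite /wgt (sum_prod_corner (fun l b => if b then th l else 1 - th l)).
by rewrite big1// => l _ /=; rewrite addrC subrK.
Qed.

Lemma wgt_coord th l : \sum_e wgt th e * (e l)%:R = th l.
Proof.
(* Inserting [e l] at the coordinate [l] alone keeps each summand a product, so that the sum over
   the corners factorizes again. *)
transitivity (\sum_(e : corner) \prod_l'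
    ((if e l' then th l' else 1 - th l') * (if l' == l then (e l')%:R else 1))).
  apply: eq_bigr => e _; rewrite big_split /=; congr (_ * _).
  by rewrite (bigD1 l)//= eqxx big1 ?mulr1// => l' /negbTE ->.
rewrite (sum_prod_corner (fun l' b => (if b then th l' else 1 - th l') *
   (if l' == l then b%:R else 1))).
rewrite (bigD1 l)//= eqxx !mulr1 mulr0 addr0 big1 ?mulr1// => l' /negbTE ->.
by rewrite !mulr1 addrC subrK.
Qed.

Variable rho : R.
Hypothesis rho0 : 0 < rho.
Let rho_ge0 : 0 <= rho := ltW rho0.

(** Carrying the lower corner and the fractional parts along keeps the floor function out of later
    arguments; a translation by a grid vector changes [k] only. *)
Definition in_cell (x : V) (k : 'rV[int]_d) (th : 'I_d -> R) :=
  (forall l, 0 <= th l <= 1) /\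
  (forall l, coord x l = rho * ((k ord0 l)%:~R + th l)).

Lemma in_cell_ex x : exists k th, in_cell x k th.
Proof.
exists (\row_l Num.floor (coord x l / rho)),
  (fun l => coord x l / rho - (Num.floor (coord x l / rho))%:~R).
split=> l; last first.
  by rewrite mxE addrC subrK mulrC divfK// gt_eqF.
have /andP[h1 h2] := floor_itv (coord x l / rho).
by rewrite subr_ge0 h1/= lerBlDr addrC ltW// -[X in _ + X]/1 -intrD1.
Qed.

Let tent (t : R) : R := Num.max 0 (1 - `|t|).

Lemma beta_tent i (x : V) (k : 'rV[int]_d) th : in_cell x k th ->
  beta rho i x = \prod_l tent (th l + (k ord0 l - i ord0 l)%:~R).
Proof.
move=> [_ h]; apply: eq_bigr => l _; rewrite h coord_xg -mulrBr normrM.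
rewrite gtr0_norm// mulrAC divff ?gt_eqF// mul1r /tent intrB.
by congr (Num.max 0 (1 - `|_|)); ring.
Qed.

Lemma beta_corner x k th e : in_cell x k th ->
  beta rho (cshift k e) x = wgt th e.
Proof.
move=> hx; rewrite (beta_tent _ hx); apply: eq_bigr => l _.
have [/(_ l)/andP[h0 h1] _] := hx.
rewrite !mxE opprD addrA subrr add0r /tent.
case: (e l) => /=; rewrite ?subr0 ?oppr0 ?addr0.
  rewrite mulrN1z ler0_norm ?subr_le0// opprK addrC subrK.
  by apply/max_idPr.
by rewrite ger0_norm//; apply/max_idPr; rewrite subr_ge0.
Qed.

(** Some coordinate of [i] is neither that of [k] nor its successor; it is at distance at least
    [rho] from that of [x], so its tent factor vanishes. *)
Lemma beta_out x k th i : in_cell x k th ->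
  (forall e, i <> cshift k e) -> beta rho i x = 0.
Proof.
move=> hx hi.
have [l hl] : exists l, i ord0 l != k ord0 l /\ i ord0 l != k ord0 l + 1.
  apply/not_existsP => h; apply: (hi [ffun l => i ord0 l != k ord0 l]).
  apply/rowP => l; rewrite !mxE ffunE.
  have /not_andP := h l; case: eqVneq => [->|_]/=; first by rewrite addr0.
  by case=> // /negP; rewrite negbK => /eqP ->.
rewrite (beta_tent _ hx) (bigD1 l)//=.
have [/(_ l)/andP[h0 h1] _] := hx.
suff -> : tent (th l + (k ord0 l - i ord0 l)%:~R) = 0 by rewrite mul0r.
apply/max_idPl; rewrite subr_le0.
case: hl => /eqP hl1 /eqP hl2.
have [hlt|hge] := ltrP (i ord0 l) (k ord0 l).
  have : (1 : R) <= (k ord0 l - i ord0 l)%:~R by rewrite ler1z; lia.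
  move=> h; rewrite ger0_norm; lra.
have : (k ord0 l - i ord0 l)%:~R <= (- 2%:Z)%:~R :> R by rewrite ler_int; lia.
move=> h.
have {}h : (k ord0 l - i ord0 l)%:~R <= - 2 :> R.
  by apply: le_trans h _; rewrite mulrNz.
by rewrite ler0_norm; lra.
Qed.

Lemma interp_seq v x (s : seq 'rV[int]_d) : uniq s ->
  (forall i, i \notin s -> beta rho i x = 0) ->
  interp rho v x = \sum_(i <- s) v i * beta rho i x.
Proof.
move=> us hs; rewrite /interp (fsbigE s _ us)//; last by move=> i _ /hs ->; rewrite mulr0.
by apply: eq_bigl => i; rewrite in_setT.
Qed.

Definition corners k : seq 'rV[int]_d := [seq cshift k e | e <- enum {: corner}].

Lemma corners_uniq k : uniq (corners k).
Proof. by rewrite map_inj_uniq ?enum_uniq//; exact: cshift_inj. Qed.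

Lemma corners_out x k th i : in_cell x k th ->
  i \notin corners k -> beta rho i x = 0.
Proof.
move=> hx hi; apply: (beta_out hx) => e ie; move/negP: hi; apply.
by rewrite ie; apply: map_f; rewrite mem_enum.
Qed.

Lemma interp_cell v x k th : in_cell x k th ->
  interp rho v x = \sum_e v (cshift k e) * wgt th e.
Proof.
move=> hx; rewrite (interp_seq _ (corners_uniq k)); last by move=> i; exact: (corners_out hx).
rewrite big_map big_enum/=; apply: eq_bigr => e _.
by rewrite (beta_corner e hx).
Qed.

(** This lets a Lipschitz constant on the grid pass through an interpolation unchanged. The factor
    [interp_lip] of [interp_lipschitz] would be raised to the power [N] by the backward recursion;
    it is paid only once, after the last step. *)
Lemma interp_shift v (x : V) (s : 'rV[int]_d) :
  interp rho v (x + xg rho s) = interp rho (fun i => v (i + s)) x.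
Proof.
have [k [th hx]] := in_cell_ex x.
have hxs : in_cell (x + xg rho s) (k + s) th.
  split=> [|l]; first exact: hx.1.
  by rewrite coordD coord_xg hx.2 !mxE intrD; ring.
rewrite (interp_cell _ hx) (interp_cell _ hxs); apply: eq_bigr => e _.
by rewrite /cshift addrAC.
Qed.

(** Linearity, monotonicity and the quadratic bound follow from this description: a convex
    combination of values at grid points near [x] with barycentre [x]. *)
Lemma interpP x : exists (w : corner -> R) (q : corner -> 'rV[int]_d),
  [/\ forall e, 0 <= w e, \sum_e w e = 1,
      forall v, interp rho v x = \sum_e v (q e) * w e,
      forall l, \sum_e w e * coord (xg rho (q e)) l = coord x l &
      forall e l, `|coord (xg rho (q e)) l - coord x l| <= rho].
Proof.
have [k [th hx]] := in_cell_ex x.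
exists (wgt th), (cshift k); split.
- by move=> e; apply: wgt_ge0; exact: hx.1.
- exact: wgt_sum.
- by move=> v; exact: interp_cell.
- move=> l; rewrite hx.2.
  under eq_bigr do rewrite coord_xg !mxE intrD mulrDr mulrDr [X in _ + X]mulrCA -pmulrn.
  rewrite big_split/= -mulr_suml wgt_sum mul1r.
  by rewrite -mulr_sumr wgt_coord mulrDr.
move=> e l; rewrite hx.2 coord_xg !mxE intrD -mulrBr normrM gtr0_norm//.
rewrite -[leRHS]mulr1 ler_wpM2l// //.
rewrite opprD addrACA subrr add0r -pmulrn.
have /andP[h0 h1] := hx.1 l.
by case: (e l) => /=; rewrite ler_norml; lra.
Qed.

Lemma interpD v w (x : V) : interp rho (fun i => v i + w i) x = interp rho v x + interp rho w x.
Proof.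
have [W [q [_ _ h _ _]]] := interpP x.
by rewrite !h -big_split; apply: eq_bigr => e _; rewrite mulrDl.
Qed.

Lemma interp_le v w (x : V) : (forall i, v i <= w i) -> interp rho v x <= interp rho w x.
Proof.
have [W [q [W0 _ h _ _]]] := interpP x.
by move=> hvw; rewrite !h; apply: ler_sum => e _; rewrite ler_wpM2r.
Qed.

Lemma interp_cst c (x : V) : interp rho (fun=> c) x = c.
Proof.
have [W [q [_ W1 h _ _]]] := interpP x.
by rewrite h -mulr_sumr W1 mulr1.
Qed.

Lemma interpN v (x : V) : interp rho (fun i => - v i) x = - interp rho v x.
Proof.
have [W [q [_ W1 h _ _]]] := interpP x.
by rewrite !h -sumrN; apply: eq_bigr => e _; rewrite mulNr.
Qed.

Lemma interp_dist v w c (x : V) : (forall i, `|v i - w i| <= c) ->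
  `|interp rho v x - interp rho w x| <= c.
Proof.
move=> h; rewrite -interpN -interpD ler_norml.
have cE a : a = interp rho (fun=> a) x by rewrite interp_cst.
rewrite [X in X <= _ <= _]cE [X in _ <= _ <= X]cE.
by apply/andP; split; apply: interp_le => i; have := h i; rewrite ler_norml => /andP[].
Qed.

(* |x_i - x_j|^2 <= 2 |x - x_j|^2 + 2 d rho^2 at the corners x_i of the cell of x *)
Lemma interp_quad v c (p : V) a j (x : V) : 0 <= a ->
  (forall i, v i <= c + dotv p (xg rho i - xg rho j)
               + a * dotv (xg rho i - xg rho j) (xg rho i - xg rho j)) ->
  interp rho v x <= c + dotv p (x - xg rho j)
     + a * (2 * dotv (x - xg rho j) (x - xg rho j) + 2 * (d%:R * rho ^+ 2)).
Proof.
move=> a0 h; have [W [q [W0 W1 hI hl hr]]] := interpP x.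
rewrite hI.
pose B := a * (2 * dotv (x - xg rho j) (x - xg rho j) + 2 * (d%:R * rho ^+ 2)).
apply: (@le_trans _ _ (\sum_e (c + dotv p (xg rho (q e) - xg rho j) + B) * W e)).
  apply: ler_sum => e _; rewrite ler_wpM2r//; apply: le_trans (h _) _.
  rewrite lerD2l ler_wpM2l//.
  have -> : xg rho (q e) - xg rho j = (x - xg rho j) + (xg rho (q e) - x).
    by rewrite [RHS]addrC addrA subrK.
  apply: le_trans (dotv_sqrD_le _ _) _; rewrite lerD2l ler_wpM2l//.
  by apply: dotvv_le => l; rewrite coordB.
under eq_bigr do rewrite 2!mulrDl.
rewrite !big_split/= -!mulr_sumr W1 !mulr1 lerD2r lerD2l.
suff -> : \sum_e dotv p (xg rho (q e) - xg rho j) * W e = dotv p (x - xg rho j) by [].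
rewrite /dotv.
under eq_bigr do rewrite mulr_suml.
rewrite exchange_big/=; apply: eq_bigr => l _.
under eq_bigr do rewrite -mulrA.
rewrite -mulr_sumr; congr (_ * _).
rewrite coordB -(hl l).
under eq_bigr do rewrite coordB mulrC mulrBr.
by rewrite sumrB -mulr_suml W1 mul1r.
Qed.

Lemma ler_dist_prod (I : Type) (s : seq I) (a b : I -> R) :
  (forall i, 0 <= a i <= 1) -> (forall i, 0 <= b i <= 1) ->
  `|\prod_(i <- s) a i - \prod_(i <- s) b i| <= \sum_(i <- s) `|a i - b i|.
Proof.
move=> ha hb; elim: s => [|i s IH]; first by rewrite !big_nil subrr normr0.
rewrite !big_cons.
have -> : a i * \prod_(j <- s) a j - b i * \prod_(j <- s) b j =
  (a i - b i) * \prod_(j <- s) a j +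
  b i * (\prod_(j <- s) a j - \prod_(j <- s) b j) by ring.
apply: le_trans (ler_normD _ _) _; rewrite !normrM.
have /andP[bi0 bi1] := hb i.
have p0 : 0 <= \prod_(j <- s) a j.
  by apply: prodr_ge0 => j _; have /andP[] := ha j.
have p1 : \prod_(j <- s) a j <= 1.
  by apply: prodr_ile1 => *; exact: ha.
apply: lerD.
  by rewrite (ger0_norm p0) -[leRHS]mulr1 ler_wpM2l.
rewrite (ger0_norm bi0); apply: le_trans IH.
by rewrite -[leRHS]mul1r ler_wpM2r.
Qed.

Lemma tent_itv (t : R) : 0 <= Num.max 0 (1 - `|t| / rho) <= 1.
Proof.
rewrite le_max lexx/= ge_max ler01/= gerBl.
by rewrite divr_ge0.
Qed.

Lemma beta_itv i (x : V) : 0 <= beta rho i x <= 1.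
Proof.
rewrite prodr_ge0//=; last by move=> l _; have /andP[] := tent_itv (coord x l - coord (xg rho i) l).
by apply: prodr_ile1 => *; exact: tent_itv.
Qed.

Lemma beta_ge0 i (x : V) : 0 <= beta rho i x.
Proof. by have /andP[] := beta_itv i x. Qed.

Lemma beta_dist i (x y : V) : `|beta rho i x - beta rho i y| <= norm1 (x - y) / rho.
Proof.
apply: le_trans (ler_dist_prod _ (fun l => tent_itv _) (fun l => tent_itv _)) _.
rewrite /norm1 mulr_suml; apply: ler_sum => l _.
rewrite coordB.
set A := coord x l; set B := coord y l; set C := coord _ l.
have h (s t : R) : `|Num.max 0 s - Num.max 0 t| <= `|s - t|.
  rewrite !maxEle; case: ifP => // h1; case: ifP => // h2.
  - by move: h1 h2 => h1 /negbT; rewrite -ltNge => h2; rewrite ler_norml !ger0_norm//; lra.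
  - by move: h1 h2 => /negbT; rewrite -ltNge => h1 h2; rewrite sub0r normrN distrC ger0_norm// ger0_norm; lra.
  - by rewrite subrr normr0.
apply: le_trans (h _ _) _.
have -> : 1 - `|A - C| / rho - (1 - `|B - C| / rho) = (`|B - C| - `|A - C|) / rho by ring.
rewrite normrM (gtr0_norm (x := rho^-1)) ?invr_gt0//.
rewrite ler_wpM2r ?invr_ge0//.
apply: le_trans (ler_dist_dist _ _) _.
by rewrite opprB addrA subrK distrC.
Qed.

(** At most [2 * 2 ^+ d] corners of two cells contribute, each with at most [(2 * d%:R + 1) * K]
    times the distance. *)
Definition interp_lip : R := 2 * (2 ^+ d * (2 * d%:R + 1)).

Lemma interp_lipschitz v K (x y : V) : 0 <= K ->
  (forall i j, `|v i - v j| <= K * norm1 (xg rho i - xg rho j)) ->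
  `|interp rho v x - interp rho v y| <= interp_lip * K * norm1 (x - y).
Proof.
move=> K0 hv; set n := norm1 (x - y).
have n0 : 0 <= n by exact: norm1_ge0.
have [k [th hx]] := in_cell_ex x; have [k' [th' hy]] := in_cell_ex y.
pose s := undup (corners k ++ corners k').
have us : uniq s by exact: undup_uniq.
have sx i : i \notin s -> beta rho i x = 0.
  by rewrite mem_undup mem_cat negb_or => /andP[/(corners_out hx)].
have sy i : i \notin s -> beta rho i y = 0.
  by rewrite mem_undup mem_cat negb_or => /andP[_ /(corners_out hy)].
(* Subtracting the constant [v k] makes the coefficients at all relevant corners small. *)
have -> : interp rho v x - interp rho v y =
  interp rho (fun i => v i - v k) x - interp rho (fun i => v i - v k) y.
  by rewrite !interpD !interp_cst; ring.
rewrite !(interp_seq _ us)// -sumrB.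
apply: le_trans (ler_norm_sum _ _ _) _.
have near_cell (z : V) k0 th0 i : in_cell z k0 th0 -> i \in corners k0 ->
    norm1 (xg rho i - z) <= d%:R * rho.
  move=> hz /mapP[e _ ->].
  have -> : d%:R * rho = \sum_(l < d) rho by rewrite sumr_const card_ord mulr_natl.
  apply: ler_sum => l _; rewrite coordB coord_xg hz.2 !mxE intrD -mulrBr normrM gtr0_norm//.
  rewrite -[leRHS]mulr1 ler_wpM2l// // opprD addrACA subrr add0r -pmulrn.
  have /andP[h0 h1] := hz.1 l.
  by case: (e l) => /=; rewrite ler_norml; lra.
have kk : norm1 (xg rho k - x) <= d%:R * rho.
  apply: (near_cell _ _ _ _ hx); apply/mapP; exists [ffun=> false].
    by rewrite mem_enum.
  by apply/rowP => l; rewrite !mxE ffunE addr0.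
have hin i : i \in s -> `|v i - v k| <= K * (2 * d%:R * rho + n).
  move=> hi; apply: le_trans (hv _ _) _; rewrite ler_wpM2l//.
  have hix : norm1 (xg rho i - x) <= d%:R * rho + n.
    move: hi; rewrite mem_undup mem_cat => /orP[/(near_cell _ _ _ _ hx) h|/(near_cell _ _ _ _ hy) h].
      by apply: le_trans h _; rewrite lerDl.
    have -> : xg rho i - x = (xg rho i - y) + (y - x) by rewrite addrA subrK.
    apply: le_trans (ler_norm1D _ _) _; rewrite lerD//.
    by rewrite -norm1N opprB.
  have -> : xg rho i - xg rho k = (xg rho i - x) + (x - xg rho k) by rewrite addrA subrK.
  apply: le_trans (ler_norm1D _ _) _; rewrite -[in X in _ + X]norm1N opprB.
  lra.
have size_s : (size s)%:R <= 2 * 2 ^+ d :> R.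
  rewrite -natrX -natrM ler_nat; apply: leq_trans (size_undup _) _.
  rewrite size_cat !size_map -enumT -!cardE card_ffun card_bool card_ord.
  by rewrite mul2n addnn.
pose D : R := K * (2 * d%:R + 1) * n.
have hD i : i \in s -> `|(v i - v k) * beta rho i x - (v i - v k) * beta rho i y| <= D.
  move=> hi; rewrite -mulrBr normrM /D.
  (* For [n <= rho] the factor [n / rho] from [beta_dist] compensates coefficients of order
     [K * rho]; for [rho < n] the coefficients are themselves of order [K * n]. *)
  have [nr|rn] := leP n rho.
    apply: le_trans (ler_pM _ _ (hin i hi) (beta_dist i x y)) _ => //.
    rewrite -/n -!mulrA ler_wpM2l//.
    rewrite [leLHS](_ : _ = n * ((2 * d%:R * rho + n) / rho)); last by ring.
    rewrite [leRHS]mulrC ler_wpM2l// ler_pdivrMr// mulrDl mul1r; lra.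
  have hb : `|beta rho i x - beta rho i y| <= 1.
    by have := beta_itv i x; have := beta_itv i y; rewrite ler_norml; lra.
  apply: le_trans (ler_pM _ _ (hin i hi) hb) _ => //.
  rewrite mulr1 -[leRHS]mulrA ler_wpM2l// [leRHS]mulrDl mul1r lerD2r.
  by rewrite ler_wpM2l ?mulr_ge0// ltW.
rewrite big_seq; apply: le_trans (ler_sum _ hD) _.
rewrite -big_seq big_const_seq count_predT iter_addr_0 -mulr_natl.
have -> : interp_lip * K * n = (2 * 2 ^+ d) * D by rewrite /interp_lip /D; ring.
by rewrite ler_wpM2r// /D !mulr_ge0// addr_ge0// mulr_ge0.
Qed.

End Interp.

(** * Measurability and Lebesgue measure on R^d *)

Section MeasurableSets.
Context {R : realType} {d0 : measure_display} {aT : measurableType d0}.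
Implicit Types (f : aT -> R) (a : R).

Lemma measurable_set_lt f a : measurable_fun [set: aT] f -> measurable [set x | f x < a].
Proof.
move=> mf; have -> : [set x | f x < a] = f @^-1` `]-oo, a[.
  by apply/seteqP; split => x /=; rewrite in_itv.
by rewrite -[X in measurable X]setTI; apply: mf.
Qed.

Lemma measurable_set_gt f a : measurable_fun [set: aT] f -> measurable [set x | a < f x].
Proof.
move=> mf; have -> : [set x | a < f x] = f @^-1` `]a, +oo[.
  by apply/seteqP; split => x /=; rewrite in_itv/= andbT.
by rewrite -[X in measurable X]setTI; apply: mf.
Qed.

Lemma measurable_set_ge f a : measurable_fun [set: aT] f -> measurable [set x | a <= f x].
Proof.
move=> mf; have -> : [set x | a <= f x] = f @^-1` `[a, +oo[.
  by apply/seteqP; split => x /=; rewrite in_itv/= andbT.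
by rewrite -[X in measurable X]setTI; apply: mf.
Qed.

Lemma measurable_set_eq f a : measurable_fun [set: aT] f -> measurable [set x | f x = a].
Proof.
move=> mf; have -> : [set x | f x = a] = f @^-1` [set a] by [].
by rewrite -[X in measurable X]setTI; apply: mf.
Qed.

Lemma measurable_fun_lt f : (forall a, measurable [set x | f x < a]) ->
  measurable_fun [set: aT] f.
Proof.
move=> h mD; apply: (measurability _ (measurable_realfun.RGenCInfty.measurableE R)) => // _ [_ [a ->] <-].
rewrite setTI (_ : _ @^-1` _ = ~` [set x | f x < a]); first exact: measurableC.
apply/seteqP; split => x /=; rewrite in_itv/= andbT leNgt; by move/negP.
Qed.

End MeasurableSets.

Section MeasurableRd.
Context {R : realType} (d : nat).
Local Notation V := (Rd R d).

Lemma measurable_coord (l : 'I_d) : measurable_fun [set: V] (fun z : V => coord z l).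
Proof.
move=> _ Y mY; rewrite setTI; apply: sub_sigma_algebra.
rewrite (bigD1 l)//=; left.
by exists Y => //; rewrite setTI.
Qed.

Lemma measurable_fun_coord {d0} {aT : measurableType d0} (g : aT -> V) :
  (forall l, measurable_fun [set: aT] (fun x => coord (g x) l)) ->
  measurable_fun [set: aT] g.
Proof.
move=> h; apply: (@measurability _ _ aT V setT g _ (erefl _)) => A [B].
elim/big_ind : _ B A => [B A []|P Q hP hQ B A [/hP|/hQ]|l _ B A [C mC <-] <-].
- by move=> h1 /h1.
- by move=> h1 /h1.
- rewrite setTI setTI.
  by have := h l measurableT C mC; rewrite setTI.
Qed.

Lemma measurable_enorm : measurable_fun [set: V] (@enorm R d).
Proof.
apply: (@measurableT_comp _ _ _ _ _ _ (@Num.sqrt R)).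
  apply: continuous_measurable_fun; exact: sqrt_continuous.
by apply: measurable_sum => l; apply: measurable_funM; exact: measurable_coord.
Qed.

Lemma measurable_translation (x : V) : measurable_fun [set: V] (fun z : V => x + z).
Proof.
apply: measurable_fun_coord => l.
under eq_fun do rewrite coordD.
by apply: measurable_funD => //; exact: measurable_coord.
Qed.

Lemma measurable_scaling (a : R) : measurable_fun [set: V] (fun z : V => a *: z).
Proof.
apply: measurable_fun_coord => l.
under eq_fun do rewrite coordZ.
by apply: measurable_funM => //; exact: measurable_coord.
Qed.

Lemma measurable_opp : measurable_fun [set: V] (fun z : V => - z).
Proof.
apply: measurable_fun_coord => l.
under eq_fun do rewrite coordN.
by apply: measurableT_comp => //; exact: measurable_coord.
Qed.

Lemma rat_dense_norm1 (x : V) (e : R) : 0 < e ->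
  exists q : 'rV[rat]_d, norm1 (x - (map_mx (ratr : rat -> R) q : V)) < e.
Proof.
move=> e0; pose e' := e / d.+1%:R.
have e'0 : 0 < e' by rewrite divr_gt0.
have /choice[q hq] : forall l, exists q : rat, `|coord x l - ratr q| < e'.
  move=> l; have /rat_in_itvoo[q] : coord x l - e' < coord x l + e' by lra.
  by rewrite in_itv/= => /andP[h1 h2]; exists q; rewrite ltr_norml; lra.
exists (\row_l q l).
apply: (@le_lt_trans _ _ (\sum_(l < d) e')).
  apply: ler_sum => l _; rewrite coordB {2}/Defs.coord !mxE; exact: ltW.
rewrite sumr_const card_ord -mulr_natr /e' mulrAC ltr_pdivrMr// ltr_pM2l//.
by rewrite ltr_nat.
Qed.

(* a Lipschitz f is the infimum over rational q of f(q) + K |x - q| *)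
Lemma measurable_lipschitz (f : V -> R) (K : R) : 0 <= K ->
  (forall x y, `|f x - f y| <= K * norm1 (x - y)) -> measurable_fun [set: V] f.
Proof.
move=> K0 hf; apply: measurable_fun_lt => a.
pose qV (q : 'rV[rat]_d) : V := map_mx ratr q.
have -> : [set x | f x < a] =
    \bigcup_(q in [set: 'rV[rat]_d]) [set x | K * norm1 (x - qV q) < a - f (qV q)].
  apply/seteqP; split => x /=.
    move=> fxa; pose e := (a - f x) / (2 * K + 1).
    have [|q hq] := @rat_dense_norm1 x e.
      by rewrite divr_gt0// ?subr_gt0//; lra.
    exists q => //=.
    have := hf x (qV q); rewrite ler_norml => /andP[h1 h2].
    have : norm1 (x - qV q) * (2 * K + 1) < a - f x.
      by rewrite -ltr_pdivlMr//; lra.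
    have := norm1_ge0 (x - qV q); nra.
  move=> [q _ /=]; have := hf x (qV q); rewrite ler_norml => /andP[h1 h2]; lra.
apply: countable_bigcupT_measurable => // q.
apply: measurable_set_lt; apply: measurable_funM => //.
apply: measurable_sum => l; apply: measurableT_comp => //.
under eq_fun do rewrite coordB.
by apply: measurable_funB => //; exact: measurable_coord.
Qed.

End MeasurableRd.

(** * Boxes, dilations, spheres and grid cells under Lebesgue measure *)

Section Boxes.
Context {R : realType} (d : nat).
Local Notation V := (Rd R d).
Implicit Types (a b : V) (rho : R).

Definition box a b : set V := [set x | forall l, coord a l < coord x l <= coord b l].

Lemma coord_row (F : 'I_d -> R) l : coord (\row_k F k : V) l = F l.
Proof. by rewrite /Defs.coord mxE. Qed.

Lemma fin_all_measurable (P : 'I_d -> set V) : (forall l, measurable (P l)) ->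
  measurable [set x | forall l, P l x].
Proof.
move=> h; have -> : [set x | forall l, P l x] = \bigcap_(l in [set: 'I_d]) P l.
  by apply/seteqP; split => x /= hx l; [move=> _; exact: hx|exact: hx].
exact: fin_bigcap_measurable.
Qed.

Lemma measurable_box a b : measurable (box a b).
Proof.
apply: (fin_all_measurable (P := fun l => [set x | coord a l < coord x l <= coord b l])) => l.
have -> : [set x : V | coord a l < coord x l <= coord b l] =
    [set x | coord a l < coord x l] `&` ~` [set x | coord b l < coord x l].
  apply/seteqP; split => x /=; first by move=> /andP[? ?]; split => //; apply/negP; rewrite -leNgt.
  by move=> [-> /negP]; rewrite -leNgt.
apply: measurableI; last apply: measurableC; by apply: measurable_set_gt; exact: measurable_coord.
Qed.

Lemma measurable_cell rho (i : 'rV[int]_d) : measurable (cell rho i : set V).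
Proof.
apply: (fin_all_measurable (P := fun l => [set x | coord (xg rho i) l - rho / 2 < coord x l < coord (xg rho i) l + rho / 2])) => l.
have -> : [set x : V | coord (xg rho i) l - rho / 2 < coord x l < coord (xg rho i) l + rho / 2] =
    [set x | coord (xg rho i) l - rho / 2 < coord x l] `&` [set x | coord x l < coord (xg rho i) l + rho / 2].
  by apply/seteqP; split => x /=; [move=> /andP[? ?]|move=> [-> ->]].
apply: measurableI; first by apply: measurable_set_gt; exact: measurable_coord.
by apply: measurable_set_lt; exact: measurable_coord.
Qed.

(** The pi-system on which [is_lebesgue_Rd] prescribes the measure. *)
Definition boxes : set (set V) := [set A | exists a b, A = box a b].

Lemma boxes_setI : setI_closed boxes.
Proof.
move=> _ _ [a [b ->]] [a' [b' ->]].
exists (\row_l Num.max (coord a l) (coord a' l)), (\row_l Num.min (coord b l) (coord b' l)).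
apply/seteqP; split => x /=.
  move=> [h h'] l; rewrite !coord_row gt_max le_min.
  by have /andP[-> ->] := h l; have /andP[-> ->] := h' l.
move=> h; split=> l; have := h l; rewrite !coord_row gt_max le_min;
  by move=> /andP[/andP[? ?] /andP[? ?]]; apply/andP.
Qed.

Definition cube (n : R) : set V := box (const_mx (- n)) (const_mx n).

Lemma cubeP n x : cube n x <-> forall l, - n < coord x l <= n.
Proof. by split=> h l; have := h l; rewrite /Defs.coord !mxE. Qed.

Lemma cube_bigcup : \bigcup_n cube n%:R = [set: V].
Proof.
rewrite -subTset => x _; have [n hn] : exists n : nat, norm1 x < n%:R.
  by exists (Num.truncn (norm1 x)).+1; exact: truncnS_gt.
exists n => //; apply/cubeP => l.
have := le_lt_trans (coord_le_norm1 x l) hn.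
by rewrite ltr_norml => /andP[-> /ltW ->].
Qed.

Lemma measurable_boxes : (measurable : set (set V)) = <<s boxes >>.
Proof.
apply/seteqP; split; last first.
  apply: smallest_sub; first exact: sigma_algebra_measurable.
  by move=> _ [a [b ->]]; exact: measurable_box.
apply: smallest_sub; first exact: smallest_sigma_algebra.
elim/big_ind : _ => [//|P Q hP hQ A [/hP|/hQ]//|l _ A [C mC <-]].
have h : measurable_fun [set: g_sigma_algebraType boxes] (fun z : V => coord z l).
  apply: (@measurability _ _ (g_sigma_algebraType boxes) R setT _ (@ocitv R) (erefl _)).
  move=> _ [_ [[u v] _ <-] <-]; rewrite setTI.
  have -> : (fun z : V => coord z l) @^-1` `]u, v] =
    \bigcup_n box (\row_l' if l' == l then u else - n%:R) (\row_l' if l' == l then v else n%:R).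
    apply/seteqP; split => x /=.
      rewrite in_itv/= => hx.
      have [n _ /cubeP hn] : (\bigcup_n cube n%:R) x by rewrite cube_bigcup.
      by exists n => // l'; rewrite !coord_row; case: eqP => // ->.
    by move=> [n _ /(_ l)]; rewrite in_itv /= !coord_row eqxx.
  apply: bigcupT_measurable => n; apply: sub_sigma_algebra.
  by eexists; eexists.
by have := h measurableT C mC; rewrite setTI.
Qed.

Definition dilation (s : R) (z : V) : V := s *: z.
HB.instance Definition _ s :=
  isMeasurableFun.Build _ _ _ _ (dilation s) (measurable_scaling s).

Variable lam : {measure set V -> \bar R}.
Hypothesis lamP : is_lebesgue_Rd lam.

Lemma lam_box a b : lam (box a b) = (\prod_l Num.max 0 (coord b l - coord a l))%:E.
Proof. exact: lamP. Qed.

Lemma lam_cube (n : R) : 0 <= n -> lam (cube n) = ((2 * n) ^+ d)%:E.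
Proof.
move=> n0; rewrite lam_box; congr (_%:E).
rewrite -[RHS](_ : \prod_(l < d) (2 * n) = _); last by rewrite prodr_const card_ord.
apply: eq_bigr => l _; rewrite /Defs.coord !mxE opprK (_ : n + n = 2 * n); last by ring.
by apply/max_idPr; rewrite mulr_ge0.
Qed.

(** Both sides are measures in [A] that agree on boxes and are finite on the cubes, so uniqueness of
    measures applies. *)
Lemma lam_dilation (s : R) (A : set V) : 0 < s -> measurable A ->
  lam (dilation s^-1 @^-1` A) = ((s ^+ d)%:E * lam A)%E.
Proof.
move=> s0 mA.
have sd0 : 0 <= s ^+ d by rewrite exprn_ge0// ltW.
pose m1 := pushforward lam (dilation s^-1).
pose m2 := mscale (NngNum sd0) lam.
suff : m1 A = m2 A by [].
apply: (measure_unique boxes (fun n => cube n%:R)) => //.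
- exact: measurable_boxes.
- exact: boxes_setI.
- by move=> n; eexists; eexists.
- exact: cube_bigcup.
- move=> _ [a [b ->]].
  change (lam (dilation s^-1 @^-1` box a b) = (s ^+ d)%:E * lam (box a b))%E.
  have -> : dilation s^-1 @^-1` box a b = box (s *: a) (s *: b).
    apply/seteqP; split => x /= h l; have := h l; rewrite /dilation !coordZ;
    by rewrite ltr_pdivlMl// ler_pdivrMl.
  rewrite !lam_box -EFinM; congr (_%:E).
  rewrite -[s ^+ d](_ : \prod_(l < d) s = _); last by rewrite prodr_const card_ord.
  rewrite -big_split /=; apply: eq_bigr => l _.
  by rewrite !coordZ -mulrBr maxr_pMr ?mulr0// ltW.
- move=> n; change (lam (dilation s^-1 @^-1` cube n%:R) < +oo)%E.
  have -> : dilation s^-1 @^-1` (cube n%:R) = cube (s * n%:R).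
    apply/seteqP; split => x /= /cubeP h; apply/cubeP => l; have := h l; rewrite coordZ;
    by rewrite ltr_pdivlMl// ler_pdivrMl// mulrN.
  by rewrite lam_cube ?ltry// mulr_ge0// ltW.
Qed.

(* spheres of different radii are disjoint and, by scaling, no smaller in
   measure than the sphere of radius r if their radius is larger *)
Lemma lam_sphere (r : R) : 0 < r -> lam [set z | enorm z = r] = 0%E.
Proof.
move=> r0; pose S (s : R) : set V := [set z | enorm z = s * r].
have mS s : measurable (S s) by apply: measurable_set_eq; exact: measurable_enorm.
have -> : [set z | enorm z = r] = S 1%R by rewrite /S; under [RHS]eq_set do rewrite mul1r.
have hS s : 1 <= s -> (lam (S 1%R) <= lam (S s))%E.
  move=> s1; have s0 : 0 < s by lra.
  have -> : S s = dilation s^-1 @^-1` (S 1%R).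
    apply/seteqP; split => z /=; rewrite /S/= /dilation enormZ gtr0_norm ?invr_gt0// mul1r.
      by move=> ->; rewrite mulrA mulVf ?mul1r// gt_eqF.
    by move=> <-; rewrite mulrA divff ?mul1r// gt_eqF.
  rewrite lam_dilation// -[leLHS]mul1e lee_wpmul2r// lee_fin.
  by rewrite exprn_ege1.
pose s (k : nat) : R := 2 - k.+1%:R^-1.
have s1 k : 1 <= s k by rewrite /s lerBrDr -lerBrDl (_ : 2 - 1 = 1) ?invf_le1 ?ler1n//; ring.
have s2 k : s k <= 2 by rewrite gerBl invr_ge0.
pose c := (2 * (3 * r)) ^+ d.
have fin n : (n%:R%:E * lam (S 1%R) <= c%:E)%E.
  rewrite -lam_cube; last by rewrite mulr_ge0// ltW.
  have -> : (n%:R%:E * lam (S 1%R) = \sum_(k < n) lam (S 1%R))%E.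
    by rewrite sumr_const card_ord mule_natl.
  apply: (@le_trans _ _ (\sum_(k < n) lam (S (s k)))%E).
    by apply: lee_sum => k _; exact: hS.
  rewrite -(measure_bigsetU lam (F := fun k => S (s k)))//; last first.
    apply/trivIsetP => i j _ _ ij; rewrite -subset0 => z [hi hj].
    have hi' : enorm z = s i * r := hi; have hj' : enorm z = s j * r := hj.
    move/eqP: ij; apply; move: hi'; rewrite hj' => /(mulIf (lt0r_neq0 r0)).
    by move=> /(congr1 (fun x => 2 - x)); rewrite /s !subKr => /invr_inj /eqP; rewrite eqr_nat => /eqP [].
  rewrite le_measure ?inE//.
  - exact: bigsetU_measurable.
  - exact: measurable_box.
  rewrite -(bigcup_mkord n (fun k => S (s k))) => z [k _ hz0]; have hz : enorm z = s k * r := hz0; apply/cubeP => l.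
  have := coord_le_enorm z l; rewrite hz ler_norml.
  have := s2 k; have := s1 k => ? ? /andP[? ?]; nra.
apply/eqP; rewrite eq_le measure_ge0 andbT.
have fS : (lam (S 1%R) < +oo)%E by have := fin 1%N; rewrite mul1e => /le_lt_trans; apply; exact: ltry.
move: fin; rewrite -(@fineK _ (lam (S 1%R))) ?ge0_fin_numE// => fin.
rewrite lee_fin leNgt; apply/negP => h.
have := fin (Num.truncn (c / fine (lam (S 1%R)))).+1.
by rewrite -EFinM lee_fin leNgt -ltr_pdivrMr// truncnS_gt.
Qed.

(** The cell is open and the prescribed boxes are half-open, so it is squeezed between the box with
    the same sides and slightly shorter boxes. *)
Lemma lam_cell rho (i : 'rV[int]_d) : 0 < rho -> lam (cell rho i) = (rho ^+ d)%:E.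
Proof.
move=> rho0.
pose A (t : R) : V := \row_l (coord (xg rho i) l - rho / 2).
pose B (t : R) : V := \row_l (coord (xg rho i) l + rho / 2 - t).
have AB t : t <= rho -> lam (box (A t) (B t)) = ((rho - t) ^+ d)%:E.
  move=> t1; rewrite lam_box; congr (_%:E).
  rewrite -[RHS](_ : \prod_(l < d) (rho - t) = _); last by rewrite prodr_const card_ord.
  apply: eq_bigr => l _; rewrite /A /B !coord_row.
  rewrite [X in Num.max 0 X](_ : _ = rho - t); last by lra.
  by apply/max_idPr; rewrite subr_ge0.
have up : (lam (cell rho i) <= (rho ^+ d)%:E)%E.
  rewrite -[in leRHS](subr0 rho) -AB; last exact: ltW.
  rewrite le_measure ?inE//.
  - exact: measurable_cell.
  - exact: measurable_box.
  move=> x hx l; have := hx l; rewrite !coord_row subr0.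
  by move=> /andP[-> /ltW].
have fin : lam (cell rho i) \is a fin_num by rewrite ge0_fin_numE// (le_lt_trans up) ?ltry.
apply/eqP; rewrite eq_le up/= -(fineK fin) lee_fin.
apply/ler_addgt0Pl => e e0.
(* Shortening every side by [rho * t] costs at most [d%:R * t * rho ^+ d] of the volume, which this
   choice keeps below [e]. *)
pose t := Num.min 1 (e / ((d.+1)%:R * rho ^+ d)).
have rd0 : 0 < rho ^+ d by rewrite exprn_gt0.
have t0 : 0 < t by rewrite lt_min ltr01 divr_gt0// mulr_gt0.
have t1 : t <= 1 by rewrite ge_min lexx.
have te : d%:R * t * rho ^+ d <= e.
  have : t <= e / ((d.+1)%:R * rho ^+ d) by rewrite ge_min lexx orbT.
  rewrite ler_pdivlMr ?mulr_gt0// => h; apply: le_trans h.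
  rewrite mulrA [t * _]mulrC ler_wpM2r//; first exact: ltW.
  by rewrite ler_wpM2r ?ler_nat//; exact: ltW.
have low : (((rho - rho * t) ^+ d)%:E <= lam (cell rho i))%E.
  rewrite -AB; last by rewrite ler_piMr//; exact: ltW.
  rewrite le_measure ?inE//.
  - exact: measurable_box.
  - exact: measurable_cell.
  move=> x hx l; have := hx l; rewrite !coord_row.
  by move=> /andP[-> /=]; have := mulr_gt0 rho0 t0; lra.
move: low; rewrite -(fineK fin) lee_fin => low.
rewrite -lerBlDl; apply: le_trans low.
have -> : rho - rho * t = rho * (1 - t) by ring.
rewrite exprMn.
(* Bernoulli's inequality [(1 - t)^d >= 1 - d t], read off from the telescoping bound for
   products. *)
have h : `|\prod_(l < d) (1 : R) - \prod_(l < d) (1 - t)| <= \sum_(l < d) `|1 - (1 - t)|.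
  by apply: ler_dist_prod => _; rewrite ?ler01 ?lexx// subr_ge0 t1/= gerBl; exact: ltW.
move: h; rewrite !prodr_const card_ord expr1n subKr sumr_const card_ord -mulr_natl.
rewrite (ger0_norm (ltW t0)) => /ler_normlW h.
nra.
Qed.

Lemma cell_disjoint rho (i j : 'rV[int]_d) (x : V) : 0 < rho ->
  cell rho i x -> cell rho j x -> i = j.
Proof.
move=> rho0 hi hj; apply/rowP => l; have := hi l; have := hj l.
rewrite !coord_xg => /andP[h1 h2] /andP[h3 h4].
have H (m n : int) : rho * m%:~R < rho * n%:~R + rho -> m <= n.
  rewrite -[X in _ + X]mulr1 -mulrDr ltr_pM2l// -[1]/(1%:~R) -intrD ltr_int.
  by rewrite ltzD1.
by apply/eqP; rewrite eq_le !H//; lra.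
Qed.

Lemma cell_near rho (i : 'rV[int]_d) (x : V) : cell rho i x ->
  forall l, `|coord x l - coord (xg rho i) l| <= rho / 2.
Proof. by move=> h l; have /andP[h1 h2] := h l; rewrite ler_norml; lra. Qed.

End Boxes.

(** * Moments of the Levy measure *)

Section Dyadic.
Context {R : realType}.
Implicit Types (r s x y : R).

(* the solution of D(r) = r^s + D(2 r) that vanishes at r = 2 *)
Definition dyad s r : R := (r `^ s - 2 `^ s) / (1 - 2 `^ s).

Lemma powR_le_neg s x y : s <= 0 -> 0 < x -> x <= y -> y `^ s <= x `^ s.
Proof.
move=> s0 x0 xy; have y0 := lt_le_trans x0 xy.
rewrite -[s]opprK (powRN x) (powRN y) lef_pV2 ?posrE ?powR_gt0//.
by apply: ge0_ler_powR => //; rewrite ?oppr_ge0// nnegrE ltW.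
Qed.

Lemma powR2_gt1 s : 0 < s -> (1 : R) < 2 `^ s.
Proof.
move=> s0; have := @gt0_ltr_powR R s s0 1 2; rewrite !nnegrE powR1.
by apply; rewrite ?ler01 ?ler0n ?ltr1n.
Qed.

Lemma powR2_lt1 s : s < 0 -> (2 : R) `^ s < 1.
Proof.
move=> s0; rewrite -[s]opprK powRN invf_lt1 ?powR_gt0//.
by apply: powR2_gt1; rewrite oppr_gt0.
Qed.

(** At [s = 0] the denominator vanishes: this is the logarithmic case, which [sig != 1] excludes for
    the first moment. *)
Lemma dyad_rec s r : 0 < r -> s != 0 -> dyad s r = r `^ s + dyad s (2 * r).
Proof.
move=> r0; rewrite neq_lt => s0.
have ne : 1 - 2 `^ s != 0.
  by case/orP: s0 => [/powR2_lt1|/powR2_gt1] h; [rewrite gt_eqF|rewrite lt_eqF]; lra.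
by rewrite /dyad powRM// ?(ltW r0)//; field.
Qed.

Lemma dyad_ge0 s r : 0 < r <= 2 -> s != 0 -> 0 <= dyad s r.
Proof.
move=> /andP[r0 r2]; rewrite neq_lt /dyad => /orP[s0|s0].
  rewrite divr_ge0 ?subr_ge0 ?(ltW (powR2_lt1 s0))//.
  by apply: powR_le_neg => //; exact: ltW.
rewrite -mulrNN -invrN; rewrite divr_ge0// oppr_ge0 subr_le0; last exact/ltW/powR2_gt1.
by apply: ge0_ler_powR => //; rewrite ?nnegrE// ltW.
Qed.

(** The sign of [s] decides the behaviour for small [r]: the innermost annulus dominates if [s < 0],
    whereas for [s > 0] the geometric sum stays bounded, as in [dyad_pos]. *)
Lemma dyad_neg s r : s < 0 -> dyad s r <= r `^ s / (1 - 2 `^ s).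
Proof.
move=> s0; rewrite ler_wpM2r ?invr_ge0 ?subr_ge0 ?(ltW (powR2_lt1 s0))//.
by rewrite gerBl powR_ge0.
Qed.

Lemma dyad_pos s r : 0 < s -> dyad s r <= 2 `^ s / (2 `^ s - 1).
Proof.
move=> s0; rewrite /dyad -mulrNN -invrN !opprB.
rewrite ler_wpM2r ?invr_ge0 ?subr_ge0 ?(ltW (powR2_gt1 s0))//.
by rewrite gerBl powR_ge0.
Qed.

End Dyadic.

Section LevyMeasure.
Context {R : realType} (d : nat).
Local Notation V := (Rd R d).
Variables (lam nu : {measure set V -> \bar R}).
Hypothesis lamP : is_lebesgue_Rd lam.
Hypothesis nu_int : (\int[nu]_z (Num.min 1 (enorm z ^+ 2))%:E < +oo)%E.
Implicit Types (r a : R) (A D : set V).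

Lemma measurable_enorm_gt r : measurable [set z : V | r < enorm z].
Proof. by apply: measurable_set_gt; exact: measurable_enorm. Qed.

Lemma measurable_enorm_ge r : measurable [set z : V | r <= enorm z].
Proof. by apply: measurable_set_ge; exact: measurable_enorm. Qed.

Lemma measurable_enorm_lt r : measurable [set z : V | enorm z < r].
Proof. by apply: measurable_set_lt; exact: measurable_enorm. Qed.

Lemma measurable_ring r a : measurable [set z : V | r < enorm z < a].
Proof.
have -> : [set z : V | r < enorm z < a] = [set z | r < enorm z] `&` [set z | enorm z < a].
  by apply/seteqP; split => z /=; [move/andP|move=> [-> ->]].
by apply: measurableI; [exact: measurable_enorm_gt|exact: measurable_enorm_lt].
Qed.

Lemma measurable_sqr_enorm : measurable_fun [set: V] (fun z : V => enorm z ^+ 2).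
Proof. by apply: measurable_funX; exact: measurable_enorm. Qed.

Lemma measurable_min1 : measurable_fun [set: V] (fun z : V => Num.min 1 (enorm z ^+ 2)).
Proof. by apply: measurable_minr => //; exact: measurable_sqr_enorm. Qed.

Lemma min1_ge0 (z : V) : 0 <= Num.min 1 (enorm z ^+ 2).
Proof. by rewrite le_min ler01 sqr_ge0. Qed.

(** One constant for both uses: it bounds the mass outside the unit ball and the second moment
    inside. *)
Definition levy_mass : R := \int[nu]_z (Num.min 1 (enorm z ^+ 2)).

Lemma levy_massE : (\int[nu]_z (Num.min 1 (enorm z ^+ 2))%:E)%E = levy_mass%:E.
Proof.
rewrite /levy_mass /Rintegral fineK// ge0_fin_numE//.
by apply: integral_ge0 => z _; rewrite lee_fin min1_ge0.
Qed.

Lemma levy_mass_ge0 : 0 <= levy_mass.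
Proof. by apply: Rintegral_ge0 => z _; exact: min1_ge0. Qed.

Lemma le_levy_mass A (f : V -> R) : measurable A -> measurable_fun [set: V] f ->
  (forall z, A z -> 0 <= f z <= Num.min 1 (enorm z ^+ 2)) ->
  (\int[nu]_(z in A) (f z)%:E <= levy_mass%:E)%E.
Proof.
move=> mA mf hf; rewrite -levy_massE.
apply: (@le_trans _ _ (\int[nu]_(z in A) (Num.min 1 (enorm z ^+ 2))%:E)%E).
  apply: ge0_le_integral => //.
  - by move=> z /hf /andP[]; rewrite lee_fin.
  - by apply/measurable_EFinP; exact: measurable_funTS.
  - by apply/measurable_EFinP; apply: measurable_funTS; exact: measurable_min1.
  - by move=> z /hf /andP[]; rewrite lee_fin.
apply: ge0_subset_integral => //.
- by apply/measurable_EFinP; exact: measurable_min1.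
- by move=> z _; rewrite lee_fin min1_ge0.
Qed.

(** Chebyshev's inequality: for [r <= 1] the truncated square is at least [r ^+ 2] on this set. *)
Lemma nu_ge_mass r : 0 < r <= 1 ->
  ((r ^+ 2)%:E * nu [set z | (r <= enorm z)%R] <= levy_mass%:E)%E.
Proof.
move=> /andP[r0 r1]; rewrite -integral_cst; last exact: measurable_enorm_ge.
apply: (le_levy_mass (f := fun=> r ^+ 2)); [exact: measurable_enorm_ge|by []|].
move=> z /= rz; rewrite sqr_ge0 le_min expr_le1// ?r1 ?(ltW r0)//=.
by rewrite ler_sqr ?nnegrE ?enorm_ge0// ltW.
Qed.

Lemma nu_ge_lty r : 0 < r <= 1 -> (nu [set z | (r <= enorm z)%R] < +oo)%E.
Proof.
move=> r01; have := nu_ge_mass r01; rewrite ltey; apply: contraTneq => ->.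
have /andP[r0 _] := r01.
by rewrite gt0_muley ?lte_fin ?exprn_gt0// -ltNge ltry.
Qed.

Lemma nu_sub_lty r A : 0 < r <= 1 -> measurable A -> A `<=` [set z | r <= enorm z] ->
  (nu A < +oo)%E.
Proof.
move=> r01 mA h; apply: le_lt_trans (nu_ge_lty r01).
by rewrite le_measure ?inE//; exact: measurable_enorm_ge.
Qed.

Lemma nu_ge1_mass : (nu [set z | (1 <= enorm z)%R] <= levy_mass%:E)%E.
Proof. by have := @nu_ge_mass 1; rewrite ltr01 lexx expr1n mul1e => /(_ isT). Qed.

Lemma integral_sqr_mass A : measurable A -> A `<=` [set z | enorm z < 1] ->
  (\int[nu]_(z in A) (enorm z ^+ 2)%:E <= levy_mass%:E)%E.
Proof.
move=> mA hA; apply: le_levy_mass => //; first exact: measurable_sqr_enorm.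
move=> z /hA /= z1; rewrite sqr_ge0 le_min lexx andbT/=.
by rewrite expr_le1 ?enorm_ge0// ltW.
Qed.

Lemma integrable_sqr A : measurable A -> A `<=` [set z | enorm z < 1] ->
  nu.-integrable A (fun z => (enorm z ^+ 2)%:E).
Proof.
move=> mA hA; apply/integrableP; split.
  by apply/measurable_EFinP; apply: measurable_funTS; exact: measurable_sqr_enorm.
under eq_integral do rewrite abse_EFin ger0_norm ?sqr_ge0//.
by apply: le_lt_trans (integral_sqr_mass mA hA) _; exact: ltry.
Qed.

Lemma bounded_integrable A (f : V -> R) (c : R) : measurable A ->
  (nu A < +oo)%E -> measurable_fun [set: V] f -> (forall z, A z -> `|f z| <= c) ->
  nu.-integrable A (EFin \o f).
Proof.
move=> mA fA mf hc; apply: measurable_bounded_integrable => //.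
  exact: measurable_funTS.
exists c; split; first exact: num_real.
by move=> x cx y Ay; apply: le_trans (hc _ Ay) _; exact: ltW.
Qed.

Variables (sig Cnu : R).
Hypothesis sig02 : 0 < sig < 2.
Hypothesis Cnu0 : 0 < Cnu.
Hypothesis nu_dens : exists g : V -> R, measurable_fun [set: V] g /\
     (forall z, 0 < enorm z < 1 -> 0 <= g z <= Cnu * enorm z `^ (- (d%:R + sig))) /\
     (forall A, measurable A -> A `<=` [set z | enorm z < 1] ->
        nu A = (\int[lam]_(z in A) (g z)%:E)%E).

Lemma nu_sphere r : 0 < r < 1 -> nu [set z | enorm z = r] = 0%E.
Proof.
move=> /andP[r0 r1]; have [g [mg [_ hg]]] := nu_dens.
have mS : measurable [set z : V | enorm z = r].
  by apply: measurable_set_eq; exact: measurable_enorm.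
rewrite hg//; last by move=> z /= ->.
apply: null_set_integral => //; last exact: (lam_sphere lamP).
by apply/measurable_EFinP; exact: measurable_funTS.
Qed.

(** The value scheme integrates over [r <= enorm z], whereas [lam_r] is the mass of [r < enorm z].
    Spheres being null, its two weights still add up to one. *)
Lemma nu_ge_gt r : 0 < r < 1 -> nu [set z | r <= enorm z] = nu [set z | r < enorm z].
Proof.
move=> r01; have -> : [set z : V | r <= enorm z] = [set z | enorm z = r] `|` [set z | r < enorm z].
  apply/seteqP; split => z /=.
    by rewrite le_eqVlt => /orP[/eqP->|]; [left|right].
  by move=> [->|/ltW].
rewrite measureU//; first 1 last.
- by apply: measurable_set_eq; exact: measurable_enorm.
- exact: measurable_enorm_gt.
- by apply/seteqP; split => z //= -[->]; rewrite ltxx.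
by rewrite [X in (X + _)%E](nu_sphere r01) add0e.
Qed.

Definition annulus r : set V := [set z | r < enorm z < 1] `&` [set z | enorm z <= 2 * r].

Lemma measurable_annulus r : measurable (annulus r).
Proof.
apply: measurableI; first exact: measurable_ring.
rewrite (_ : [set z : V | enorm z <= 2 * r] = ~` [set z | 2 * r < enorm z]).
  by apply: measurableC; exact: measurable_enorm_gt.
by apply/seteqP; split => z /=; rewrite leNgt => /negP.
Qed.

(** The density is at most [Cnu * r ^ (- (d + sig))] on the annulus, which lies in the cube of
    half-side [3 * r]; half-side [2 * r] would miss points on the excluded faces. *)
Lemma nu_annulus r : 0 < r -> (nu (annulus r) <= (Cnu * 6 ^+ d * r `^ (- sig))%:E)%E.
Proof.
move=> r0; have [g [mg [g_le hg]]] := nu_dens.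
have /andP[sig0 _] := sig02.
have mA := measurable_annulus r.
rewrite hg//; last by move=> z [/= /andP[]].
pose c := Cnu * r `^ (- (d%:R + sig)).
have c0 : 0 <= c by rewrite mulr_ge0 ?powR_ge0// ltW.
apply: (@le_trans _ _ (\int[lam]_(z in annulus r) (cst c%:E) z)%E).
  apply: ge0_le_integral => //.
  - move=> z [/= /andP[z1 z2] _]; rewrite lee_fin.
    have /andP[//] : 0 <= g z <= Cnu * enorm z `^ (- (d%:R + sig)).
    by apply: g_le; rewrite (lt_trans r0 z1) z2.
  - by apply/measurable_EFinP; exact: measurable_funTS.
  move=> z [/= /andP[z1 z2] _]; rewrite lee_fin.
  have /andP[_ h] : 0 <= g z <= Cnu * enorm z `^ (- (d%:R + sig)).
    by apply: g_le; rewrite (lt_trans r0 z1) z2.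
  apply: le_trans h _; rewrite ler_wpM2l ?(ltW Cnu0)//.
  by apply: powR_le_neg; rewrite ?oppr_le0 ?addr_ge0// ltW.
rewrite integral_cst//.
have h : (lam (annulus r) <= ((2 * (3 * r)) ^+ d)%:E)%E.
  rewrite -(lam_cube lamP); last by rewrite mulr_ge0// ltW.
  rewrite le_measure ?inE//; first exact: measurable_box.
  move=> z [/= /andP[z1 z2] z3]; apply/cubeP => l.
  by have := le_trans (coord_le_enorm z l) z3; rewrite ler_norml; lra.
apply: le_trans (lee_wpmul2l _ h) _; first by rewrite lee_fin.
rewrite -EFinM lee_fin /c opprD powRD; last by rewrite (gt_eqF r0) implybT.
rewrite (powRN r d%:R) powR_mulrn ?(ltW r0)// !exprMn.
have rd : r ^+ d != 0 by rewrite expf_neq0// gt_eqF.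
rewrite [leLHS](_ : _ = Cnu * (2 ^+ d * 3 ^+ d) * r `^ (- sig)); last by field.
by rewrite -exprMn (_ : 2 * 3 = 6)//; ring.
Qed.

Definition ring_moment (n : nat) r : \bar R :=
  (\int[nu]_(z in [set z | (r < enorm z < 1)%R]) (enorm z ^+ n)%:E)%E.

Lemma measurable_enormX n A : measurable_fun A (fun z : V => (enorm z ^+ n)%:E).
Proof.
by apply/measurable_EFinP; apply: measurable_funTS; apply: measurable_funX; exact: measurable_enorm.
Qed.

Definition ring_const (n : nat) : R := 2 ^+ n * (Cnu * 6 ^+ d).

Lemma ring_const_ge0 n : 0 <= ring_const n.
Proof. by rewrite /ring_const !mulr_ge0// ltW. Qed.

(** Each dyadic annulus contributes at most [(2 * r) ^+ n] times its mass, that is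
    [ring_const n * r ^ (n - sig)], and [dyad] solves the resulting recursion. *)
Lemma ring_moment_le n r : 0 < r < 2 -> n%:R - sig != 0 ->
  (ring_moment n r <= (ring_const n * dyad (n%:R - sig) r)%:E)%E.
Proof.
(* [m] counts the doublings that take [r] to at least 2. Admitting all [r < 2] makes the induction
   hypothesis available at [2 * r] whenever [r < 1]. *)
move=> + ns; have [m] : exists m : nat, 2 <= 2 ^+ m * r \/ r <= 0.
  have [r0|r0] := leP r 0; first by exists 0%N; right.
  exists (Num.truncn (2 / r)).+1; left; rewrite -ler_pdivrMr//.
  apply: le_trans (ltW (truncnS_gt _)) _.
  by rewrite -natrX ler_nat ltnW// ltn_expl.
elim: m r => [|m IH] r hm /andP[r0 r2].
  by exfalso; case: hm; rewrite ?expr0 ?mul1r; lra.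
have [r1|r1] := leP 1 r.
  have -> : ring_moment n r = 0%E.
    rewrite /ring_moment (_ : [set z | _] = set0) ?integral_set0//.
    by rewrite -subset0 => z /= /andP[? ?]; lra.
  by rewrite lee_fin mulr_ge0 ?ring_const_ge0// dyad_ge0// r0 ltW.
have hE : [set z : V | r < enorm z < 1] = annulus r `|` [set z : V | 2 * r < enorm z < 1].
  apply/seteqP; split => z.
    move=> /= /andP[z1 z2]; have [z3|z3] := leP (enorm z) (2 * r).
      by left; split => //; apply/andP; split.
    by right; apply/andP; split.
  by move=> [[]//|/= /andP[z1 z2]]; rewrite z2 andbT; apply: le_lt_trans z1; lra.
rewrite /ring_moment hE ge0_integral_setU//; first 1 last.
- exact: measurable_annulus.
- exact: measurable_ring.
- exact: measurable_enormX.
- by move=> z _; rewrite lee_fin exprn_ge0// enorm_ge0.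
- apply/disj_setPS => z [[_ /= h1] /= /andP[h2 _]]; lra.
have -> : ring_const n * dyad (n%:R - sig) r =
    ring_const n * r `^ (n%:R - sig) + ring_const n * dyad (n%:R - sig) (2 * r).
  by rewrite (dyad_rec r0 ns) mulrDr.
rewrite EFinD; apply: leeD; last first.
  apply: IH; last by apply/andP; split; lra.
  by case: hm; [left; rewrite mulrA -exprSr|right; lra].
apply: (@le_trans _ _ (\int[nu]_(z in annulus r) (cst ((2 * r) ^+ n)%:E) z)%E).
  apply: ge0_le_integral => //.
  - exact: measurable_annulus.
  - by move=> z _; rewrite lee_fin exprn_ge0// enorm_ge0.
  - exact: measurable_enormX.
  - move=> z [_ /= h]; rewrite lee_fin lerXn2r ?nnegrE ?enorm_ge0//; lra.
rewrite integral_cst; last exact: measurable_annulus.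
apply: le_trans (lee_wpmul2l _ (nu_annulus r0)) _.
  by rewrite lee_fin exprn_ge0// mulr_ge0// ltW.
rewrite -EFinM lee_fin /ring_const powRD; last by rewrite (gt_eqF r0) implybT.
rewrite powR_mulrn ?(ltW r0)// exprMn.
by rewrite [leRHS](_ : _ = 2 ^+ n * r ^+ n * (Cnu * 6 ^+ d * r `^ (- sig)))//; ring.
Qed.

End LevyMeasure.

(** * Truncated moments: jump rate, compensator and covariance *)

Section LevyMoments.
Context {R : realType} (d : nat).
Local Notation V := (Rd R d).
Variables (lam nu : {measure set V -> \bar R}).
Hypothesis lamP : is_lebesgue_Rd lam.
Hypothesis nu_int : (\int[nu]_z (Num.min 1 (enorm z ^+ 2))%:E < +oo)%E.
Implicit Types (r a : R) (A D : set V).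

Lemma lam_r_ge0 r : 0 <= lam_r nu r.
Proof. by apply: fine_ge0; exact: measure_ge0. Qed.

Lemma nu_gt_lty r : 0 < r <= 1 -> (nu [set z | (r < enorm z)%R] < +oo)%E.
Proof.
move=> r01; apply: (nu_sub_lty nu_int r01); first exact: measurable_enorm_gt.
by move=> z /= /ltW.
Qed.

Lemma nu_gtE r : 0 < r <= 1 -> nu [set z | (r < enorm z)%R] = (lam_r nu r)%:E.
Proof. by move=> r01; rewrite /lam_r fineK// ge0_fin_numE// nu_gt_lty. Qed.

Lemma nu_ring_lty r : 0 < r <= 1 -> (nu [set z | (r < enorm z < 1)%R] < +oo)%E.
Proof.
move=> r01; apply: (nu_sub_lty nu_int r01); first exact: measurable_ring.
by move=> z /= /andP[/ltW].
Qed.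

Lemma integrable_ring r (f : V -> R) (c : R) : 0 < r <= 1 ->
  measurable_fun [set: V] f -> (forall z, r < enorm z < 1 -> `|f z| <= c) ->
  nu.-integrable [set z | r < enorm z < 1] (EFin \o f).
Proof.
move=> r01 mf hc; apply: (bounded_integrable (c := c)) => //.
  exact: measurable_ring.
exact: nu_ring_lty.
Qed.

Definition ring_m1 r : R := \int[nu]_(z in [set z | r < enorm z < 1]) enorm z.

Lemma ring_m1_ge0 r : 0 <= ring_m1 r.
Proof. by apply: Rintegral_ge0 => z _; exact: enorm_ge0. Qed.

Lemma integrable_ring_enorm r : 0 < r <= 1 ->
  nu.-integrable [set z | r < enorm z < 1] (EFin \o (@enorm R d)).
Proof.
move=> r01; apply: (integrable_ring (c := 1) r01); first exact: measurable_enorm.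
by move=> z /andP[_ z1]; rewrite ger0_norm ?enorm_ge0// ltW.
Qed.

Lemma integrable_ring_coord r l : 0 < r <= 1 ->
  nu.-integrable [set z | r < enorm z < 1] (EFin \o (fun z => coord z l)).
Proof.
move=> r01; apply: (integrable_ring (c := 1) r01); first exact: measurable_coord.
move=> z /andP[_ z1]; apply: le_trans (coord_le_enorm _ _) _; exact: ltW.
Qed.

Lemma coord_b_r r l :
  coord (b_r nu r) l = \int[nu]_(z in [set z | r < enorm z < 1]) coord z l.
Proof. by rewrite /b_r coord_row. Qed.

Lemma b_r_le r l : 0 < r <= 1 -> `|coord (b_r nu r) l| <= ring_m1 r.
Proof.
move=> r01; rewrite coord_b_r.
apply: le_trans (le_normr_Rintegral _ (integrable_ring_coord l r01)) _.
  exact: measurable_ring.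
apply: le_Rintegral; first exact: measurable_ring.
- by apply: integrable_norm; exact: integrable_ring_coord.
- exact: integrable_ring_enorm.
- by move=> z _; exact: coord_le_enorm.
Qed.

Lemma integrable_ring_cst r (c : R) : 0 < r <= 1 ->
  nu.-integrable [set z | r < enorm z < 1] (EFin \o (fun=> c)).
Proof. by move=> r01; apply: (integrable_ring (c := `|c|) r01). Qed.

Lemma ring_sub r : measurable [set z : V | r < enorm z < 1] /\
  [set z : V | r < enorm z < 1] `<=` [set z | enorm z < 1].
Proof. by split; [exact: measurable_ring|move=> z /= /andP[]]. Qed.

Lemma nu_ring_le r : 0 < r <= 1 ->
  fine (nu [set z | r < enorm z < 1]) <= lam_r nu r.
Proof.
move=> r01; apply: fine_le; rewrite ?ge0_fin_numE ?nu_ring_lty ?nu_gt_lty//.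
rewrite le_measure ?inE//; first exact: measurable_ring.
  exact: measurable_enorm_gt.
by move=> z /= /andP[].
Qed.

(** These jumps are shorter than one. In particular a vanishing jump rate forces a vanishing
    compensator, which settles the degenerate case of [jump_defect]. *)
Lemma ring_m1_le_lam r : 0 < r <= 1 -> ring_m1 r <= lam_r nu r.
Proof.
move=> r01; apply: le_trans (nu_ring_le r01); rewrite -[leRHS]mul1r.
rewrite -Rintegral_cst; last exact: measurable_ring.
apply: le_Rintegral; first exact: measurable_ring.
- exact: integrable_ring_enorm.
- exact: integrable_ring_cst.
- by move=> z /= /andP[_ /ltW].
Qed.

Lemma ring_m2_le r : 
  \int[nu]_(z in [set z | r < enorm z < 1]) (enorm z ^+ 2) <= levy_mass nu.
Proof.
have [mA hA] := ring_sub r.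
rewrite /Rintegral -[leRHS]/(fine (levy_mass nu)%:E); apply: fine_le => //.
  by apply: integrable_fin_num => //; exact: integrable_sqr.
exact: integral_sqr_mass.
Qed.

(** Young's inequality under the integral. With [s ^+ 2 = h] the jump rate enters only as
    [h * lam_r], the exponent of the damping factor. *)
Lemma ring_m1_young r (s : R) : 0 < r <= 1 -> 0 < s ->
  s * ring_m1 r <= (s ^+ 2 * lam_r nu r + levy_mass nu) / 2.
Proof.
move=> r01 s0; have [mA hA] := ring_sub r.
have iq := integrable_sqr nu_int mA hA.
rewrite /ring_m1 -RintegralZl//; last exact: integrable_ring_enorm.
have i1 : nu.-integrable [set z | r < enorm z < 1] (EFin \o (fun=> s ^+ 2 / 2)).
  exact: integrable_ring_cst.
have i2 : nu.-integrable [set z | r < enorm z < 1] (EFin \o (fun z => 2^-1 * enorm z ^+ 2)).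
  have -> : EFin \o (fun z : V => 2^-1 * enorm z ^+ 2) = (fun z => (2^-1)%:E * (enorm z ^+ 2)%:E)%E.
    by apply/funext => z.
  exact: integrableZl.
apply: (@le_trans _ _ (\int[nu]_(z in [set z | r < enorm z < 1])
    (s ^+ 2 / 2 + 2^-1 * enorm z ^+ 2))).
  apply: le_Rintegral => //.
  - have -> : EFin \o (fun z : V => s * enorm z) = (fun z => s%:E * (enorm z)%:E)%E.
      by apply/funext => z.
    by apply: integrableZl => //; exact: integrable_ring_enorm.
  - have -> : EFin \o (fun z : V => s ^+ 2 / 2 + 2^-1 * enorm z ^+ 2) =
      ((EFin \o (fun=> (s ^+ 2 / 2)%R)) \+ (EFin \o (fun z : V => (2^-1 * enorm z ^+ 2)%R)))%E.
      by apply/funext => z.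
    exact: integrableD.
  - by move=> z _; have := sqr_ge0 (s - enorm z); rewrite sqrrB -mulr_natr; lra.
rewrite RintegralD// Rintegral_cst// RintegralZl//.
have := ring_m2_le r; have := nu_ring_le r01.
have : 0 <= s ^+ 2 by exact: sqr_ge0.
by move=> h1 h2 h3; have := ler_wpM2l h1 h2; lra.
Qed.

Lemma enorm_gt_split r : r < 1 ->
  [set z : V | r < enorm z] = [set z | r < enorm z < 1] `|` [set z | 1 <= enorm z].
Proof.
move=> r1; apply/seteqP; split => z /=.
  by move=> rz; have [z1|z1] := leP 1 (enorm z); [right|left; rewrite rz].
by move=> [/andP[]//|]; exact: lt_le_trans.
Qed.

Lemma ring_ge1_disjoint r :
  [set z : V | r < enorm z < 1] `&` [set z | 1 <= enorm z] = set0.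
Proof. by apply/seteqP; split => z //= -[/andP[_ z1]]; rewrite leNgt z1. Qed.

Lemma lam_r_split r : 0 < r < 1 ->
  ((lam_r nu r)%:E <= ring_moment nu 0 r + (levy_mass nu)%:E)%E.
Proof.
move=> /andP[r0 r1]; rewrite -nu_gtE ?r0 ?(ltW r1)//.
rewrite enorm_gt_split//.
rewrite measureU//; first 1 last.
- exact: measurable_ring.
- exact: measurable_enorm_ge.
- exact: ring_ge1_disjoint.
apply: leeD; last exact: nu_ge1_mass.
rewrite /ring_moment; under eq_integral do rewrite expr0.
by rewrite integral_cst ?mul1e//; exact: measurable_ring.
Qed.

Lemma levy_sqr_coord r (l : 'I_d) : 0 < r < 1 ->
  fine (\int[nu]_(z in [set z | (enorm z < r)%R]) (coord z l * coord z l)%:E)%E <= levy_mass nu.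
Proof.
move=> /andP[r0 r1].
have h : (\int[nu]_(z in [set z | (enorm z < r)%R]) (coord z l * coord z l)%:E <= (levy_mass nu)%:E)%E.
  apply: (le_levy_mass nu_int); first exact: measurable_enorm_lt.
    by apply: measurable_funM; exact: measurable_coord.
  move=> z /= zr; rewrite -expr2 sqr_ge0/= le_min.
  have h1 : coord z l ^+ 2 <= enorm z ^+ 2.
    by rewrite -(real_normK (num_real (coord z l))) ler_sqr ?nnegrE ?enorm_ge0// coord_le_enorm.
  rewrite h1 andbT (le_trans h1)// expr_le1 ?enorm_ge0//; lra.
rewrite -[leRHS]/(fine (levy_mass nu)%:E); apply: fine_le => //.
rewrite ge0_fin_numE; first exact: le_lt_trans h (ltry _).
by apply: integral_ge0 => z _; rewrite lee_fin -expr2 sqr_ge0.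
Qed.

(** As the root is symmetric, the squared norm of its column [m] is the diagonal entry [(m, m)] of
    the covariance. Without a root, [psd_sqrt] has its default value 0. *)
Lemma sigcol_le r (m : 'I_d) : 0 < r < 1 ->
  dotv (sigcol nu r m) (sigcol nu r m) <= levy_mass nu.
Proof.
move=> r01; have V0 := levy_mass_ge0 nu.
have -> : dotv (sigcol nu r m) (sigcol nu r m) = \sum_l sigma_r nu r l m ^+ 2.
  by apply: eq_bigr => l _; rewrite /sigcol /Defs.coord !mxE expr2.
rewrite /sigma_r /psd_sqrt; case: xgetP => [S _ [SS [_ h]]|_]; last first.
  by rewrite big1// => l _; rewrite mxE expr0n.
have -> : \sum_l S l m ^+ 2 = (S *m S) m m.
  by rewrite mxE; apply: eq_bigr => l _; rewrite expr2 -{1}SS mxE.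
rewrite h mxE; have := levy_sqr_coord m r01; lra.
Qed.

Variables (sig Cnu M : R).
Hypothesis sig02 : 0 < sig < 2.
Hypothesis sig1 : sig != 1.
Hypothesis Cnu0 : 0 < Cnu.
Hypothesis M0 : 0 < M.
Hypothesis nu_dens : exists g : V -> R, measurable_fun [set: V] g /\
     (forall z, 0 < enorm z < 1 -> 0 <= g z <= Cnu * enorm z `^ (- (d%:R + sig))) /\
     (forall A, measurable A -> A `<=` [set z | enorm z < 1] ->
        nu A = (\int[lam]_(z in A) (g z)%:E)%E).

Lemma ring_m1_dyad r : 0 < r < 1 -> ring_m1 r <= ring_const d Cnu 1 * dyad (1 - sig) r.
Proof.
move=> /andP[r0 r1].
rewrite -[leRHS]/(fine (_)%:E) /ring_m1 /Rintegral; apply: fine_le => //.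
  apply: integrable_fin_num; first exact: measurable_ring.
  by apply: integrable_ring_enorm; rewrite r0 ltW.
apply: (ring_moment_le (lam := lam) lamP sig02 Cnu0 nu_dens (n := 1)).
  by rewrite r0; lra.
by rewrite subr_eq0 eq_sym.
Qed.

Lemma lam_r_powR r : 0 < r < 1 ->
  lam_r nu r <= (ring_const d Cnu 0 / (1 - 2 `^ (- sig)) + levy_mass nu) * r `^ (- sig).
Proof.
move=> r01; have /andP[r0 r1] := r01; have /andP[s0 _] := sig02.
have h : (ring_moment nu 0 r <= (ring_const d Cnu 0 * dyad (0 - sig) r)%:E)%E.
  apply: (ring_moment_le (lam := lam) lamP sig02 Cnu0 nu_dens (n := 0)).
    by rewrite r0; lra.
  by rewrite sub0r oppr_eq0 gt_eqF.
have := le_trans (lam_r_split r01) (leeD h (lexx _)).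
rewrite -EFinD lee_fin sub0r => /le_trans; apply.
rewrite mulrDl; apply: lerD.
  rewrite -mulrA ler_wpM2l ?ring_const_ge0//.
  by rewrite [leRHS]mulrC; apply: dyad_neg; rewrite oppr_lt0.
(* The mass outside the unit ball is absorbed because [r ^ (- sig) >= 1]. *)
rewrite ler_peMr ?levy_mass_ge0// -[leLHS](_ : (1 : R) `^ (- sig) = 1); last by rewrite powR1.
apply: powR_le_neg; [by rewrite oppr_le0; exact: ltW|exact: r0|exact: ltW].
Qed.

(* for [sig < 1] the first moment is bounded in r; for [1 < sig] it is
   O(r^(1-sig)) and the mass lam_r is O(r^(-sig)), whence the exponent 1 - 2 sig *)
Lemma drift_defect : exists2 C1 : R, 0 <= C1 & forall h r : R, 0 < h -> 0 < r < 1 ->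
  (1 < sig -> h * r `^ (1 - 2 * sig) <= M) ->
  (1 - expR (- (h * lam_r nu r))) * ring_m1 r <= C1.
Proof.
have rc n := ring_const_ge0 d Cnu0 n.
have V0 := levy_mass_ge0 nu.
have /andP[s0 s2] := sig02.
move: sig1; rewrite neq_lt => /orP[sl|sg].
  have p : 0 < 1 - sig by lra.
  have q := powR2_gt1 p.
  exists (ring_const d Cnu 1 * (2 `^ (1 - sig) / (2 `^ (1 - sig) - 1))).
    by rewrite mulr_ge0// divr_ge0 ?powR_ge0// subr_ge0 ltW.
  move=> h r h0 r01 _.
  apply: (@le_trans _ _ (1 * ring_m1 r)).
    by rewrite ler_wpM2r ?ring_m1_ge0// gerBl expR_ge0.
  rewrite mul1r; apply: le_trans (ring_m1_dyad r01) _.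
  by rewrite ler_wpM2l// dyad_pos.
have p : 1 - sig < 0 by lra.
have q := powR2_lt1 p.
have q' : (2 : R) `^ (- sig) < 1 by apply: powR2_lt1; lra.
pose A := ring_const d Cnu 0 / (1 - 2 `^ (- sig)) + levy_mass nu.
pose B := ring_const d Cnu 1 / (1 - 2 `^ (1 - sig)).
have A0 : 0 <= A by apply: addr_ge0 => //; apply: divr_ge0; [exact: rc|rewrite subr_ge0; exact: ltW].
have B0 : 0 <= B by apply: divr_ge0; [exact: rc|rewrite subr_ge0; exact: ltW].
exists (A * B * M); first by rewrite mulr_ge0 ?(ltW M0)// mulr_ge0.
move=> h r h0 r01 /(_ sg) hM; have /andP[r0 r1] := r01.
have l0 := lam_r_ge0 r; have m0 := ring_m1_ge0 r.
apply: (@le_trans _ _ (h * lam_r nu r * ring_m1 r)).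
  rewrite ler_wpM2r// lerBlDr -lerBlDl.
  by have := expR_ge1Dx (- (h * lam_r nu r)); lra.
apply: (@le_trans _ _ (h * (A * r `^ (- sig)) * (B * r `^ (1 - sig)))).
  apply: ler_pM => //; first by rewrite mulr_ge0// ltW.
    by rewrite ler_wpM2l ?lam_r_powR// ltW.
  apply: le_trans (ring_m1_dyad r01) _; rewrite /B -mulrA ler_wpM2l//.
  by rewrite [leRHS]mulrC dyad_neg.
rewrite [leLHS](_ : _ = A * B * (h * (r `^ (- sig) * r `^ (1 - sig)))); last by ring.
rewrite -powRD; last by rewrite (gt_eqF r0) implybT.
rewrite (_ : - sig + (1 - sig) = 1 - 2 * sig); last by ring.
by rewrite ler_wpM2l// mulr_ge0.
Qed.

End LevyMoments.

(** * Lipschitz bound for the discrete value function *)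

(* Both lemmas include the divergent case, where integrals and infima have the
   junk value 0: two functions at bounded distance diverge together. *)
Section Stability.
Context {R : realType}.

Lemma Rintegral_dist {dd} {aT : measurableType dd} (mu : {measure set aT -> \bar R})
    (D : set aT) (f g b : aT -> R) : measurable D ->
  measurable_fun D f -> measurable_fun D g -> mu.-integrable D (EFin \o b) ->
  (forall x, D x -> `|f x - g x| <= b x) ->
  `|\int[mu]_(x in D) f x - \int[mu]_(x in D) g x| <= \int[mu]_(x in D) b x.
Proof.
move=> mD mf mg ib hb.
have tr (u v : aT -> R) : measurable_fun D u -> (forall x, D x -> `|u x - v x| <= b x) ->
    mu.-integrable D (EFin \o v) -> mu.-integrable D (EFin \o u).
  move=> mu_ h iv; apply: (@le_integrable _ _ _ mu D mD (EFin \o u) ((abse \o (EFin \o v)) \+ (EFin \o b))%E).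
  - exact/measurable_EFinP.
  - move=> x Dx; change (`|u x|%:E <= `| `|v x| + b x |%:E)%E; rewrite lee_fin.
    have := h x Dx; have := ler_normD (u x - v x) (v x); rewrite subrK => h1 h2.
    by apply: le_trans (ler_norm _); lra.
  - by apply: integrableD => //; exact: integrable_abse.
have junk (u : aT -> R) : measurable_fun D u -> ~ mu.-integrable D (EFin \o u) ->
    \int[mu]_(x in D) u x = 0.
  move=> mu_ nu_; have : ~ ((\int[mu]_(x in D) (u x)%:E)%E \is a fin_num).
    rewrite -integral_fin_num_abs// => h; apply: nu_; apply/integrableP; split => //.
    exact/measurable_EFinP.
  by rewrite /Rintegral; case: (\int[mu]_(x in D) _)%E.
have hb' x : D x -> `|g x - f x| <= b x by move=> Dx; rewrite distrC hb.
have [ifi|nif] := pselect (mu.-integrable D (EFin \o f)); last first.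
  have nig : ~ mu.-integrable D (EFin \o g) by move=> /(tr _ _ mf hb).
  rewrite (junk f mf nif) (junk g mg nig) subrr normr0; apply: Rintegral_ge0 => x Dx.
  exact: le_trans (hb x Dx).
have igi := tr _ _ mg hb' ifi.
rewrite -RintegralB//.
have ifg : mu.-integrable D (EFin \o (fun x => f x - g x)).
  by have := integrableB mD ifi igi; apply: eq_integrable => // x _.
apply: le_trans (le_normr_Rintegral mD ifg) _.
by apply: le_Rintegral => //; exact: integrable_norm.
Qed.

Lemma inf_dist (T : Type) (A B : T -> R) (c : R) : inhabited T ->
  (forall a, `|A a - B a| <= c) ->
  `|inf [set A a | a in [set: T]] - inf [set B a | a in [set: T]]| <= c.
Proof.
move=> [t0].
have half (P Q : T -> R) : (forall a, `|P a - Q a| <= c) ->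
    has_inf [set P a | a in [set: T]] ->
    has_inf [set Q a | a in [set: T]] /\
    inf [set P a | a in [set: T]] - c <= inf [set Q a | a in [set: T]].
  move=> h [_ lb].
  have hQ : lbound [set Q a | a in [set: T]] (inf [set P a | a in [set: T]] - c).
    move=> _ [a _ <-]; have := ge_inf lb (imageP P (I : [set: T] a)).
    by have := h a; rewrite ler_norml => /andP[]; lra.
  have Q0 : [set Q a | a in [set: T]] !=set0 by exists (Q t0), t0.
  by split; [split => //; eexists; exact: hQ|exact: lb_le_inf].
move=> h; have h' a : `|B a - A a| <= c by rewrite distrC.
have [iA|nA] := pselect (has_inf [set A a | a in [set: T]]); last first.
  have nB : ~ has_inf [set B a | a in [set: T]] by move=> /(half _ _ h') [].
  by rewrite !inf_out// subrr normr0 (le_trans _ (h t0)).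
have [iB h1] := half _ _ h iA; have [_ h2] := half _ _ h' iB.
by rewrite ler_norml; lra.
Qed.

End Stability.

Section JumpWeight.
Context {R : realType}.
Implicit Types (h lr : R).

(* equal to 0, and not to its limit h, at lr = 0 *)
Definition jump_weight h lr : R := (1 - expR (- (h * lr))) / lr.

Lemma jump_weightM h lr : jump_weight h lr * lr = 1 - expR (- (h * lr)).
Proof.
rewrite /jump_weight; have [->|n0] := eqVneq lr 0; last by rewrite divfK.
by rewrite !mulr0 oppr0 expR0 subrr.
Qed.

Lemma expR_le1 h lr : 0 <= h -> 0 <= lr -> expR (- (h * lr)) <= 1.
Proof. by move=> h0 l0; rewrite -[leRHS]expR0 ler_expR oppr_le0 mulr_ge0. Qed.

Lemma jump_weight_ge0 h lr : 0 <= h -> 0 <= lr -> 0 <= jump_weight h lr.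
Proof. by move=> h0 l0; rewrite divr_ge0// subr_ge0 expR_le1. Qed.

Lemma jump_weight_le h lr : 0 <= h -> 0 <= lr -> jump_weight h lr <= h.
Proof.
move=> h0; rewrite le_eqVlt => /predU1P[<-|l0]; first by rewrite /jump_weight invr0 mulr0.
rewrite ler_pdivrMr//; have := expR_ge1Dx (- (h * lr)); lra.
Qed.

(** This is [(1 + x) e^(-x) <= 1] at [x = h * lr]. At [lr = 0] it fails for [h > 0], since the
    weight is 0 there. *)
Lemma jump_weight_ge h lr : 0 <= h -> 0 < lr -> h * expR (- (h * lr)) <= jump_weight h lr.
Proof.
move=> h0 l0; rewrite ler_pdivlMr//.
have := expR_ge1Dx (h * lr); have := expR_gt0 (h * lr).
rewrite expRN; set E := expR _ => E0 E1.
have : E^-1 * (1 + h * lr) <= 1 by rewrite mulrC ler_pdivrMr// mul1r.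
by rewrite mulrDr mulr1; lra.
Qed.

End JumpWeight.

Section ValueFunction.
Context {R : realType} (d : nat).
Local Notation V := (Rd R d).
Variables (lam nu : {measure set V -> \bar R}).
Hypothesis d0 : (0 < d)%N.
Hypothesis nu_int : (\int[nu]_z (Num.min 1 (enorm z ^+ 2))%:E < +oo)%E.
Variables (L : V -> V -> R) (F G : V -> probability V R -> R) (T : R)
  (mu : R -> probability V R) (rho h r : R) (N : nat) (LL LF : R).
Hypothesis rho0 : 0 < rho.
Hypothesis h0 : 0 < h.
Hypothesis r01 : 0 < r < 1.
Hypothesis nu_sph : nu [set z | r <= enorm z] = nu [set z | r < enorm z].
Hypothesis LL0 : 0 <= LL.
Hypothesis LF0 : 0 <= LF.
Hypothesis Llip : forall x y q, `|L x q - L y q| <= LL * enorm (x - y).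
Hypothesis Flip : forall x y m, `|F x m - F y m| <= LF * enorm (x - y).
Hypothesis Glip : forall x y m, `|G x m - G y m| <= LF * enorm (x - y).

(** Stated through translations so that it combines with [interp_shift], and in the Euclidean norm
    of the assumptions on [L], [F] and [G]. *)
Definition grid_lip (K : R) (v : 'rV[int]_d -> R) : Prop :=
  forall i s, `|v (i + s) - v i| <= K * enorm (xg rho s : V).

Lemma xgD (i j : 'rV[int]_d) : xg rho (i + j) = xg rho i + xg rho j :> V.
Proof. by apply: eq_coord => l; rewrite coordD !coord_xg mxE intrD mulrDr. Qed.

Lemma xgN (i : 'rV[int]_d) : xg rho (- i) = - xg rho i :> V.
Proof. by apply: eq_coord => l; rewrite coordN !coord_xg mxE mulrNz mulrN. Qed.

Lemma grid_lip_norm1 K v : 0 <= K -> grid_lip K v ->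
  forall i j, `|v i - v j| <= K * norm1 (xg rho i - xg rho j : V).
Proof.
move=> K0 hv i j; have := hv j (i - j).
have -> : j + (i - j) = i by rewrite addrC subrK.
move=> /le_trans; apply.
by rewrite ler_wpM2l// xgD xgN enorm_le_norm1.
Qed.

Lemma measurable_interp K v : 0 <= K -> grid_lip K v ->
  measurable_fun [set: V] (interp rho v : V -> R).
Proof.
move=> K0 hv; apply: (@measurable_lipschitz _ _ _ (interp_lip d * K)).
  by rewrite mulr_ge0// !mulr_ge0// addr_ge0// mulr_ge0.
by move=> x y; apply: interp_lipschitz => //; exact: grid_lip_norm1.
Qed.

(** The diffusion and jump weights sum to one, so [K] is averaged and not amplified; only [h * F]
    and [h * L] add to it. *)
Lemma S_value_lip K v k a : 0 <= K -> grid_lip K v ->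
  forall i s, `|S_value nu L F mu rho h r v (i + s) k a -
                S_value nu L F mu rho h r v i k a| <=
              (h * (LF + LL) + K) * enorm (xg rho s : V).
Proof.
move=> K0 hv i s; rewrite /S_value xgD.
set e := enorm (xg rho s : V); set x := xg rho i : V; set xs := xg rho s : V.
set lr := lam_r nu r.
have e0 : 0 <= e by exact: enorm_ge0.
have lr0 : 0 <= lr by exact: lam_r_ge0.
have Idist y : `|interp rho v (y + xs) - interp rho v y| <= K * e.
  by rewrite (interp_shift rho0); apply: (interp_dist rho0) => j; exact: hv.
set P := expR _ / _; set S1 := \sum_(m < d) _; set S2 := \sum_(m < d) _.
set J1 := fine _; set J2 := fine _.
have hF : `|F (x + xs) (mu (k%:R * h)) - F x (mu (k%:R * h))| <= LF * e.
  by apply: le_trans (Flip _ _ _) _; rewrite addrC addKr.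
have hL : `|L (x + xs) a - L x a| <= LL * e.
  by apply: le_trans (Llip _ _ _) _; rewrite addrC addKr.
have P0 : 0 <= P by rewrite divr_ge0 ?expR_ge0// mulr_ge0.
have hS : `|S1 - S2| <= 2 * d%:R * (K * e).
  rewrite -sumrB; apply: le_trans (ler_norm_sum _ _ _) _.
  have -> : 2 * d%:R * (K * e) = \sum_(m < d) (2 * (K * e)).
    by rewrite sumr_const card_ord -mulr_natr; ring.
  apply: ler_sum => m _.
  have sh (y1 y2 : V) : x + xs + y1 + y2 = x + y1 + y2 + xs.
    by rewrite -!addrA; congr (_ + _); rewrite addrC -!addrA.
  rewrite !sh opprD addrACA; apply: le_trans (ler_normD _ _) _.
  have -> : 2 * (K * e) = K * e + K * e by ring.
  by apply: lerD; exact: Idist.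
have mI (y : V) D : measurable_fun D (fun z : V => interp rho v (y + z)).
  apply: measurable_funTS; apply: measurableT_comp (measurable_interp K0 hv) _.
  exact: measurable_translation.
have hJ : `|J1 - J2| <= K * e * lr.
  have r01' : 0 < r <= 1 by have /andP[-> /ltW ->] := r01.
  have -> : K * e * lr = \int[nu]_(z in [set z | r <= enorm z]) (K * e).
    rewrite Rintegral_cst; last exact: measurable_enorm_ge.
    by rewrite /lr /lam_r -nu_sph.
  apply: Rintegral_dist => //; first exact: measurable_enorm_ge.
    apply: (bounded_integrable (c := `|K * e|)) => //; first exact: measurable_enorm_ge.
    exact: nu_ge_lty.
  by move=> z _; rewrite -addrA [xs + z]addrC addrA Idist.
rewrite -/(jump_weight h lr); set k0 := jump_weight h lr.
have k00 : 0 <= k0 by apply: jump_weight_ge0 => //; exact: ltW.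
have kl : k0 * lr = 1 - expR (- (h * lr)) by exact: jump_weightM.
have hPS : `|P * S1 - P * S2| <= expR (- (h * lr)) * (K * e).
  rewrite -mulrBr normrM (ger0_norm P0); apply: le_trans (ler_wpM2l P0 hS) _.
  have dn : (2 * d%:R : R) != 0 by rewrite mulf_neq0 ?pnatr_eq0// -lt0n.
  by rewrite (mulrA P) /P (divfK dn).
have hkJ : `|k0 * J1 - k0 * J2| <= (1 - expR (- (h * lr))) * (K * e).
  rewrite -mulrBr normrM (ger0_norm k00); apply: le_trans (ler_wpM2l k00 hJ) _.
  by rewrite -kl (_ : k0 * (K * e * lr) = k0 * lr * (K * e))//; ring.
have hhF : `|h * F (x + xs) (mu (k%:R * h)) - h * F x (mu (k%:R * h))| <= h * (LF * e).
  by rewrite -mulrBr normrM (gtr0_norm h0) ler_wpM2l// ltW.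
have hhL : `|h * L (x + xs) a - h * L x a| <= h * (LL * e).
  by rewrite -mulrBr normrM (gtr0_norm h0) ler_wpM2l// ltW.
move: hPS hkJ hhF hhL; rewrite !ler_norml => /andP[a1 a2] /andP[b1 b2] /andP[c1 c2] /andP[d1 d2].
by apply/andP; split; lra.
Qed.

Lemma S_scheme_lip K v k : 0 <= K -> grid_lip K v ->
  grid_lip (h * (LF + LL) + K) (S_scheme nu L F mu rho h r v ^~ k).
Proof.
move=> K0 hv i s; apply: inf_dist; first exact: (inhabits 0).
by move=> a; exact: S_value_lip.
Qed.

Lemma u_back_lip n : grid_lip (LF + n%:R * (h * (LF + LL)))
  (u_back nu L F G T mu rho h r N n).
Proof.
have hh : 0 <= h * (LF + LL) by rewrite mulr_ge0 ?(ltW h0)// addr_ge0.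
elim: n => [|n IH] /=.
  rewrite mul0r addr0 => i s; apply: le_trans (Glip _ _ _) _.
  by rewrite xgD addrC addKr.
have -> : LF + n.+1%:R * (h * (LF + LL)) = h * (LF + LL) + (LF + n%:R * (h * (LF + LL))).
  by rewrite -natr1; ring.
by apply: S_scheme_lip => //; rewrite addr_ge0// mulr_ge0.
Qed.

Lemma u_grid_lip k : N%:R * h <= T ->
  grid_lip (LF + T * (LF + LL)) (u_grid nu L F G T mu rho h r N k).
Proof.
move=> NT i s; apply: le_trans (u_back_lip _ _ _) _.
rewrite ler_wpM2r ?enorm_ge0// lerD2l mulrA ler_wpM2r ?addr_ge0//.
apply: le_trans NT; rewrite ler_wpM2r ?(ltW h0)// ler_nat; exact: leq_subr.
Qed.

End ValueFunction.

(** * Gradient bounds for mollified Lipschitz functions *)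

Section Mollification.
Context {R : realType} (d : nat).
Local Notation V := (Rd R d).
Variables (lam : {measure set V -> \bar R}).
Hypothesis lamP : is_lebesgue_Rd lam.

(** The radial profile of [eta0], extended to negative arguments by a constant so that it is
    monotone on the line, hence measurable. *)
Let bump (t : R) : R := if t < 1 then expR (1 / (Num.max 0 t ^+ 2 - 1)) else 0.

Lemma bump_noninc : {homo bump : m n /~ n <= m}.
Proof.
move=> s t st; rewrite /bump.
have [t1|t1] := ltP t 1; last by case: ifP => // _; exact: expR_ge0.
rewrite (le_lt_trans st t1) ler_expR !div1r.
have hm : Num.max 0 s <= Num.max 0 t by rewrite ge_max !le_max lexx st orbT.
have s0 : 0 <= Num.max 0 s by rewrite le_max lexx.
have t0 := le_trans s0 hm.
have m1 : Num.max 0 t < 1 by rewrite gt_max ltr01.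
rewrite lef_nV2 ?negrE.
- by rewrite lerD2r lerXn2r.
- by rewrite subr_lt0 expr_lt1.
- by rewrite subr_lt0 expr_lt1// (le_lt_trans hm).
Qed.

Lemma eta0_bump (x : V) : eta0 x = bump (enorm x).
Proof. by rewrite /eta0 /bump max_r ?enorm_ge0. Qed.

Lemma measurable_eta0 : measurable_fun [set: V] (@eta0 R d).
Proof.
rewrite (_ : @eta0 R d = bump \o @enorm R d); last by apply/funext => x; exact: eta0_bump.
apply: (@measurableT_comp _ _ _ _ _ _ bump); last exact: measurable_enorm.
by apply: nonincreasing_measurable => //; exact: bump_noninc.
Qed.

Lemma eta0_itv (x : V) : 0 <= eta0 x <= 1.
Proof.
rewrite /eta0; case: ifP => [x1|_]; last by rewrite lexx ler01.
rewrite expR_ge0/= -[leRHS]expR0 ler_expR div1r invr_le0 subr_le0.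
by rewrite expr_le1 ?enorm_ge0// ltW.
Qed.

Lemma eta0_supp (x : V) : 1 <= enorm x -> eta0 x = 0.
Proof. by move=> h; rewrite /eta0 ltNge h. Qed.

(** A bound on the integral of [eta_eps] that is uniform in [eps]: the support lies in a cube of
    volume [(2 * eps) ^+ d], and the powers of [eps] cancel. *)
Definition eta_mass : R := (\int[lam]_y (eta0 y))^-1 * 2 ^+ d.

Lemma eta_mass_ge0 : 0 <= eta_mass.
Proof.
rewrite mulr_ge0// invr_ge0; apply: Rintegral_ge0 => y _.
by have /andP[] := eta0_itv y.
Qed.

Variable eps : R.
Hypothesis eps0 : 0 < eps.

Lemma measurable_eta : measurable_fun [set: V] (eta_eps lam eps : V -> R).
Proof.
apply: measurable_funM => //; apply: (measurableT_comp measurable_eta0).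
exact: measurable_scaling.
Qed.

Let c : R := (fine (\int[lam]_y (eta0 y)%:E)%E)^-1 * eps ^- d.

Lemma eta_const_ge0 : 0 <= c.
Proof.
rewrite mulr_ge0// ?invr_ge0 ?exprn_ge0 ?(ltW eps0)//.
apply: fine_ge0; apply: integral_ge0 => y _; rewrite lee_fin.
by have /andP[] := eta0_itv y.
Qed.

Lemma eta_ge0 (y : V) : 0 <= eta_eps lam eps y.
Proof. by rewrite mulr_ge0 ?eta_const_ge0//; have /andP[] := eta0_itv (eps^-1 *: y). Qed.

Lemma eta_le (y : V) : eta_eps lam eps y <= c * \1_(cube eps : set V) y.
Proof.
have c0 := eta_const_ge0; rewrite /eta_eps ler_wpM2l//.
have [h|h] := ltP (enorm y) eps.
  rewrite indicE mem_set ?(proj2 (andP (eta0_itv _)))//.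
  apply/cubeP => l; have := le_lt_trans (coord_le_enorm y l) h.
  by rewrite ltr_norml => /andP[-> /ltW].
rewrite eta0_supp ?indicE ?ler0n//.
by rewrite enormZ gtr0_norm ?invr_gt0// ler_pdivlMl// mulr1.
Qed.

Lemma integral_eta_le : (\int[lam]_y (eta_eps lam eps y)%:E <= eta_mass%:E)%E.
Proof.
have c0 := eta_const_ge0.
have mc : measurable (cube eps : set V) by exact: measurable_box.
apply: (@le_trans _ _ (\int[lam]_y (c%:E * (\1_(cube eps : set V) y)%:E))%E).
  apply: ge0_le_integral => //.
  - by move=> y _; rewrite lee_fin eta_ge0.
  - by apply/measurable_EFinP; exact: measurable_eta.
  - by apply/measurable_EFinP; apply: measurable_funM => //; exact: measurable_indic.
  - by move=> y _; rewrite -EFinM lee_fin eta_le.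
rewrite ge0_integralZl//; first 1 last.
- by apply/measurable_EFinP; exact: measurable_indic.
rewrite integral_indic// setIT lam_cube ?(ltW eps0)// -EFinM lee_fin /c /eta_mass.
rewrite exprMn -mulrA ler_wpM2l ?invr_ge0//.
  by apply: Rintegral_ge0 => y _; have /andP[] := eta0_itv y.
by rewrite mulrCA mulVf ?mulr1// expf_neq0// gt_eqF.
Qed.

Lemma integrable_eta : lam.-integrable [set: V] (EFin \o (eta_eps lam eps)).
Proof.
apply/integrableP; split; first by apply/measurable_EFinP; exact: measurable_eta.
under eq_integral do rewrite /= ger0_norm ?eta_ge0//.
by apply: le_lt_trans integral_eta_le _; exact: ltry.
Qed.

Lemma mollify_lip (w : V -> R) (K : R) : 0 <= K ->
  (forall x y, `|w x - w y| <= K * norm1 (x - y)) ->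
  forall x y, `|mollify lam eps w x - mollify lam eps w y| <= eta_mass * K * norm1 (x - y).
Proof.
move=> K0 hw x y.
have mw := measurable_lipschitz K0 hw.
have mwx (z : V) : measurable_fun [set: V] (fun u : V => w (z - u) * eta_eps lam eps u).
  apply: (measurable_funM _ measurable_eta); apply: (measurableT_comp mw).
  by apply: (measurableT_comp (measurable_translation _)); exact: measurable_opp.
have ib : lam.-integrable [set: V] (EFin \o (fun u => K * norm1 (x - y) * eta_eps lam eps u)).
  have -> : EFin \o (fun u : V => K * norm1 (x - y) * eta_eps lam eps u) =
    (fun u => (K * norm1 (x - y))%:E * (EFin \o eta_eps lam eps) u)%E by apply/funext.
  by apply: integrableZl => //; exact: integrable_eta.
have h (u : V) : [set: V] u -> `|w (x - u) * eta_eps lam eps u - w (y - u) * eta_eps lam eps u| <=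
    K * norm1 (x - y) * eta_eps lam eps u.
  move=> _; rewrite -mulrBl normrM (ger0_norm (eta_ge0 u)) ler_wpM2r ?eta_ge0//.
  apply: le_trans (hw _ _) _.
  by rewrite opprB addrA subrK.
apply: le_trans (Rintegral_dist measurableT (mwx x) (mwx y) ib h) _.
rewrite RintegralZl//; last exact: integrable_eta.
rewrite [leRHS](_ : _ = K * norm1 (x - y) * eta_mass); last by ring.
rewrite ler_wpM2l ?mulr_ge0 ?norm1_ge0//.
rewrite /Rintegral -[leRHS]/(fine eta_mass%:E); apply: fine_le => //; last exact: integral_eta_le.
by apply: integrable_fin_num => //; exact: integrable_eta.
Qed.

(** If the difference quotients converge, the limit inherits their bound; if not, ['D_v w x] is the
    default value 0. *)
Lemma derive_lip (w : V -> R) (K : R) (x v : V) : 0 <= K ->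
  (forall x y, `|w x - w y| <= K * norm1 (x - y)) ->
  `|'D_v w x| <= K * norm1 v.
Proof.
move=> K0 hw; rewrite /derive.
set q := (fun t : R => _).
have hq t : t != 0 -> `|q t| <= K * norm1 v.
  move=> t0; rewrite /q /= normrM normfV ler_pdivrMl ?normr_gt0//.
  apply: le_trans (hw _ _) _; rewrite addrK.
  have -> : norm1 (t *: v) = `|t| * norm1 v.
    by rewrite /norm1 mulr_sumr; apply: eq_bigr => l _; rewrite coordZ normrM.
  by rewrite mulrCA.
have [cq|ncq] := pselect (cvg (q t @[t --> 0^'])); last first.
  rewrite dvgP//; have -> : (point : R) = 0 by [].
  by rewrite normr0 mulr_ge0// norm1_ge0.
rewrite ler_norml; apply/andP; split.
  apply: limr_ge => //; near=> t; have : `|q t| <= K * norm1 v.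
    by apply: hq; near: t; exact: nbhs_dnbhs_neq.
  by rewrite ler_norml => /andP[].
apply: limr_le => //; near=> t; have : `|q t| <= K * norm1 v.
  by apply: hq; near: t; exact: nbhs_dnbhs_neq.
by rewrite ler_norml => /andP[].
Unshelve. all: by end_near. Qed.

Lemma norm1_unitv (l : 'I_d) : norm1 (unitv l : V) = 1.
Proof.
rewrite /norm1 (bigD1 l)//= big1 ?addr0.
  by rewrite /unitv /Defs.coord mxE !eqxx normr1.
by move=> k kl; rewrite /unitv /Defs.coord mxE eqxx (negbTE kl) normr0.
Qed.

Lemma grad_lip (w : V -> R) (K : R) (x : V) : 0 <= K ->
  (forall x y, `|w x - w y| <= K * norm1 (x - y)) -> enorm (grad w x) <= d%:R * K.
Proof.
move=> K0 hw; apply: le_trans (enorm_le_norm1 _) _.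
have -> : d%:R * K = \sum_(l < d) K by rewrite sumr_const card_ord mulr_natl.
apply: ler_sum => l _; rewrite /grad coord_row.
by have := derive_lip x (unitv l : V) K0 hw; rewrite norm1_unitv mulr1.
Qed.

End Mollification.

(** * The transition kernel of the Fokker-Planck scheme *)

Section Esum.
Context {R : realType}.

Lemma esum_exchange_le (I J : choiceType) (a : I -> J -> \bar R) :
  (forall i j, 0 <= a i j)%E ->
  (\esum_(i in [set: I]) \esum_(j in [set: J]) a i j <=
   \esum_(j in [set: J]) \esum_(i in [set: I]) a i j)%E.
Proof.
move=> a0; apply: ge_ereal_sup => _ [F [fF _] <-].
rewrite fsbig_finite//= -esum_sum//.
apply: le_esum => j _; rewrite -fsbig_finite//.
by apply: esum_ge; exists F.
Qed.

Lemma esum_exchange (I J : choiceType) (a : I -> J -> \bar R) :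
  (forall i j, 0 <= a i j)%E ->
  (\esum_(i in [set: I]) \esum_(j in [set: J]) a i j =
   \esum_(j in [set: J]) \esum_(i in [set: I]) a i j)%E.
Proof. by move=> a0; apply/eqP; rewrite eq_le !esum_exchange_le. Qed.

Lemma esum_nneseries (I : countType) (a : I -> \bar R) : (forall i, 0 <= a i)%E ->
  (\esum_(i in [set: I]) a i = \sum_(n <oo) oapp a 0 (pickle_inv n))%E.
Proof.
move=> a0; rewrite nneseries_esumT; last by move=> n; case: pickle_inv => /=.
have -> : (fun n => oapp a 0 (pickle_inv n))%E =
    (fun n => if n \in range (@pickle I) then oapp a 0 (pickle_inv n) else 0)%E.
  apply/funext => n; case: ifPn => //.
  have := @pickle_invK I n; case: (pickle_inv n) => [i|]//= <-.
  by rewrite mem_set//; exists i.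
rewrite -esum_mkcond (reindex_esum [set: I] _ (@pickle I)).
  by apply: eq_esum => i _; rewrite pickleK_inv.
split; [by move=> i _; exists i|by move=> i j _ _ /(pcan_inj pickleK)|by []].
Qed.

Lemma integral_esum {dd} {aT : measurableType dd} (mu : {measure set aT -> \bar R})
    (D : set aT) (I : countType) (f : I -> aT -> \bar R) : measurable D ->
  (forall i, measurable_fun D (f i)) -> (forall i x, 0 <= f i x)%E ->
  (\int[mu]_(x in D) (\esum_(i in [set: I]) f i x) =
   \esum_(i in [set: I]) \int[mu]_(x in D) f i x)%E.
Proof.
move=> mD mf f0; rewrite esum_nneseries; last by move=> i; exact: integral_ge0.
under eq_integral do rewrite esum_nneseries//.
rewrite integral_nneseries//.
- by apply: eq_eseriesr => n _; case: pickle_inv => //=; rewrite integral0.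
- by move=> n; case: pickle_inv => //= i.
- by move=> n x _; case: pickle_inv => //=.
Qed.

Lemma esum_seq (I : choiceType) (a : I -> \bar R) (s : seq I) : uniq s ->
  (forall i, 0 <= a i)%E -> (forall i, i \notin s -> a i = 0)%E ->
  (\esum_(i in [set: I]) a i = \sum_(i <- s) a i)%E.
Proof.
move=> us a0 hs; transitivity (\esum_(i in [set` s]) a i)%E.
  rewrite [RHS]esum_mkcond; apply: eq_esum => i _.
  by case: ifPn => //; rewrite mem_setE => /hs.
rewrite (@esum_fset R I [set` s] a (finite_seq s)); last by move=> i _; exact: a0.
by rewrite -(fsbig_seq _ a us).
Qed.

Lemma esumZl (I : countType) (c : R) (a : I -> \bar R) : 0 <= c -> (forall i, 0 <= a i)%E ->
  (\esum_(i in [set: I]) (c%:E * a i) = c%:E * \esum_(i in [set: I]) a i)%E.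
Proof.
move=> c0 a0; rewrite !esum_nneseries//; last by move=> i; rewrite mule_ge0.
rewrite -nneseriesZl//; last by move=> n _; case: pickle_inv => /=.
by apply: eq_eseriesr => n _; case: pickle_inv => //=; rewrite mule0.
Qed.

End Esum.

Section Cells.
Context {R : realType} (d : nat).
Local Notation V := (Rd R d).
Variable rho : R.
Hypothesis rho0 : 0 < rho.
Implicit Types (c v : 'rV[int]_d -> R) (i j : 'rV[int]_d).

Lemma interpZ (a : R) v (x : V) : interp rho (fun i => a * v i) x = a * interp rho v x.
Proof.
have [W [q [_ _ h _ _]]] := interpP rho0 x.
by rewrite !h mulr_sumr; apply: eq_bigr => e _; rewrite mulrA.
Qed.

Lemma interp_ge0 v (x : V) : (forall i, 0 <= v i) -> 0 <= interp rho v x.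
Proof. by move=> h; rewrite -(interp_cst rho0 0 x); apply: interp_le. Qed.

Lemma esum_beta v (x : V) : (forall i, 0 <= v i) ->
  (\esum_(i in [set: 'rV[int]_d]) (beta rho i x * v i)%:E = (interp rho v x)%:E)%E.
Proof.
move=> v0; have [k [th hx]] := in_cell_ex rho0 x.
have out i : i \notin corners k -> beta rho i x = 0 by exact: (corners_out rho0 hx).
rewrite (esum_seq (corners_uniq k)).
- rewrite sumEFin (interp_seq _ (corners_uniq k))//.
  by congr (_%:E); apply: eq_bigr => i _; rewrite mulrC.
- by move=> i; rewrite lee_fin mulr_ge0// beta_ge0.
- by move=> i /out ->; rewrite mul0r.
Qed.

Lemma measurable_beta i : measurable_fun [set: V] (beta rho i : V -> R).
Proof.
apply: (@measurable_lipschitz _ _ _ rho^-1); first by rewrite invr_ge0 ltW.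
by move=> x y; rewrite mulrC; exact: beta_dist.
Qed.

(** The open cells are disjoint but miss their faces, so the list has one element or none. *)
Lemma cell_seq (x : V) : exists s : seq 'rV[int]_d,
  [/\ uniq s, (size s <= 1)%N & forall i, i \notin s -> \1_(cell rho i) x = 0 :> R].
Proof.
have [[i0 hi0]|h] := pselect (exists i, cell rho i x).
  exists [:: i0]; split=> // i; rewrite inE => ne; rewrite indicE memNset//.
  by move=> hi; move/eqP: ne; apply; exact: (cell_disjoint rho0 hi hi0).
exists [::]; split=> // i _; rewrite indicE memNset// => hi; apply: h.
by exists i.
Qed.

Lemma esum_cell c (x : V) : (forall i, 0 <= c i) ->
  (\esum_(i in [set: 'rV[int]_d]) (c i * \1_(cell rho i) x)%:E =
   (\sum_(i \in [set: 'rV[int]_d]) c i * \1_(cell rho i) x)%R%:E)%E.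
Proof.
move=> c0; have [s [us _ hs]] := cell_seq x.
rewrite (esum_seq us).
- rewrite sumEFin; congr (_%:E).
  rewrite (fsbigE s _ us)//; last by move=> i _ /hs ->; rewrite mulr0.
  by apply: eq_bigl => i; rewrite in_setT.
- by move=> i; rewrite lee_fin mulr_ge0.
- by move=> i /hs ->; rewrite mulr0.
Qed.

Lemma esum_cell_le1 (x : V) :
  (\esum_(i in [set: 'rV[int]_d]) (\1_(cell rho i) x)%:E <= (1 : R)%:E)%E.
Proof.
have [s [us s1 hs]] := cell_seq x.
rewrite (esum_seq us); first 1 last.
- by move=> i; rewrite lee_fin.
- by move=> i /hs ->.
case: s us s1 hs => [|i [|//]] _ _ _; first by rewrite big_nil lee_fin.
by rewrite big_seq1 lee_fin indicE lern1 leq_b1.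
Qed.

Lemma enorm_xg_ge (s : 'rV[int]_d) : s != 0 -> rho <= enorm (xg rho s : V).
Proof.
move=> s0; have [l hl] : exists l, s ord0 l != 0.
  apply/not_existsP => h; move/eqP: s0; apply; apply/rowP => l; rewrite mxE.
  by have /negP := h l; rewrite negbK => /eqP.
apply: le_trans (coord_le_enorm _ l); rewrite coord_xg normrM (gtr0_norm rho0).
rewrite ler_peMr ?(ltW rho0)// -intr_norm ler1z.
by rewrite -gtz0_ge1 normr_gt0.
Qed.

(** Distinct grid points are at least [rho] apart. The constant blows up as [rho] tends to 0 and
    serves for measurability only. *)
Lemma bounded_grid_lip v (b : R) : (forall i, 0 <= v i <= b) -> grid_lip rho (b / rho) v.
Proof.
move=> hv i s; have b0 : 0 <= b by have /andP[] := hv 0; exact: le_trans.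
have [->|s0] := eqVneq s 0.
  by rewrite addr0 subrr normr0 mulr_ge0 ?enorm_ge0// divr_ge0// ltW.
apply: (@le_trans _ _ b).
  by have := hv (i + s); have := hv i; rewrite ler_norml; lra.
rewrite -[leLHS](divfK (lt0r_neq0 rho0)) ler_wpM2l ?divr_ge0 ?(ltW rho0)//.
exact: enorm_xg_ge.
Qed.

Lemma measurable_interp_bounded v (b : R) : (forall i, 0 <= v i <= b) ->
  measurable_fun [set: V] (interp rho v : V -> R).
Proof.
move=> hv; have b0 : 0 <= b by have /andP[] := hv 0; exact: le_trans.
apply: (@measurable_interp _ _ _ rho0 (b / rho)).
  by rewrite divr_ge0// ltW.
exact: bounded_grid_lip.
Qed.

End Cells.

Section Kernel.
Context {R : realType} (d : nat).
Local Notation V := (Rd R d).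
Variables (lam nu : {measure set V -> \bar R}).
Hypothesis d0 : (0 < d)%N.
Hypothesis nu_int : (\int[nu]_z (Num.min 1 (enorm z ^+ 2))%:E < +oo)%E.
Variables (L : V -> V -> R) (DpH : V -> V -> V) (F G : V -> probability V R -> R)
  (m0 : probability V R) (T : R) (mu : R -> probability V R) (rho h r eps : R) (N : nat).
Hypothesis rho0 : 0 < rho.
Hypothesis h01 : 0 < h < 1.
Hypothesis r01 : 0 < r < 1.

Local Notation B := (Bker lam nu L DpH F G T mu rho h r eps N).
Local Notation Ph := (Phi lam nu L DpH F G T mu rho h r eps N).
Local Notation lr := (lam_r nu r).
Local Notation ex := (expR (- (h * lr))).
Local Notation kap := (jump_weight h lr).
Implicit Types (g : 'rV[int]_d -> R) (i j : 'rV[int]_d).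

Let h0 : 0 < h. Proof. by have /andP[] := h01. Qed.
Let r0 : 0 < r. Proof. by have /andP[] := r01. Qed.
Let r1 : 0 < r <= 1. Proof. by have /andP[-> /ltW ->] := r01. Qed.
Let lr0 : 0 <= lr. Proof. exact: lam_r_ge0. Qed.
Let kap0 : 0 <= kap. Proof. by apply: jump_weight_ge0 => //; exact: ltW. Qed.
Let ex0 : 0 < ex. Proof. exact: expR_gt0. Qed.
Let kapl : kap * lr = 1 - ex. Proof. exact: jump_weightM. Qed.

(** The dual operator [(B g)_j] in closed form: summation over [i] turns every [beta rho i] into an
    interpolation of [g]. *)
Definition transition g j k : R :=
  ex / (2 * d%:R) * \sum_(p < d) (interp rho g (Ph j k p true) + interp rho g (Ph j k p false))
  + kap * \int[nu]_(z in [set z | r < enorm z]) interp rho g (xg rho j + z).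

Lemma measurable_jumps : measurable [set z : V | r < enorm z].
Proof. exact: measurable_enorm_gt. Qed.

Lemma integrable_interp g b D (x : V) : (forall i, 0 <= g i <= b) ->
  measurable D -> D `<=` [set z | r < enorm z] ->
  nu.-integrable D (EFin \o (fun z => interp rho g (x + z))).
Proof.
move=> hg mD hD; apply: (bounded_integrable (c := b)) => //.
- apply: le_lt_trans (nu_gt_lty nu_int r1).
  by rewrite le_measure ?inE//; exact: measurable_jumps.
- apply: (measurableT_comp (measurable_interp_bounded rho0 hg)).
  exact: measurable_translation.
move=> z _; rewrite ger0_norm; last by apply: interp_ge0 => // i; have /andP[] := hg i.
by rewrite -(interp_cst rho0 b (x + z)); apply: interp_le => // i; have /andP[] := hg i.
Qed.

Lemma Bker_ge0 i j k : 0 <= B i j k.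
Proof.
rewrite /Bker; apply: addr_ge0.
  apply: mulr_ge0; first by apply: divr_ge0; rewrite ?expR_ge0// mulr_ge0.
  by apply: sumr_ge0 => p _; rewrite addr_ge0// beta_ge0.
apply: mulr_ge0 => //; apply: fine_ge0; apply: integral_ge0 => z _.
by rewrite lee_fin beta_ge0.
Qed.

(** All terms are nonnegative, so the sum over [i] passes through the finite sum and the integral,
    where [esum_beta] evaluates it. *)
Lemma esum_Bker g b j k : (forall i, 0 <= g i <= b) ->
  (\esum_(i in [set: 'rV[int]_d]) (B i j k * g i)%:E = (transition g j k)%:E)%E.
Proof.
move=> hg; have g0 i : 0 <= g i by have /andP[] := hg i.
pose P := ex / (2 * d%:R).
have P0 : 0 <= P by rewrite divr_ge0 ?expR_ge0// mulr_ge0.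
pose Pg i := P * g i; pose kg i := kap * g i.
have Pg0 i : 0 <= Pg i by rewrite mulr_ge0.
have kg0 i : 0 <= kg i by rewrite mulr_ge0.
have Jfin i : (\int[nu]_(z in [set z | (r < enorm z)%R]) (beta rho i (xg rho j + z) * kg i)%:E)%E =
    (kap * fine (\int[nu]_(z in [set z | (r < enorm z)%R]) (beta rho i (xg rho j + z))%:E)%E * g i)%:E.
  have ib : nu.-integrable [set z | r < enorm z] (EFin \o (fun z => beta rho i (xg rho j + z))).
    apply: (bounded_integrable (c := 1)) => //; first exact: measurable_jumps.
    - exact: nu_gt_lty.
    - by apply: (measurableT_comp (measurable_beta rho0 i)); exact: measurable_translation.
    - by move=> z _; have /andP[? ?] := beta_itv rho0 i (xg rho j + z); rewrite ger0_norm.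
  under eq_integral do rewrite mulrC EFinM.
  rewrite integralZl//; last exact: measurable_jumps.
  rewrite -(fineK (integrable_fin_num measurable_jumps ib)) -EFinM /kg.
  by congr (_%:E); ring.
transitivity (\esum_(i in [set: 'rV[int]_d])
   (\sum_(p < d) ((beta rho i (Ph j k p true) * Pg i)%:E + (beta rho i (Ph j k p false) * Pg i)%:E)
    + \int[nu]_(z in [set z | (r < enorm z)%R]) (beta rho i (xg rho j + z) * kg i)%:E))%E.
  apply: eq_esum => i _; rewrite Jfin.
  under eq_bigr do rewrite -EFinD.
  rewrite sumEFin -EFinD; congr (_%:E); rewrite /Bker -/(jump_weight h lr) mulrDl; congr (_ + _).
  rewrite -/P mulrAC mulr_sumr; apply: eq_bigr => p _.
  by rewrite /Pg mulrDr [in LHS]mulrC [X in _ + X]mulrC.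
rewrite esumD; first 1 last.
- by move=> i _; apply: sume_ge0 => p _; rewrite -EFinD lee_fin addr_ge0// mulr_ge0// beta_ge0.
- by move=> i _; apply: integral_ge0 => z _; rewrite lee_fin mulr_ge0// beta_ge0.
rewrite esum_sum; last by move=> i p _ _; rewrite -EFinD lee_fin addr_ge0// mulr_ge0// beta_ge0.
rewrite -integral_esum; first 1 last.
- exact: measurable_jumps.
- move=> i; apply/measurable_EFinP; apply: measurable_funTS; apply: measurable_funM => //.
  by apply: (measurableT_comp (measurable_beta rho0 i)); exact: measurable_translation.
- by move=> i z; rewrite lee_fin mulr_ge0// beta_ge0.
have e1 p : (\esum_(i in [set: 'rV[int]_d]) ((beta rho i (Ph j k p true) * Pg i)%:E
      + (beta rho i (Ph j k p false) * Pg i)%:E) =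
    (P * (interp rho g (Ph j k p true) + interp rho g (Ph j k p false)))%:E)%E.
  rewrite esumD; first 1 last.
  - by move=> i _; rewrite lee_fin mulr_ge0// beta_ge0.
  - by move=> i _; rewrite lee_fin mulr_ge0// beta_ge0.
  by rewrite !esum_beta// -EFinD !interpZ// mulrDr.
rewrite (eq_bigr _ (fun p _ => e1 p)) sumEFin -mulr_sumr.
rewrite /transition EFinD; congr (_ + _)%E.
under eq_integral do rewrite (esum_beta rho0 _ kg0) (interpZ rho0) EFinM.
have ii := integrable_interp (xg rho j) hg measurable_jumps (fun z hz => hz).
by rewrite (integralZl measurable_jumps ii) -(fineK (integrable_fin_num measurable_jumps ii)) -EFinM.
Qed.

Lemma transition1 j k : transition (fun=> 1) j k = 1.
Proof.
rewrite /transition.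
under eq_bigr do rewrite !interp_cst//.
under eq_Rintegral do rewrite interp_cst//.
rewrite Rintegral_cst; last exact: measurable_jumps.
rewrite mul1r -/lr kapl sumr_const card_ord.
have dn : d%:R != 0 :> R by rewrite pnatr_eq0 -lt0n.
by rewrite -mulr_natr; field.
Qed.

End Kernel.

(** * One step of the dual operator on a function below a paraboloid *)

Section OneStep.
Context {R : realType} (d : nat).
Local Notation V := (Rd R d).
Variables (lam nu : {measure set V -> \bar R}).
Hypothesis d0 : (0 < d)%N.
Hypothesis nu_int : (\int[nu]_z (Num.min 1 (enorm z ^+ 2))%:E < +oo)%E.
Variables (L : V -> V -> R) (DpH : V -> V -> V) (F G : V -> probability V R -> R)
  (T : R) (mu : R -> probability V R) (rho h r eps : R) (N : nat).
Hypothesis rho0 : 0 < rho.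
Hypothesis h01 : 0 < h < 1.
Hypothesis r01 : 0 < r < 1.

Local Notation Ph := (Phi lam nu L DpH F G T mu rho h r eps N).
Local Notation lr := (lam_r nu r).
Local Notation ex := (expR (- (h * lr))).
Local Notation kap := (jump_weight h lr).
Local Notation w1 := (ring_m1 nu r).
Local Notation Vm := (levy_mass nu).
Local Notation tr := (transition lam nu L DpH F G T mu rho h r eps N).
Local Notation drift j k := (DpH (xg rho j) (grad (w_eps lam nu L F G T mu rho h r eps N (k%:R * h)) (xg rho j))).

Let h0 : 0 < h. Proof. by have /andP[] := h01. Qed.
Let r1 : 0 < r <= 1. Proof. by have /andP[-> /ltW ->] := r01. Qed.
Let lr0 : 0 <= lr. Proof. exact: lam_r_ge0. Qed.
Let kap0 : 0 <= kap. Proof. by apply: jump_weight_ge0 => //; exact: ltW. Qed.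
Let kaph : kap <= h. Proof. by apply: jump_weight_le => //; exact: ltW. Qed.
Let ex0 : 0 < ex. Proof. exact: expR_gt0. Qed.
Let ex1 : ex <= 1. Proof. by apply: expR_le1 => //; exact: ltW. Qed.
Let kapl : kap * lr = 1 - ex. Proof. exact: jump_weightM. Qed.
Let V0 : 0 <= Vm. Proof. exact: levy_mass_ge0. Qed.
Let w0 : 0 <= w1. Proof. exact: ring_m1_ge0. Qed.

(** The difference [kap - h * ex] is what survives of [b_r] when the mean of the small jumps
    compensates it. For [lr > 0] the weight [kap] lies between [h * ex] and [h]; for [lr = 0] the
    first moment is 0. *)
Lemma jump_defect : `|kap - h * ex| * w1 <= h * ((1 - ex) * w1).
Proof.
have [l0|l0] := eqVneq lr 0.
  have -> : w1 = 0 by apply/eqP; rewrite eq_le w0 -l0 ring_m1_le_lam.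
  by rewrite !mulr0.
rewrite mulrA ler_wpM2r//.
have l1 : 0 < lr by rewrite lt_neqAle eq_sym l0.
have ge := jump_weight_ge (ltW h0) l1.
rewrite ger0_norm ?subr_ge0// mulrBr mulr1; have := kaph; lra.
Qed.

(* e^(-x) x^2 <= 2 absorbs the square of the compensating drift *)
Lemma damped_drift_sqr : ex * (h * w1 ^+ 2) <= 1 + Vm ^+ 2.
Proof.
set x := h * lr; have x0 : 0 <= x by rewrite mulr_ge0// ltW.
have hy : Num.sqrt h * w1 <= (x + Vm) / 2.
  have := ring_m1_young nu_int r1 (s := Num.sqrt h); rewrite sqrtr_gt0 h0 => /(_ isT).
  by rewrite sqr_sqrtr// ltW.
have hq : h * w1 ^+ 2 <= (x ^+ 2 + Vm ^+ 2) / 2.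
  have : (Num.sqrt h * w1) ^+ 2 <= ((x + Vm) / 2) ^+ 2.
    rewrite ler_sqr ?nnegrE ?mulr_ge0 ?sqrtr_ge0 ?invr_ge0 ?addr_ge0//.
  rewrite exprMn sqr_sqrtr; last exact: ltW.
  move=> /le_trans; apply; have := sqr_ge0 (x - Vm); rewrite !expr2; lra.
have e2 : ex * x ^+ 2 <= 2.
  rewrite expRN mulrC ler_pdivrMr ?expR_gt0//.
  have := expR_ge1Dxn 1 x0; rewrite (_ : (2`!)%:R = 2 :> R)//; lra.
apply: le_trans (ler_wpM2l (ltW ex0) hq) _.
have : ex * Vm ^+ 2 <= Vm ^+ 2 by rewrite ler_piMl ?sqr_ge0.
have := sqr_ge0 Vm; lra.
Qed.

Lemma nu_ring_ge1 : fine (nu [set z | r < enorm z < 1]) + fine (nu [set z | 1 <= enorm z]) = lr.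
Proof.
have f1 := nu_ring_lty nu_int r1.
have f2 : (nu [set z | (1 <= enorm z)%R] < +oo)%E by apply: nu_ge_lty; rewrite ?ltr01 ?lexx.
rewrite -fineD ?ge0_fin_numE// /lam_r; congr fine.
rewrite enorm_gt_split; last by have /andP[] := r01.
rewrite measureU//.
- exact: measurable_ring.
- exact: measurable_enorm_ge.
- exact: ring_ge1_disjoint.
Qed.

Lemma nu_ge1_le : fine (nu [set z | 1 <= enorm z]) <= Vm.
Proof.
rewrite -[leRHS]/(fine Vm%:E); apply: fine_le => //; last exact: nu_ge1_mass.
by rewrite ge0_fin_numE//; apply: nu_ge_lty; rewrite ?ltr01 ?lexx.
Qed.

Variables (CD C1 M P : R).
Hypothesis CD0 : 0 <= CD.
Hypothesis P0 : 0 <= P.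
Hypothesis rhoM : rho ^+ 2 <= M * h.
Hypothesis hC1 : (1 - ex) * w1 <= C1.
Hypothesis hCD : forall j k, enorm (drift j k) <= CD.

(** In the application [g] is an infimal convolution, [A] its value at [x_j] plus a slack, [p] a
    slope there, and [a] is [(2 * delta)^-1]. *)
Variables (g : 'rV[int]_d -> R) (A a : R) (p : V) (j : 'rV[int]_d) (k : nat).
Hypothesis a0 : 0 <= a.
Hypothesis A0 : 0 <= A.
Hypothesis g2 : forall i, 0 <= g i <= 2.
Hypothesis hP : forall l, `|coord p l| <= P.
Hypothesis hg : forall i, g i <= A + dotv p (xg rho i - xg rho j)
   + a * dotv (xg rho i - xg rho j) (xg rho i - xg rho j).

Lemma interp_step (y : V) : interp rho g (xg rho j + y) <=
  A + dotv p y + a * (2 * dotv y y + 2 * (d%:R * rho ^+ 2)).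
Proof.
have := interp_quad rho0 (xg rho j + y) a0 hg.
by rewrite (_ : xg rho j + y - xg rho j = y)// addrC addKr.
Qed.

Let b : V := b_r nu r.
Let D : V := drift j k.

(** The two increments are [y + s] and [y - s]: the terms linear in [s] cancel, and the
    parallelogram identity adds up the squares. *)
Lemma interp_pair (m : 'I_d) :
  interp rho g (Ph j k m true) + interp rho g (Ph j k m false) <=
  2 * (A - h * dotv p (D + b)
     + a * (2 * h ^+ 2 * dotv (D + b) (D + b) + 2 * (h * d%:R) * Vm + 2 * (d%:R * rho ^+ 2))).
Proof.
have hd : 0 <= h * d%:R by rewrite mulr_ge0// ltW.
set s := Num.sqrt (h * d%:R) *: sigcol nu r m.
pose y : V := - (h *: (D + b)).
have e1 : Ph j k m true = xg rho j + (y + s).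
  by rewrite /Phi mul1r addrA.
have e2 : Ph j k m false = xg rho j + (y - s).
  by rewrite /Phi mulN1r scaleNr addrA.
have := interp_step (y + s); have := interp_step (y - s); rewrite -e1 -e2.
have ss : dotv s s <= h * d%:R * Vm.
  rewrite /s dotvZl dotvZr mulrA -expr2 sqr_sqrtr// ler_wpM2l//.
  by apply: sigcol_le.
have yy : dotv y y = h ^+ 2 * dotv (D + b) (D + b).
  by rewrite /y dotvNl dotvNr opprK dotvZl dotvZr; ring.
have py : dotv p y = - (h * dotv p (D + b)) by rewrite /y dotvNr dotvZr.
have := dotv_sqrD y s.
set u1 := dotv (y + s) (y + s); set u2 := dotv (y - s) (y - s) => sq.
rewrite (dotvDr y s p) (dotvDr y (- s) p) dotvNr py => q2 q1.
have h4 : a * (u1 + u2) <= a * (2 * (h ^+ 2 * dotv (D + b) (D + b)) + 2 * (h * d%:R * Vm)).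
  by rewrite ler_wpM2l// sq yy; lra.
move: h4; rewrite !mulrDr; move: q1 q2; rewrite !mulrDr.
set Z := dotv (D + b) (D + b); set W := dotv p (D + b); lra.
Qed.

(** [K1] collects the first-order terms, namely the drift [D], the uncompensated part of [b], and
    the jumps beyond the unit ball. [K2] collects the squares of both drifts, the covariance, the
    interpolation error with [rho ^+ 2 <= M * h], and the second moment of the small jumps. *)
Let K1 : R := P * d%:R * (CD + C1) + 2 * Vm.
Let K2 : R := 4 * CD ^+ 2 + 4 * d%:R * (1 + Vm ^+ 2) + 2 * d%:R * Vm + 2 * d%:R * M + 2 * Vm.

Let norm1D : norm1 D <= d%:R * CD.
Proof. by apply: le_trans (norm1_le_enorm _) _; rewrite ler_wpM2l// hCD. Qed.

Let norm1b : norm1 b <= d%:R * w1.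
Proof.
have -> : d%:R * w1 = \sum_(l < d) w1 by rewrite sumr_const card_ord mulr_natl.
by apply: ler_sum => l _; apply: b_r_le.
Qed.

Lemma diffusion_part :
  ex / (2 * d%:R) * (\sum_(m < d) (interp rho g (Ph j k m true) + interp rho g (Ph j k m false)))
  <= ex * A - ex * h * dotv p D - ex * h * dotv p b
     + a * h * (4 * CD ^+ 2 + 4 * d%:R * (1 + Vm ^+ 2) + 2 * d%:R * Vm)
     + ex * a * (2 * (d%:R * rho ^+ 2)).
Proof.
have dn : d%:R != 0 :> R by rewrite pnatr_eq0 -lt0n.
set Q := A - h * dotv p (D + b) + a * (2 * h ^+ 2 * dotv (D + b) (D + b)
   + 2 * (h * d%:R) * Vm + 2 * (d%:R * rho ^+ 2)).
apply: (@le_trans _ _ (ex * Q)).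
  have -> : ex * Q = ex / (2 * d%:R) * \sum_(m < d) (2 * Q).
    by rewrite sumr_const card_ord -mulr_natr; field.
  apply: ler_wpM2l; first by rewrite divr_ge0 ?(ltW ex0)// mulr_ge0.
  by apply: ler_sum => m _; exact: interp_pair.
have DD : dotv D D <= CD ^+ 2.
  by rewrite -sqr_enorm ler_sqr ?nnegrE ?enorm_ge0// hCD.
have bb : dotv b b <= d%:R * w1 ^+ 2 by apply: dotvv_le => l; exact: b_r_le.
(* The factor [ex * h] is spent in two ways: it is at most one in front of [CD ^+ 2], and against
   [w1 ^+ 2] it is needed for [damped_drift_sqr]. *)
have hb : ex * (h ^+ 2 * dotv (D + b) (D + b)) <= h * (2 * CD ^+ 2 + 2 * d%:R * (1 + Vm ^+ 2)).
  have exh : ex * h <= 1 by have /andP[_ /ltW h1] := h01; rewrite mulr_ile1// ltW.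
  have Z' : dotv (D + b) (D + b) <= 2 * CD ^+ 2 + 2 * (d%:R * w1 ^+ 2).
    by apply: le_trans (dotv_sqrD_le D b) _; lra.
  have eh0 : 0 <= ex * h ^+ 2 by rewrite mulr_ge0 ?sqr_ge0// ltW.
  rewrite mulrA; apply: le_trans (ler_wpM2l eh0 Z') _.
  rewrite [leLHS](_ : _ = h * ((ex * h) * (2 * CD ^+ 2) + 2 * d%:R * (ex * (h * w1 ^+ 2)))); last by ring.
  rewrite ler_wpM2l ?(ltW h0)//; apply: lerD.
    by rewrite ler_piMl// mulr_ge0 ?sqr_ge0.
  by rewrite ler_wpM2l ?mulr_ge0//; exact: damped_drift_sqr.
have hv : ex * (h * d%:R * Vm) <= h * d%:R * Vm.
  by rewrite ler_piMl// !mulr_ge0// ltW.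
have := ler_wpM2l a0 (lerD (lerD hb hb) (lerD hv hv)).
by rewrite /Q (dotvDr D b p); lra.
Qed.

(** Inside the unit ball the paraboloid is integrated, which produces [dotv p b] and a second
    moment; outside, only [g <= 2] is available, on a set of mass at most [Vm]. *)
Lemma jump_part :
  \int[nu]_(z in [set z | r < enorm z]) interp rho g (xg rho j + z) <=
  A * lr + dotv p b + 2 * a * Vm + a * (2 * (d%:R * rho ^+ 2)) * lr + 2 * Vm.
Proof.
have mR : measurable [set z : V | r < enorm z < 1] by exact: measurable_ring.
have mG : measurable [set z : V | 1 <= enorm z] by exact: measurable_enorm_ge.
have /andP[_ rlt1] := r01.
have E : [set z : V | r < enorm z] = _ := enorm_gt_split d rlt1.
have ii D' : measurable D' -> D' `<=` [set z | r < enorm z] ->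
    nu.-integrable D' (EFin \o (fun z : V => interp rho g (xg rho j + z))).
  by move=> mD hD; exact: (integrable_interp nu_int rho0 r01 (xg rho j) g2).
rewrite E Rintegral_setU//; first 1 last.
- by rewrite -E; apply: ii => //; exact: measurable_enorm_gt.
- by apply/disj_setPS; rewrite ring_ge1_disjoint.
set c := A + a * (2 * (d%:R * rho ^+ 2)).
have i1 : nu.-integrable [set z | r < enorm z < 1] (EFin \o (fun=> c)).
  exact: integrable_ring_cst.
have ic l : nu.-integrable [set z | r < enorm z < 1] (EFin \o (fun z : V => coord p l * coord z l)).
  have -> : EFin \o (fun z : V => coord p l * coord z l) =
      (fun z => (coord p l)%:E * (EFin \o (fun z : V => coord z l)) z)%E by apply/funext.
  by apply: integrableZl => //; exact: integrable_ring_coord.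
have i2 : nu.-integrable [set z | r < enorm z < 1] (EFin \o (dotv p)).
  have -> : EFin \o (dotv p) = (fun z => \sum_(l < d) (EFin \o (fun z : V => (coord p l * coord z l)%R)) z)%E.
    by apply/funext => z /=; rewrite sumEFin.
  by apply: integrable_sum.
have i3 : nu.-integrable [set z | r < enorm z < 1] (EFin \o (fun z : V => 2 * a * enorm z ^+ 2)).
  have -> : EFin \o (fun z : V => 2 * a * enorm z ^+ 2) =
      (fun z => (2 * a)%:E * (enorm z ^+ 2)%:E)%E by apply/funext.
  by apply: integrableZl => //; apply: integrable_sqr => //; move=> z /= /andP[].
have i12 : nu.-integrable [set z | r < enorm z < 1] (EFin \o (fun z : V => c + dotv p z)).
  have -> : EFin \o (fun z : V => c + dotv p z) = ((EFin \o (fun=> c)) \+ (EFin \o (dotv p)))%E.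
    by apply/funext.
  exact: integrableD.
have i123 : nu.-integrable [set z | r < enorm z < 1]
    (EFin \o (fun z : V => c + dotv p z + 2 * a * enorm z ^+ 2)).
  have -> : EFin \o (fun z : V => c + dotv p z + 2 * a * enorm z ^+ 2) =
    ((EFin \o (fun z : V => (c + dotv p z)%R)) \+ (EFin \o (fun z : V => (2 * a * enorm z ^+ 2)%R)))%E.
    by apply/funext.
  exact: integrableD.
have ip : \int[nu]_(z in [set z | r < enorm z < 1]) dotv p z = dotv p b.
  rewrite /Rintegral.
  transitivity (fine (\sum_(l < d) \int[nu]_(z in [set z | (r < enorm z < 1)%R]) (coord p l * coord z l)%:E)%E).
    congr fine; rewrite -integral_sum//; apply: eq_integral => z _.
    by rewrite sumEFin.
  have hl l : (\int[nu]_(z in [set z | (r < enorm z < 1)%R]) (coord p l * coord z l)%:E)%E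
      = (coord p l * coord b l)%:E.
    have il := integrable_ring_coord nu_int l r1.
    under eq_integral do rewrite EFinM.
    by rewrite (integralZl mR il) /b coord_b_r -(fineK (integrable_fin_num mR il)) -EFinM.
  by rewrite (eq_bigr _ (fun l _ => hl l)) sumEFin.
have J1 : \int[nu]_(z in [set z | r < enorm z < 1]) interp rho g (xg rho j + z) <=
    c * fine (nu [set z | r < enorm z < 1]) + dotv p b + 2 * a * Vm.
  apply: (@le_trans _ _ (\int[nu]_(z in [set z | r < enorm z < 1]) (c + dotv p z + 2 * a * enorm z ^+ 2))).
    apply: le_Rintegral => //; first by apply: ii => // z /= /andP[].
    by move=> z _; have := interp_step z; rewrite -sqr_enorm /c; lra.
  rewrite RintegralD// RintegralD// Rintegral_cst// ip lerD2l RintegralZl//; last first.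
    by apply: integrable_sqr => //; move=> z /= /andP[].
  by rewrite ler_wpM2l ?mulr_ge0//; exact: ring_m2_le.
(* Since [A >= 0], the bound 2 may be raised to [A + 2]; the terms in [A] of both regions then sum
   to [A * lr]. *)
have J2 : \int[nu]_(z in [set z | 1 <= enorm z]) interp rho g (xg rho j + z) <=
    (A + 2) * fine (nu [set z | 1 <= enorm z]).
  rewrite -Rintegral_cst//; apply: le_Rintegral => //.
  - by apply: ii => // z /=; exact: lt_le_trans.
  - apply: (bounded_integrable (c := `|A + 2|)) => //.
    by apply: nu_ge_lty; rewrite ?ltr01 ?lexx.
  move=> z _; apply: (@le_trans _ _ 2); last by rewrite lerDr.
  by rewrite -(interp_cst rho0 2 (xg rho j + z)); apply: interp_le => // i; have /andP[] := g2 i.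
have a20 : 0 <= a * (2 * (d%:R * rho ^+ 2)) by do 3!(apply: mulr_ge0 => //); exact: sqr_ge0.
have n0 : 0 <= fine (nu [set z | 1 <= enorm z]) by apply: fine_ge0.
have n1 := nu_ge1_le.
apply: le_trans (lerD J1 J2) _; rewrite -nu_ring_ge1 /c.
move: (mulr_ge0 a20 n0) n1; lra.
Qed.

(** By [kap * lr = 1 - ex] the multiples of [A], and those of [rho ^+ 2], recombine with total
    weight one. The multiples of [dotv p b] leave [kap - ex * h], controlled by [jump_defect]. *)
Lemma transition_le : tr g j k <= A + h * K1 + a * h * K2.
Proof.
have rho2 : 2 * (d%:R * rho ^+ 2) <= 2 * (d%:R * (M * h)).
  by rewrite ler_wpM2l// ler_wpM2l.
have := ler_wpM2l a0 rho2 => {}rho2.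
have jp := ler_wpM2l kap0 jump_part.
have dp := diffusion_part.
have pD : - (ex * h * dotv p D) <= h * (P * (d%:R * CD)).
  apply: le_trans (ler_norm _) _; rewrite normrN normrM.
  apply: (@le_trans _ _ (h * (P * norm1 D))); last by rewrite ler_wpM2l ?(ltW h0)// ler_wpM2l.
  have e0 : 0 <= ex * h by rewrite mulr_ge0 ?ltW.
  rewrite (ger0_norm e0); apply: ler_pM => //.
    by rewrite ler_piMl ?(ltW h0).
  exact: dotv_le_norm1.
have pb : (kap - ex * h) * dotv p b <= h * (P * (d%:R * C1)).
  apply: le_trans (ler_norm _) _; rewrite normrM.
  apply: (@le_trans _ _ (`|kap - h * ex| * (P * (d%:R * w1)))).
    rewrite (mulrC ex) ler_wpM2l//; apply: le_trans (dotv_le_norm1 b hP) _.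
    by rewrite ler_wpM2l.
  rewrite (_ : `|kap - h * ex| * _ = P * d%:R * (`|kap - h * ex| * w1)); last by ring.
  rewrite [leRHS](_ : _ = P * d%:R * (h * C1)); last by ring.
  rewrite ler_wpM2l ?mulr_ge0//; apply: le_trans jump_defect _.
  by rewrite ler_wpM2l ?(ltW h0).
have kV : kap * Vm <= h * Vm by rewrite ler_wpM2r.
have kaV : kap * (a * Vm) <= h * (a * Vm) by rewrite ler_wpM2r// mulr_ge0.
rewrite /transition; apply: le_trans (lerD dp jp) _.
have eq1 : kap * (A * lr + dotv p b + 2 * a * Vm + a * (2 * (d%:R * rho ^+ 2)) * lr + 2 * Vm) =
   (1 - ex) * A + kap * dotv p b + 2 * (kap * (a * Vm)) + (1 - ex) * (a * (2 * (d%:R * rho ^+ 2)))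
   + 2 * (kap * Vm).
  by rewrite -kapl; ring.
rewrite eq1 /K1 /K2; lra.
Qed.

End OneStep.

Lemma measurable_esum {R : realType} {dd} {aT : measurableType dd} (D : set aT)
    (I : countType) (f : I -> aT -> \bar R) :
  (forall i, measurable_fun D (f i)) -> (forall i x, 0 <= f i x)%E ->
  measurable_fun D (fun x => \esum_(i in [set: I]) f i x)%E.
Proof.
move=> mf f0.
have -> : (fun x => \esum_(i in [set: I]) f i x)%E =
    (fun x => \sum_(n <oo | n \in xpredT) oapp (f ^~ x) 0 (pickle_inv n))%E.
  by apply/funext => x; rewrite esum_nneseries.
apply: (@ge0_emeasurable_sum _ _ _ D (fun n x => oapp (f ^~ x) 0%E (pickle_inv n)) xpredT).
  by move=> n x _ _; case: pickle_inv => /=.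
by move=> n _; case: pickle_inv => [i|] //=.
Qed.

(** * Mass conservation, duality and the density *)

Section Masses.
Context {R : realType} (d : nat).
Local Notation V := (Rd R d).
Variables (lam nu : {measure set V -> \bar R}).
Hypothesis d0 : (0 < d)%N.
Hypothesis lamP : is_lebesgue_Rd lam.
Hypothesis nu_int : (\int[nu]_z (Num.min 1 (enorm z ^+ 2))%:E < +oo)%E.
Variables (L : V -> V -> R) (DpH : V -> V -> V) (F G : V -> probability V R -> R)
  (m0 : probability V R) (T : R) (mu : R -> probability V R) (rho h r eps : R) (N : nat).
Hypothesis rho0 : 0 < rho.
Hypothesis h01 : 0 < h < 1.
Hypothesis r01 : 0 < r < 1.

Local Notation I := 'rV[int]_d.
Local Notation B := (Bker lam nu L DpH F G T mu rho h r eps N).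
Local Notation tr := (transition lam nu L DpH F G T mu rho h r eps N).
Local Notation mg := (m_grid lam nu L DpH F G m0 T mu rho h r eps N).
Local Notation dens := (m_dens_k lam nu L DpH F G m0 T mu rho h r eps N).

Lemma term_le_esum (a : I -> \bar R) i : (forall j, 0 <= a j)%E ->
  (a i <= \esum_(j in [set: I]) a j)%E.
Proof.
move=> a0; apply: esum_ge; exists [set i]; last by rewrite fsbig_set1.
by split => //; exact: finite_set1.
Qed.

Lemma Bker_le1 i j k : B i j k <= 1.
Proof.
have B0 i' : 0 <= B i' j k by exact: Bker_ge0.
have := @term_le_esum (fun i' => (B i' j k * 1)%:E) i.
rewrite (esum_Bker lam nu_int L DpH F G T mu eps N rho0 h01 r01 (b := 1)); last by move=> _; rewrite ler01 lexx.
rewrite transition1// mulr1 lee_fin; apply => i'.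
by rewrite lee_fin mulr1.
Qed.

Lemma m_grid_ge0 k i : 0 <= mg k i.
Proof.
case: k => [|k] /=; first by apply: fine_ge0; exact: measure_ge0.
apply: fine_ge0; apply: esum_ge0 => j _.
elim: k i j => [|k IH] i j /=; rewrite lee_fin mulr_ge0 ?Bker_ge0//.
  by apply: fine_ge0; exact: measure_ge0.
by apply: fine_ge0; apply: esum_ge0.
Qed.

(** Kernel entries are at most one, so finite total mass makes each sum finite, and the [fine] in
    the recursion loses nothing. *)
Lemma m_gridS k i : (\esum_(j in [set: I]) (mg k j)%:E < +oo)%E ->
  (mg k.+1 i)%:E = (\esum_(j in [set: I]) (mg k j * B i j k)%:E)%E.
Proof.
move=> fin; rewrite /= fineK// ge0_fin_numE; last first.
  by apply: esum_ge0 => j _; rewrite lee_fin mulr_ge0 ?m_grid_ge0 ?Bker_ge0.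
apply: le_lt_trans fin; apply: le_esum => j _.
by rewrite lee_fin ler_piMr ?m_grid_ge0 ?Bker_le1.
Qed.

Lemma esum_m_gridS k g b : (\esum_(j in [set: I]) (mg k j)%:E < +oo)%E ->
  (forall i, 0 <= g i <= b) ->
  (\esum_(i in [set: I]) (mg k.+1 i * g i)%:E =
   \esum_(j in [set: I]) (mg k j * tr g j k)%:E)%E.
Proof.
move=> fin hg; have g0 i : 0 <= g i by have /andP[] := hg i.
transitivity (\esum_(i in [set: I]) \esum_(j in [set: I]) (mg k j * (B i j k * g i))%:E)%E.
  apply: eq_esum => i _; rewrite mulrC EFinM m_gridS// -esumZl//.
    by apply: eq_esum => j _; rewrite -EFinM; congr (_%:E); ring.
  by move=> j; rewrite lee_fin mulr_ge0 ?m_grid_ge0 ?Bker_ge0.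
rewrite esum_exchange; last first.
  by move=> i j; rewrite lee_fin !mulr_ge0 ?m_grid_ge0 ?Bker_ge0.
apply: eq_esum => j _.
under eq_esum do rewrite EFinM.
rewrite esumZl ?m_grid_ge0//; last by move=> i; rewrite lee_fin mulr_ge0 ?Bker_ge0.
by rewrite (esum_Bker lam nu_int L DpH F G T mu eps N rho0 h01 r01 (b := b)).
Qed.

(** Only an inequality, since [m0] may charge the faces between the open cells. *)
Lemma mass0 : (\esum_(i in [set: I]) (mg 0 i)%:E <= 1%:E)%E.
Proof.
have -> : (\esum_(i in [set: I]) (mg 0 i)%:E =
    \esum_(i in [set: I]) \int[m0]_x (\1_(cell rho i) x)%:E)%E.
  apply: eq_esum => i _ /=.
  have mC : measurable (cell rho i : set V) by exact: measurable_cell.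
  by rewrite integral_indic// setIT fineK// fin_num_measure.
rewrite -integral_esum//; last by move=> i; apply/measurable_EFinP; apply: measurable_indic; exact: measurable_cell.
have cs x : (\esum_(i in [set: I]) (\1_(cell rho i) x)%:E <= (1 : R)%:E)%E by exact: esum_cell_le1.
apply: (@le_trans _ _ (\int[m0]_x (cst 1%:E) x)%E); last first.
  by rewrite integral_cst// mul1e; exact: probability_le1.
apply: ge0_le_integral => //.
- by move=> x _; apply: esum_ge0 => i _; rewrite lee_fin.
- apply: measurable_esum => i; last by move=> x; rewrite lee_fin.
  by apply/measurable_EFinP; apply: measurable_indic; exact: measurable_cell.
Qed.

Lemma massS k : (\esum_(i in [set: I]) (mg k i)%:E <= 1%:E)%E ->
  (\esum_(i in [set: I]) (mg k.+1 i)%:E = \esum_(i in [set: I]) (mg k i)%:E)%E.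
Proof.
move=> mk; have fin := le_lt_trans mk (ltry _).
have := @esum_m_gridS k (fun=> 1) 1 fin; rewrite ler01 lexx => /(_ (fun=> isT)).
under eq_esum do rewrite mulr1.
by move=> ->; apply: eq_esum => j _; rewrite transition1// mulr1.
Qed.

Lemma mass_le1 k : (\esum_(i in [set: I]) (mg k i)%:E <= 1%:E)%E.
Proof. by elim: k => [|k IH]; [exact: mass0|rewrite massS]. Qed.

Lemma mass_fin k : (\esum_(i in [set: I]) (mg k i)%:E < +oo)%E.
Proof. exact: le_lt_trans (mass_le1 k) (ltry _). Qed.

(** The functional [X_k], used for nonnegative bounded [g], where [pairingE] shows the sum to be
    finite. *)
Definition pairing k (g : I -> R) : R := fine (\esum_(i in [set: I]) (mg k i * g i)%:E)%E.

Lemma pairingE k g b : (forall i, 0 <= g i <= b) ->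
  (\esum_(i in [set: I]) (mg k i * g i)%:E = (pairing k g)%:E)%E.
Proof.
move=> hg; rewrite fineK// ge0_fin_numE; last first.
  by apply: esum_ge0 => i _; rewrite lee_fin mulr_ge0 ?m_grid_ge0//; have /andP[] := hg i.
have b0 : 0 <= b by have /andP[] := hg 0; exact: le_trans.
apply: (@le_lt_trans _ _ (\esum_(i in [set: I]) (b%:E * (mg k i)%:E))%E).
  apply: le_esum => i _; rewrite lee_fin mulrC ler_wpM2r ?m_grid_ge0//.
  by have /andP[] := hg i.
rewrite esumZl//; last by move=> i; rewrite lee_fin m_grid_ge0.
by rewrite lte_mul_pinfty// mass_fin.
Qed.

Lemma pairing_le k g g' (b c : R) : 0 <= c -> (forall i, 0 <= g i <= b) ->
  (forall i, 0 <= g' i <= b) -> (forall i, g i <= g' i + c) ->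
  pairing k g <= pairing k g' + c.
Proof.
move=> c0 hg hg' hgg; rewrite -lee_fin EFinD -(pairingE k hg) -(pairingE k hg').
apply: (@le_trans _ _ (\esum_(i in [set: I]) ((mg k i * g' i)%:E + c%:E * (mg k i)%:E))%E).
  apply: le_esum => i _; rewrite -EFinM -EFinD lee_fin [c * _]mulrC -mulrDr.
  by rewrite ler_wpM2l ?m_grid_ge0.
rewrite esumD; first 1 last.
- by move=> i _; rewrite lee_fin mulr_ge0 ?m_grid_ge0//; have /andP[] := hg' i.
- by move=> i _; rewrite mule_ge0 ?lee_fin ?m_grid_ge0.
rewrite leeD2l// esumZl//; last by move=> i; rewrite lee_fin m_grid_ge0.
by rewrite -[leRHS]mule1 lee_wpmul2l ?lee_fin// mass_le1.
Qed.

(** Duality moves the step onto [g], and the additive error [c] is multiplied by a total mass of at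
    most one. *)
Lemma pairing_step k g (b c : R) : 0 <= c -> (forall i, 0 <= g i <= b) ->
  (forall j, tr g j k <= g j + c) -> pairing k.+1 g <= pairing k g + c.
Proof.
move=> c0 hg htr; rewrite -lee_fin EFinD -(pairingE k.+1 hg) -(pairingE k hg).
rewrite (esum_m_gridS (mass_fin k) hg).
apply: (@le_trans _ _ (\esum_(i in [set: I]) ((mg k i * g i)%:E + c%:E * (mg k i)%:E))%E).
  apply: le_esum => i _; rewrite -EFinM -EFinD lee_fin [c * _]mulrC -mulrDr.
  by rewrite ler_wpM2l ?m_grid_ge0.
rewrite esumD; first 1 last.
- by move=> i _; rewrite lee_fin mulr_ge0 ?m_grid_ge0//; have /andP[] := hg i.
- by move=> i _; rewrite mule_ge0 ?lee_fin ?m_grid_ge0.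
rewrite leeD2l// esumZl//; last by move=> i; rewrite lee_fin m_grid_ge0.
by rewrite -[leRHS]mule1 lee_wpmul2l ?lee_fin// mass_le1.
Qed.

Lemma pairing1 k : pairing k (fun=> 1) = pairing 0 (fun=> 1).
Proof.
rewrite /pairing; congr fine; under eq_esum do rewrite mulr1.
under [RHS]eq_esum do rewrite mulr1.
by elim: k => [//|k IH]; rewrite massS// mass_le1.
Qed.

Definition cell_avg (f : V -> R) (i : I) : R :=
  rho ^- d * \int[lam]_(x in cell rho i) f x.

Lemma measurable_cellV i : measurable (cell rho i : set V).
Proof. exact: measurable_cell. Qed.

Lemma rhod_neq0 : rho ^+ d != 0.
Proof. by rewrite expf_neq0// gt_eqF. Qed.

Lemma rhod_ge0 : 0 <= rho ^- d.
Proof. by rewrite invr_ge0 exprn_ge0// ltW. Qed.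

Lemma integrable_cell (f : V -> R) i (u v : R) : measurable_fun [set: V] f ->
  (forall x, cell rho i x -> u <= f x <= v) ->
  lam.-integrable (cell rho i) (EFin \o f).
Proof.
move=> mf hf; apply: (bounded_integrable (c := `|u| + `|v|)) => //.
- exact: measurable_cellV.
- by rewrite lam_cell// ltry.
move=> x /hf /andP[ux xv]; rewrite ler_norml.
have := ler_norm v; have := ler_norm (- u); rewrite normrN.
have := normr_ge0 u; have := normr_ge0 v; lra.
Qed.

Lemma cell_avg_itv (f : V -> R) i (u v : R) : measurable_fun [set: V] f ->
  (forall x, cell rho i x -> u <= f x <= v) -> u <= cell_avg f i <= v.
Proof.
move=> mf hf; have mC := measurable_cellV i.
have ic (c : R) : lam.-integrable (cell rho i) (EFin \o (fun=> c)).
  by apply: (integrable_cell (u := c) (v := c)) => // x _; rewrite lexx.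
have cE (c : R) : c = rho ^- d * \int[lam]_(x in cell rho i) c.
  by rewrite Rintegral_cst// lam_cell//= mulrCA mulVf ?mulr1// rhod_neq0.
have if_ := integrable_cell mf hf.
by rewrite [X in X <= _ <= _]cE [X in _ <= _ <= X]cE /cell_avg !ler_wpM2l ?rhod_ge0//;
  apply: le_Rintegral => // x /hf /andP[].
Qed.

Lemma dens_esum k (f : V -> R) x : 0 <= f x ->
  ((f x * dens k x)%:E = \esum_(i in [set: I]) (mg k i * rho ^- d * (f x * \1_(cell rho i) x))%:E)%E.
Proof.
move=> fx.
have c0 i : 0 <= mg k i * rho ^- d * f x by rewrite !mulr_ge0 ?m_grid_ge0 ?rhod_ge0.
under eq_esum do rewrite mulrA.
rewrite (esum_cell rho0 x c0) /m_dens_k; congr (_%:E).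
have [s [us _ hs]] := cell_seq rho0 x.
rewrite !(fsbigE s _ us)//; first 1 last.
- by move=> i _ /hs ->; rewrite mulr0.
- by move=> i _ /hs ->; rewrite mulr0.
by rewrite !mulr_sumr; apply: eq_bigr => i _; ring.
Qed.

Lemma integral_dens k (f : V -> R) b : measurable_fun [set: V] f ->
  (forall x, 0 <= f x <= b) ->
  (\int[lam]_x (f x * dens k x)%:E = (pairing k (cell_avg f))%:E)%E.
Proof.
move=> mf hf; have f0 x : 0 <= f x by have /andP[] := hf x.
have avg_itv i : 0 <= cell_avg f i <= b by apply: cell_avg_itv => // x _.
rewrite -(pairingE k avg_itv).
under eq_integral do rewrite dens_esum//.
rewrite integral_esum//; first 1 last.
- move=> i; apply/measurable_EFinP; apply: measurable_funM => //; apply: measurable_funM => //.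
  by apply: measurable_indic; exact: measurable_cellV.
- by move=> i x; rewrite lee_fin !mulr_ge0 ?m_grid_ge0 ?rhod_ge0.
apply: eq_esum => i _.
under eq_integral do rewrite EFinM.
have mC := measurable_cellV i.
rewrite ge0_integralZl//; first 1 last.
- by apply/measurable_EFinP; apply: measurable_funM => //; exact: measurable_indic.
- by move=> x _; rewrite lee_fin mulr_ge0.
- by rewrite lee_fin mulr_ge0 ?m_grid_ge0 ?rhod_ge0.
have -> : (\int[lam]_x (f x * \1_(cell rho i) x)%:E = \int[lam]_(x in cell rho i) (f x)%:E)%E.
  rewrite [RHS]integral_mkcond; apply: eq_integral => x _.
  by rewrite patchE indicE; case: ifP => _; rewrite ?mulr1 ?mulr0.
have if_ := integrable_cell mf (fun x _ => hf x) (i := i).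
by rewrite -(fineK (integrable_fin_num mC if_)) -EFinM /cell_avg mulrA.
Qed.

Lemma dens_ge0 k x : 0 <= dens k x.
Proof.
rewrite -lee_fin -[dens k x]mul1r (@dens_esum k (fun=> 1))//.
by apply: esum_ge0 => i _; rewrite lee_fin !mulr_ge0 ?m_grid_ge0 ?rhod_ge0.
Qed.

Lemma measurable_dens k : measurable_fun [set: V] (dens k).
Proof.
apply/measurable_EFinP.
have -> : EFin \o dens k = (fun x => \esum_(i in [set: I]) (mg k i * rho ^- d * (1 * \1_(cell rho i) x))%:E)%E.
  by apply/funext => x; rewrite -(@dens_esum k (fun=> 1))//= mul1r.
apply: measurable_esum => i; last by move=> x; rewrite lee_fin !mulr_ge0 ?m_grid_ge0 ?rhod_ge0.
apply/measurable_EFinP; apply: measurable_funM => //; apply: measurable_funM => //.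
by apply: measurable_indic; exact: measurable_cellV.
Qed.

Lemma integrable_dens k : lam.-integrable [set: V] (EFin \o dens k).
Proof.
apply/integrableP; split; first by apply/measurable_EFinP; exact: measurable_dens.
under eq_integral do rewrite /= ger0_norm ?dens_ge0// -[dens k _]mul1r.
by rewrite (@integral_dens k (fun=> 1) 1)// ?ltry// => _; rewrite ler01 lexx.
Qed.

Lemma integrable_fdens k (f : V -> R) (c : R) : measurable_fun [set: V] f ->
  (forall x, `|f x| <= c) -> lam.-integrable [set: V] (EFin \o (fun x => f x * dens k x)).
Proof.
move=> mf hf.
have ic : lam.-integrable [set: V] (EFin \o (fun x => c * dens k x)).
  have -> : EFin \o (fun x => c * dens k x) = (fun x => c%:E * (EFin \o dens k) x)%E by apply/funext.
  by apply: integrableZl => //; exact: integrable_dens.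
apply: le_integrable ic => //.
  by apply/measurable_EFinP; apply: measurable_funM => //; exact: measurable_dens.
move=> x _; rewrite /= lee_fin !normrM ler_wpM2r//.
exact: le_trans (hf x) (ler_norm _).
Qed.

(** Adding 1 makes the test function nonnegative. The correction is the total mass, written at time
    0 since it does not depend on [k]. *)
Lemma Rintegral_dens k (f : V -> R) : measurable_fun [set: V] f ->
  (forall x, `|f x| <= 1) ->
  \int[lam]_x (f x * dens k x) =
  pairing k (cell_avg (fun x => f x + 1)) - pairing 0 (fun=> 1).
Proof.
move=> mf hf.
have hf2 x : 0 <= f x + 1 <= 2 by have := hf x; rewrite ler_norml; lra.
have mf1 : measurable_fun [set: V] (fun x => f x + 1) by apply: measurable_funD.
have -> : pairing 0 (fun=> 1) = \int[lam]_x dens k x.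
  rewrite -(pairing1 k); transitivity (\int[lam]_x ((fun=> 1) x * dens k x)).
    rewrite /Rintegral (@integral_dens k (fun=> 1) 1)//=; last by move=> _; rewrite ler01 lexx.
    congr pairing; apply/funext => i; rewrite /cell_avg Rintegral_cst; last exact: measurable_cellV.
    by rewrite lam_cell//= mul1r mulVf// rhod_neq0.
  by apply: eq_Rintegral => x _; rewrite mul1r.
have -> : pairing k (cell_avg (fun x => f x + 1)) = \int[lam]_x ((f x + 1) * dens k x).
  by rewrite /Rintegral (@integral_dens k (fun x => f x + 1) 2).
rewrite -RintegralB//; first 1 last.
- by apply: (@integrable_fdens k _ 2) => // x; have := hf2 x; rewrite ler_norml; lra.
- exact: integrable_dens.
by apply: eq_Rintegral => x _; ring.
Qed.

End Masses.

(** * Regularized test functions and time regularity *)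

Section InfConvolution.
Context {R : realType} (d : nat).
Local Notation V := (Rd R d).
Local Notation I := 'rV[int]_d.
Variables (rho K delta : R) (f : I -> R).
Hypothesis delta0 : 0 < delta.
Hypothesis K1 : 1 <= K.
Hypothesis f2 : forall i, 0 <= f i <= 2.
Hypothesis fK : forall i j, `|f i - f j| <= K * enorm (xg rho i - xg rho j : V).

Let q (z : V) : R := (2 * delta)^-1 * dotv z z.

Let q_ge0 z : 0 <= q z.
Proof. by rewrite mulr_ge0 ?dotvv_ge0// invr_ge0 mulr_ge0// ltW. Qed.

(** The Moreau envelope of [f] over the grid. Near-minimizers are used in place of minimizers, at
    the price of the slack in [infconv_touch]. *)
Definition infconv (i : I) : R :=
  inf [set f l + q (xg rho i - xg rho l) | l in [set: I]].

Let S i := [set f l + q (xg rho i - xg rho l) | l in [set: I]].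

Let S_lb i : lbound (S i) 0.
Proof. by move=> _ [l _ <-]; rewrite addr_ge0//; have /andP[] := f2 l. Qed.

Let S_inf i : has_inf (S i).
Proof. by split; [exists (f i + q (xg rho i - xg rho i)), i|exists 0; exact: S_lb]. Qed.

Lemma infconv_le_at i l : infconv i <= f l + q (xg rho i - xg rho l).
Proof. by apply: ge_inf; [exact: (S_inf i).2|exists l]. Qed.

Lemma infconv_le i : infconv i <= f i.
Proof.
have := infconv_le_at i i; rewrite subrr /q.
have -> : dotv (0 : V) 0 = 0 by rewrite /dotv big1// => l _; rewrite coord0 mul0r.
by rewrite mulr0 addr0.
Qed.

Lemma infconv_ge0 i : 0 <= infconv i.
Proof. by apply: lb_le_inf; [exact: (S_inf i).1|exact: S_lb]. Qed.

Lemma infconv_itv i : 0 <= infconv i <= 2.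
Proof.
rewrite infconv_ge0/=; apply: le_trans (infconv_le i) _.
by have /andP[] := f2 i.
Qed.

Let qE z : delta * (2 * q z) = enorm z ^+ 2.
Proof. by rewrite sqr_enorm /q; field; rewrite gt_eqF. Qed.

(** Young's inequality: [K ^+ 2 * delta / 2] is the maximum of [K s - s^2 / (2 delta)] over the
    distance [s]. *)
Lemma le_infconv i : f i <= infconv i + K ^+ 2 * delta / 2.
Proof.
rewrite -lerBlDr; apply: lb_le_inf; first exact: (S_inf i).1.
move=> _ [l _ <-].
have := fK i l; set z := xg rho i - xg rho l; rewrite ler_norml => /andP[_ h].
have : K * enorm z <= q z + K ^+ 2 * delta / 2.
  rewrite -(ler_pM2l delta0).
  have := sqr_ge0 (enorm z - K * delta); rewrite sqrrB -(qE z) -mulr_natl; lra.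
lra.
Qed.

Let qD z y : q (z + y) = q z + dotv (delta^-1 *: y) z + q y.
Proof.
by rewrite /q !(dotvDl, dotvDr, dotvZl) (dotvC z y); field; rewrite gt_eqF.
Qed.

(* semiconcavity, with a slope bound that does not depend on delta *)
Lemma infconv_touch j (eta : R) : 0 < eta <= delta -> exists p : V,
  (forall l, `|coord p l| <= 2 * K + 2) /\
  forall i, infconv i <= infconv j + eta + dotv p (xg rho i - xg rho j)
    + (2 * delta)^-1 * dotv (xg rho i - xg rho j) (xg rho i - xg rho j).
Proof.
move=> /andP[eta0 etad].
have [_ [l _ <-] hl] := inf_adherent eta0 (S_inf j).
rewrite -/(infconv j) in hl.
set y : V := xg rho j - xg rho l in hl.
(* The slope is the gradient of [q] at [y]; one near-minimizer [l] for [j] serves as competitor at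
   every [i]. *)
exists (delta^-1 *: y); split.
  move=> m; rewrite coordZ normrM gtr0_norm ?invr_gt0// mulrC ler_pdivrMr//.
  apply: le_trans (coord_le_enorm y m) _.
  have h1 : q y < K * enorm y + eta.
    have := infconv_le j; have := fK j l; rewrite -/y ler_norml => /andP[_ ?]; lra.
  have h2 : enorm y ^+ 2 < 2 * delta * (K * enorm y + delta).
    rewrite -qE mulrCA mulrA ltr_pM2l ?mulr_gt0//; lra.
  rewrite leNgt; apply/negP => h3.
  have e1 : delta <= enorm y.
    apply: le_trans (ltW h3); rewrite ler_peMl ?(ltW delta0)//.
    have KK (u : R) : 1 <= u -> 1 <= 2 * u + 2 by lra.
    exact: KK.
  have : (2 * K + 2) * delta * enorm y <= enorm y ^+ 2.
    by rewrite expr2 ler_wpM2r ?enorm_ge0// ltW.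
  have : delta * delta <= delta * enorm y by rewrite ler_wpM2l// ltW.
  lra.
move=> i; apply: le_trans (infconv_le_at i l) _.
set z : V := xg rho i - xg rho j.
have -> : xg rho i - xg rho l = z + y by rewrite /z /y addrA subrK.
rewrite qD.
by rewrite -[(2 * delta)^-1 * _]/(q z); lra.
Qed.

End InfConvolution.

Lemma ler_dist3 {R : realType} (a b u v c e : R) : `|a - u| <= c -> `|b - v| <= c ->
  `|u - v| <= e -> `|a - b| <= e + 2 * c.
Proof.
rewrite !ler_norml => /andP[? ?] /andP[? ?] /andP[? ?].
by apply/andP; split; lra.
Qed.

Section PiecewiseLinear.
Context {R : realType}.

Definition plin (h : R) (x : nat -> R) (t : R) : R :=
  let k := Num.truncn (t / h) in let th := (t - k%:R * h) / h in
  (1 - th) * x k + th * x k.+1.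

Lemma truncn_frac (h t : R) : 0 < h -> 0 <= t ->
  0 <= (t - (Num.truncn (t / h))%:R * h) / h < 1.
Proof.
move=> h0 t0; have /truncn_itv : 0 <= t / h by rewrite divr_ge0// ltW.
move=> /andP[k1 k2]; rewrite mulrBl mulfK ?gt_eqF// subr_ge0 k1/=.
by rewrite ltrBlDr addrC natr1.
Qed.

Lemma plin_le (h c : R) (x y : nat -> R) u : 0 < h -> 0 <= u ->
  (forall n, x n <= y n + c) -> plin h x u <= plin h y u + c.
Proof.
move=> h0 u0 hxy; have := truncn_frac h0 u0; rewrite /plin /=.
set k := Num.truncn (u / h); set th := (u - _) / h => /andP[t0 t1].
have t1' : 0 <= 1 - th by rewrite subr_ge0 ltW.
have := lerD (ler_wpM2l t1' (hxy k)) (ler_wpM2l t0 (hxy k.+1)); lra.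
Qed.

(** After subtraction of the line of slope [c] the nodal values decrease, and so does their
    interpolation, whether the two times share an interval or not. *)
Lemma plin_slope (h c : R) (x : nat -> R) : 0 < h ->
  (forall k, x k.+1 <= x k + c * h) ->
  forall s t, 0 <= s <= t -> plin h x t - plin h x s <= c * (t - s).
Proof.
move=> h0 hx s t /andP[s0 st]; have t0 := le_trans s0 st.
pose z k := x k - c * (k%:R * h).
have zS k : z k.+1 <= z k by rewrite /z -natr1; have := hx k; lra.
have z_dec m n : (m <= n)%N -> z n <= z m.
  by elim: n => [|n IH]; [rewrite leqn0 => /eqP ->|rewrite leq_eqVlt => /predU1P[->//|/IH]; exact: le_trans].
have ze u : 0 <= u -> plin h x u - c * u = plin h z u.
  move=> u0; rewrite /plin /z -natr1; set k := (Num.truncn _)%:R; field.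
  by rewrite gt_eqF.
suff : plin h z t <= plin h z s by rewrite -!ze//; lra.
have := truncn_frac h0 s0; have := truncn_frac h0 t0; rewrite /plin /=.
set k := Num.truncn (s / h); set k' := Num.truncn (t / h).
set th := (s - _) / h; set th' := (t - _) / h => /andP[a0 a1] /andP[b0 b1].
have kk : (k <= k')%N.
  rewrite leqNgt; apply/negP => lt.
  have /truncn_itv/andP[i1 _] : 0 <= s / h by rewrite divr_ge0// ltW.
  have /truncn_itv/andP[_ i2] : 0 <= t / h by rewrite divr_ge0// ltW.
  have : k'.+1%:R <= k%:R :> R by rewrite ler_nat.
  have : s / h <= t / h by rewrite ler_pM2r ?invr_gt0.
  move: i1 i2; rewrite -/k -/k'; lra.
move: kk; rewrite leq_eqVlt => /predU1P[e|lt].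
  have thh : th <= th' by rewrite /th /th' e ler_pM2r ?invr_gt0// lerD2r.
  rewrite -e; have := zS k => h1.
  have : (th' - th) * (z k - z k.+1) >= 0 by rewrite mulr_ge0// subr_ge0.
  lra.
have h1 := z_dec _ _ lt; have h2 := zS k; have h3 := zS k'.
have : th' * (z k' - z k'.+1) >= 0 by rewrite mulr_ge0// subr_ge0.
have : (1 - th) * (z k - z k.+1) >= 0 by rewrite mulr_ge0 ?subr_ge0// ltW.
lra.
Qed.

End PiecewiseLinear.

(** * The one-sided estimate in time for a fixed test function *)

Section TimeRegularity.
Context {R : realType} (d : nat).
Local Notation V := (Rd R d).
Local Notation I := 'rV[int]_d.
Variables (lam nu : {measure set V -> \bar R}).
Hypothesis d_gt0 : (0 < d)%N.
Hypothesis lamP : is_lebesgue_Rd lam.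
Hypothesis nu_int : (\int[nu]_z (Num.min 1 (enorm z ^+ 2))%:E < +oo)%E.
Variables (L : V -> V -> R) (DpH : V -> V -> V) (F G : V -> probability V R -> R)
  (m0 : probability V R) (T : R) (mu : R -> probability V R) (rho h r eps : R) (N : nat).
Hypothesis rho0 : 0 < rho.
Hypothesis h01 : 0 < h < 1.
Hypothesis r01 : 0 < r < 1.

Local Notation pr := (pairing lam nu L DpH F G m0 T mu rho h r eps N).
Local Notation mint := (m_int lam nu L DpH F G m0 T mu rho h r eps N).
Local Notation avg := (cell_avg lam rho).

Let h0 : 0 < h. Proof. by have /andP[] := h01. Qed.

Variable f : V -> R.
Hypothesis f_lip : Lip1 f.

Let fn (x : V) : R := f x + 1.

Let f_norm1 x y : `|f x - f y| <= 1 * norm1 (x - y).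
Proof. by rewrite mul1r; apply: le_trans (f_lip.2 x y) _; exact: enorm_le_norm1. Qed.

Let mf : measurable_fun [set: V] f.
Proof. exact: (measurable_lipschitz ler01 f_norm1). Qed.

Let mfn : measurable_fun [set: V] fn.
Proof. by apply: measurable_funD. Qed.

Lemma avg_itv i : 0 <= avg fn i <= 2.
Proof.
apply: cell_avg_itv => // x _.
by have := f_lip.1 x; rewrite /fn ler_norml; lra.
Qed.

Let K : R := 1 + d%:R.

Let K1 : 1 <= K. Proof. by rewrite lerDl. Qed.

Lemma avg_center i : `|avg fn i - fn (xg rho i)| <= d%:R * (rho / 2).
Proof.
have := @cell_avg_itv R d lam lamP rho rho0 fn i
  (fn (xg rho i) - d%:R * (rho / 2)) (fn (xg rho i) + d%:R * (rho / 2)) mfn.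
have near_i x : cell rho i x ->
    fn (xg rho i) - d%:R * (rho / 2) <= fn x <= fn (xg rho i) + d%:R * (rho / 2).
  move=> hx; have : `|f x - f (xg rho i)| <= d%:R * (rho / 2).
    apply: le_trans (f_norm1 _ _) _; rewrite mul1r.
    have -> : d%:R * (rho / 2) = \sum_(l < d) (rho / 2).
      by rewrite sumr_const card_ord mulr_natl.
    by apply: ler_sum => l _; rewrite coordB; exact: cell_near.
  by rewrite ler_norml /fn; lra.
by move=> /(_ near_i) /andP[? ?]; rewrite ler_norml; lra.
Qed.

(** Averaging moves each value by at most [d * rho / 2], and distinct grid points are at least [rho]
    apart; hence the constant [1 + d]. *)
Lemma avg_lip i j : `|avg fn i - avg fn j| <= K * enorm (xg rho i - xg rho j : V).
Proof.
have [->|ij] := eqVneq i j.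
  by rewrite subrr normr0 mulr_ge0 ?enorm_ge0// (le_trans ler01 K1).
have he : rho <= enorm (xg rho i - xg rho j : V).
  by rewrite -xgN -xgD; apply: enorm_xg_ge => //; rewrite subr_eq0.
have hf : `|fn (xg rho i) - fn (xg rho j)| <= enorm (xg rho i - xg rho j : V).
  by rewrite /fn opprD addrACA subrr addr0; exact: f_lip.2.
apply: le_trans (ler_dist3 (avg_center i) (avg_center j) hf) _.
rewrite mulrCA [2 * _]mulrC divfK// /K mulrDl mul1r lerD2l.
by rewrite ler_wpM2l.
Qed.

Local Notation dens := (m_dens_k lam nu L DpH F G m0 T mu rho h r eps N).

Lemma integrable_fdensZ (a : R) n :
  lam.-integrable [set: V] (EFin \o (fun x => a * (f x * dens n x))).
Proof.
rewrite (_ : EFin \o _ = (fun x => a%:E * (EFin \o (fun x => (f x * dens n x)%R)) x)%E); last by apply/funext.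
apply: integrableZl => //.
by apply: (@integrable_fdens _ _ _ _ d_gt0 lamP nu_int _ _ _ _ _ _ _ _ _ _ _ _ rho0 h01 r01 n f 1) => //; exact: f_lip.1.
Qed.

Lemma m_intE t : let k := Num.truncn (t / h) in let th := (t - k%:R * h) / h in
  mint t f = \int[lam]_x ((1 - th) * (f x * dens k x) + th * (f x * dens k.+1 x)).
Proof. by move=> k th; apply: eq_Rintegral => x _; rewrite /m_dens -/k -/th; ring. Qed.

Lemma m_int_plin t : mint t f = plin h (fun k => pr k (avg fn)) t - pr 0 (fun=> 1).
Proof.
have dE n : \int[lam]_x (f x * dens n x) = pr n (avg fn) - pr 0 (fun=> 1).
  exact: (Rintegral_dens d_gt0 lamP nu_int _ _ _ _ _ _ _ _ _ rho0 h01 r01 n mf f_lip.1).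
have iE n : lam.-integrable [set: V] (EFin \o (fun x => f x * dens n x)).
  have := integrable_fdensZ 1 n; apply: eq_integrable => // x _ /=.
  by rewrite mul1r.
rewrite m_intE RintegralD//; [|exact: integrable_fdensZ|exact: integrable_fdensZ].
rewrite !RintegralZl// !dE /plin /=; ring.
Qed.

Lemma m_intN t : mint t (fun x => - f x) = - mint t f.
Proof.
rewrite m_intE -mulN1r -RintegralZl//.
  by apply: eq_Rintegral => x _; rewrite /m_dens; ring.
have := integrableD measurableT
  (integrable_fdensZ (1 - (t - (Num.truncn (t / h))%:R * h) / h) (Num.truncn (t / h)))
  (integrable_fdensZ ((t - (Num.truncn (t / h))%:R * h) / h) (Num.truncn (t / h)).+1).
by apply: eq_integrable.
Qed.

Variables (CD C1 M : R).
Hypothesis CD0 : 0 <= CD.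
Hypothesis rhoM : rho ^+ 2 <= M * h.
Hypothesis hC1 : (1 - expR (- (h * lam_r nu r))) * ring_m1 nu r <= C1.
Hypothesis hCD : forall j k, enorm (DpH (xg rho j)
  (grad (w_eps lam nu L F G T mu rho h r eps N (k%:R * h)) (xg rho j))) <= CD.

(** The first-order constant of one step with slope bound [2 * K + 2]; the leading 1 pays for the
    slack of the near-minimizers. *)
Definition rate1 : R := 1 + ((2 * K + 2) * d%:R * (CD + C1) + 2 * levy_mass nu).
Definition rate2 : R := 4 * CD ^+ 2 + 4 * d%:R * (1 + levy_mass nu ^+ 2)
  + 2 * d%:R * levy_mass nu + 2 * d%:R * M + 2 * levy_mass nu.

Hypothesis C10 : 0 <= C1.
Hypothesis M0 : 0 <= M.

Lemma rate1_ge0 : 0 <= rate1.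
Proof.
have k0 := le_trans ler01 K1; have v0 := levy_mass_ge0 nu.
by rewrite /rate1 !addr_ge0// !mulr_ge0// addr_ge0// mulr_ge0.
Qed.

Lemma rate2_ge0 : 0 <= rate2.
Proof.
have v0 := levy_mass_ge0 nu.
have v2 : 0 <= levy_mass nu ^+ 2 by exact: sqr_ge0.
have c2 : 0 <= CD ^+ 2 by exact: sqr_ge0.
have e1 : 0 <= 4 * CD ^+ 2 by apply: mulr_ge0.
have e2 : 0 <= 4 * d%:R * (1 + levy_mass nu ^+ 2) by rewrite mulr_ge0 ?addr_ge0// mulr_ge0.
have e3 : 0 <= 2 * d%:R * levy_mass nu by rewrite mulr_ge0// mulr_ge0.
have e4 : 0 <= 2 * d%:R * M by rewrite mulr_ge0// mulr_ge0.
rewrite /rate2; lra.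
Qed.

(** The envelope lies below the averages, so replacing them costs nothing at time [s] and
    [K ^+ 2 * delta / 2] at time [t]. *)
Lemma one_sided delta s t : 0 < delta -> 0 <= s <= t ->
  mint t f - mint s f <= (rate1 + (2 * delta)^-1 * rate2) * (t - s) + K ^+ 2 * delta / 2.
Proof.
move=> de0 st; rewrite !m_int_plin.
pose g := infconv rho delta (avg fn).
have g2 i : 0 <= g i <= 2 by apply: infconv_itv => //; exact: avg_itv.
have gle i : g i <= avg fn i + 0 by rewrite addr0; apply: infconv_le => //; exact: avg_itv.
have gge i : avg fn i <= g i + K ^+ 2 * delta / 2.
  by apply: le_infconv => //; [exact: avg_itv|exact: avg_lip].
have Kd : 0 <= K ^+ 2 * delta / 2 by rewrite divr_ge0// mulr_ge0 ?sqr_ge0// ltW.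
have P0 : 0 <= 2 * K + 2 by have := K1; lra.
have ia0 : 0 <= (2 * delta)^-1 by rewrite invr_ge0 mulr_ge0// ltW.
pose c := rate1 + (2 * delta)^-1 * rate2.
have c0 : 0 <= c by rewrite addr_ge0 ?rate1_ge0// mulr_ge0 ?rate2_ge0.
have step k : pr k.+1 g <= pr k g + c * h.
  apply: (pairing_step d_gt0 nu_int _ rho0 h01 r01 (b := 2)) => //.
    by rewrite mulr_ge0// ltW.
  move=> j.
  (* The slack is at most [delta] for the slope bound, and at most [h] so that its sum over the
     steps is of order [t - s]. *)
  have eta0 : 0 < Num.min h delta <= delta by rewrite lt_min h0 de0/= ge_min lexx orbT.
  have [p [pP hp]] := infconv_touch de0 K1 avg_itv avg_lip j eta0.
  have A0 : 0 <= g j + Num.min h delta.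
    by have /andP[g0 _] := g2 j; have /andP[/ltW e0 _] := eta0; rewrite addr_ge0.
  apply: le_trans (transition_le d_gt0 nu_int rho0 h01 r01 CD0 P0 rhoM hC1 hCD k ia0 A0 g2 pP hp) _.
  rewrite [leRHS](_ : _ = g j + h
    + h * ((2 * K + 2) * d%:R * (CD + C1) + 2 * levy_mass nu)
    + (2 * delta)^-1 * h * rate2); last by rewrite /c /rate1; ring.
  by apply: lerD; [apply: lerD; [rewrite lerD2l ge_min lexx|exact: lexx]|exact: lexx].
have sl := plin_slope h0 step st.
have /andP[s0 s_t] := st.
have le1 : plin h (fun k => pr k (avg fn)) t <= plin h (fun k => pr k g) t + K ^+ 2 * delta / 2.
  apply: plin_le => //; first exact: le_trans s_t.
  by move=> n; apply: (@pairing_le _ _ _ _ d_gt0 nu_int _ _ _ _ _ _ _ _ _ _ _ _ rho0 h01 r01 n _ _ 2) => //; exact: avg_itv.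
have le2 : plin h (fun k => pr k g) s <= plin h (fun k => pr k (avg fn)) s + 0.
  apply: plin_le => // n.
  by apply: (@pairing_le _ _ _ _ d_gt0 nu_int _ _ _ _ _ _ _ _ _ _ _ _ rho0 h01 r01 n _ _ 2) => //; exact: avg_itv.
rewrite addr0 in le2.
rewrite opprB addrA subrK.
apply: le_trans (lerB le1 le2) _.
by rewrite addrAC lerD2r.
Qed.

End TimeRegularity.

(* delta = sqrt |t1 - t2| balances the smoothing error K^2 delta / 2 against
   the 1 / delta growth of the second-order terms *)
Lemma balance_rates {R : realType} (a b k q s : R) : 0 <= a -> 0 < q -> q <= s ->
  (a + (2 * q)^-1 * b) * (q * q) + k ^+ 2 * q / 2 <=
  (a * s + b / 2 + k ^+ 2 / 2 + 1) * q.
Proof.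
move=> a0 q0 qs.
rewrite [leLHS](_ : _ = (a * q + b / 2 + k ^+ 2 / 2) * q); last first.
  by field; rewrite gt_eqF.
rewrite ler_wpM2r ?(ltW q0)//; have := ler_wpM2l a0 qs; lra.
Qed.

Lemma Lip1N {R : realType} (d : nat) (f : Rd R d -> R) : Lip1 f -> Lip1 (fun x => - f x).
Proof.
move=> [f1 f2]; split=> [x|x y]; first by rewrite normrN.
by rewrite -opprD normrN; exact: f2.
Qed.

Lemma Lip1_cst0 {R : realType} (d : nat) : Lip1 (fun _ : Rd R d => 0 : R).
Proof.
by split=> [x|x y]; rewrite ?subrr normr0 ?ler01// enorm_ge0.
Qed.

(** Taking the same measure twice in (F2) leaves a Lipschitz bound in [x] alone. *)
Lemma d0_self {R : realType} (d : nat) (m : probability (Rd R d) R) : d0 m m = 0.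
Proof.
rewrite /d0 /d0gen (_ : [set _ | _ in _] = [set 0]) ?sup1//.
apply/seteqP; split => [_ [f _ <-]|_ ->]; first by rewrite /= subrr.
by exists (fun=> 0); [exact: Lip1_cst0|rewrite subrr].
Qed.

Theorem mainTheorem14 (R : realType) (d : nat) (T : R)
  (lam nu : {measure set Rd R d -> \bar R})
  (L : Rd R d -> Rd R d -> R) (DpH : Rd R d -> Rd R d -> Rd R d)
  (F G : Rd R d -> probability (Rd R d) R -> R) (m0 : probability (Rd R d) R)
  (sig Cnu : R) :
  (0 < d)%N -> 0 < T ->
  (* lam is the Lebesgue measure on R^d *)
  is_lebesgue_Rd lam ->
  (* nu is a nonnegative measure on R^d \ {0} *)
  nu [set 0] = 0%E ->
  (* (nu0) *)
  (\int[nu]_z (Num.min 1 (enorm z ^+ 2))%:E < +oo)%E ->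
  (* (nu1), with sigma <> 1 *)
  0 < sig < 2 -> 0 < Cnu ->
  (exists g : Rd R d -> R, measurable_fun [set: Rd R d] g /\
     (forall z, 0 < enorm z < 1 -> 0 <= g z <= Cnu * enorm z `^ (- (d%:R + sig))) /\
     (forall A, measurable A -> A `<=` [set z | enorm z < 1] ->
        nu A = (\int[lam]_(z in A) (g z)%:E)%E)) ->
  sig != 1 ->
  (* (L1) *)
  (forall x q1 q2 t, 0 <= t <= 1 ->
     L x (t *: q1 + (1 - t) *: q2) <= t * L x q1 + (1 - t) * L x q2) ->
  (forall x K, exists R0, forall q, R0 <= enorm q -> K * enorm q <= L x q) ->
  (* (L2) *)
  (exists LL, forall x y q, `|L x q - L y q| <= LL * enorm (x - y)) ->
  (* (F2), for F and G *)
  (exists LF, forall x y m1 m2,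
     `|F x m1 - F y m2| <= LF * (enorm (x - y) + d0 m1 m2) /\
     `|G x m1 - G y m2| <= LF * (enorm (x - y) + d0 m1 m2)) ->
  (* (H1): DpH = D_p H, continuous, bounded on bounded sets of p *)
  (forall x p, differentiable (Ham L x) p /\
     forall v, 'd (Ham L x) p v = dotv (DpH x p) v) ->
  (forall x p e, 0 < e -> exists2 del, 0 < del & forall y q,
     enorm (y - x) < del -> enorm (q - p) < del -> enorm (DpH y q - DpH x p) < e) ->
  (forall R0, exists CR, forall x p, enorm p <= R0 -> enorm (DpH x p) <= CR) ->
  forall M, 0 < M -> exists C0, 0 < C0 /\
  forall (rho h r eps : R) (N : nat),
    0 < rho -> h = T / N%:R -> 0 < h < 1 -> 0 < r < 1 -> 0 < eps ->
    rho ^+ 2 / h <= M ->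
    (sig < 1 -> h / r `^ sig <= M) ->
    (1 < sig -> h * r `^ (1 - 2 * sig) <= M) ->
  forall mu : R -> probability (Rd R d) R,
    (* mu in C([0,T], P(R^d)) for the metric d0 *)
    (forall t e, 0 <= t <= T -> 0 < e -> exists2 del, 0 < del &
       forall s, 0 <= s <= T -> `|s - t| < del -> d0 (mu s) (mu t) < e) ->
  forall t1 t2, 0 <= t1 <= T -> 0 <= t2 <= T ->
    d0gen (m_int lam nu L DpH F G m0 T mu rho h r eps N t1)
          (m_int lam nu L DpH F G m0 T mu rho h r eps N t2)
      <= C0 * Num.sqrt `|t1 - t2|.

Proof.
move=> d_gt0 T0 lamP _ nu_int sig02 Cnu0 nu_dens sig1 _ _ [LL LLP] [LF LFP] _ _ hDpH M M0.
have [C1 C10 hC1] := drift_defect lamP nu_int sig02 sig1 Cnu0 M0 nu_dens.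
(* The Lipschitz constant from [u_grid_lip], with absolute values because [LF] and [LL] come without
   a sign. *)
pose KL : R := `|LF| + T * (`|LF| + `|LL|).
have KL0 : 0 <= KL by rewrite addr_ge0// mulr_ge0 ?(ltW T0)// addr_ge0.
have il0 : 0 <= interp_lip d :> R by rewrite !mulr_ge0// addr_ge0// mulr_ge0.
pose Kw : R := interp_lip d * KL.
have Kw0 : 0 <= Kw by rewrite mulr_ge0.
have Km0 : 0 <= eta_mass lam * Kw by rewrite mulr_ge0 ?eta_mass_ge0.
(* The radius bounds the gradient of the mollified value function for all parameters at once:
   [interp_lip] comes from interpolation, [eta_mass] from mollification, [d] from summing partial
   derivatives. *)
have [CR hCR] := hDpH (d%:R * (eta_mass lam * Kw)).
pose CD : R := `|CR|.
have CD0 : 0 <= CD by exact: normr_ge0.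
pose A1 := @rate1 R d nu CD C1; pose A2 := @rate2 R d nu CD M.
pose K : R := 1 + d%:R.
have A10 : 0 <= A1 by exact: rate1_ge0.
have A20 : 0 <= A2 by apply: rate2_ge0 => //; exact: ltW.
have K20 : 0 <= K ^+ 2 by exact: sqr_ge0.
have sT : 0 <= Num.sqrt T by exact: sqrtr_ge0.
exists (A1 * Num.sqrt T + A2 / 2 + K ^+ 2 / 2 + 1).
have C00 : 0 < A1 * Num.sqrt T + A2 / 2 + K ^+ 2 / 2 + 1.
  by have := mulr_ge0 A10 sT; lra.
split=> // rho h r eps N rho0 hE h01 r01 eps0 rhoM _ hsig mu _ t1 t2 t1T t2T.
have /andP[h0 h1] := h01.
have NT : N%:R * h <= T.
  rewrite hE; have [N0|N0] := eqVneq N 0%N; first by rewrite N0 mul0r ltW.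
  by rewrite mulrC divfK// pnatr_eq0.
have rhoM' : rho ^+ 2 <= M * h by rewrite -ler_pdivrMr.
have hCR' j k : enorm (DpH (xg rho j)
    (grad (w_eps lam nu L F G T mu rho h r eps N (k%:R * h)) (xg rho j))) <= CD.
  apply: le_trans (ler_norm CR); apply: hCR; apply: grad_lip => //.
  apply: mollify_lip => // x y; apply: interp_lipschitz => //.
  apply: grid_lip_norm1 => //; apply: u_grid_lip => //.
  - exact: (nu_ge_gt lamP nu_dens).
  - move=> x' y' q; apply: le_trans (LLP _ _ _) _.
    by rewrite ler_wpM2r ?enorm_ge0// ler_norm.
  - move=> x' y' m; have [+ _] := LFP x' y' m m; rewrite d0_self addr0 => /le_trans; apply.
    by rewrite ler_wpM2r ?enorm_ge0// ler_norm.
  - move=> x' y' m; have [_ +] := LFP x' y' m m; rewrite d0_self addr0 => /le_trans; apply.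
    by rewrite ler_wpM2r ?enorm_ge0// ler_norm.
have key (f : Rd R d -> R) s t : Lip1 f -> 0 <= s < t -> t <= T ->
    m_int lam nu L DpH F G m0 T mu rho h r eps N t f
    - m_int lam nu L DpH F G m0 T mu rho h r eps N s f
    <= (A1 * Num.sqrt T + A2 / 2 + K ^+ 2 / 2 + 1) * Num.sqrt (t - s).
  move=> fL /andP[s0 st] tT.
  have ts0 : 0 < t - s by rewrite subr_gt0.
  have q0 : 0 < Num.sqrt (t - s) by rewrite sqrtr_gt0.
  have st' : 0 <= s <= t by rewrite s0 ltW.
  have qT : Num.sqrt (t - s) <= Num.sqrt T by rewrite ler_sqrt ?(ltW T0)//; lra.
  have := one_sided d_gt0 lamP nu_int m0 rho0 h01 r01 fL CD0 rhoM' (hC1 h r h0 r01 hsig)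
    hCR' C10 (ltW M0) q0 st'.
  rewrite -/A1 -/A2 -/K => /le_trans; apply.
  set q := Num.sqrt (t - s).
  have qq : t - s = q * q by rewrite -expr2 sqr_sqrtr// ltW.
  by rewrite qq; exact: balance_rates.
apply: ge_sup.
  by eexists; exists (fun=> 0); [exact: Lip1_cst0|reflexivity].
move=> _ [f fL <-].
have [t12|t12|<-] := ltgtP t1 t2.
- have /andP[t10 _] := t1T; have /andP[_ t2T'] := t2T.
  have := key _ t1 t2 (Lip1N fL) _ t2T'; rewrite t10 t12 => /(_ isT).
  rewrite !(m_intN d_gt0 lamP nu_int) // opprK addrC distrC ger0_norm// subr_ge0 ltW//.
- have /andP[t20 _] := t2T; have /andP[_ t1T'] := t1T.
  have := key _ t2 t1 fL _ t1T'; rewrite t20 t12 => /(_ isT).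
  by rewrite ger0_norm// subr_ge0 ltW.
by rewrite !subrr normr0 sqrtr0 mulr0.
Qed.
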